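(* Let $\mathcal{L}$ be a supersolvable geometric lattice and let $\mathcal{G}_{\min}$ be the building set of irreducible elements of $\mathcal{L}$. Then the algebra $\mathrm{FY}(\mathcal{L},\mathcal{G}_{\min})$ admits a quadratic Gröbner basis and is therefore Koszul.
   Context: A geometric lattice is a finite lattice $\mathcal{L}$ (least element $\hat 0$, greatest element $\hat 1$, join $\vee$, meet $\wedge$) in which all maximal chains between two comparable elements have the same cardinality, whose rank function $\rho$ satisfies $\rho(X\wedge Y)+\rho(X\vee Y)\le\rho(X)+\rho(Y)$, and in which every element is a join of atoms (elements of rank 1). A lattice $\mathcal{L}$ is supersolvable if it admits a maximal chain $\Delta$ such that for every chain $K$ in $\mathcal{L}$ the sublattice generated by $\Delta$ and $K$ is distributive. A building set of $\mathcal{L}$ is a subset $\mathcal{G}\subset\mathcal{L}\setminus\{\hat 0\}$ such that for every $X\in\mathcal{L}$ the join map $\prod_{G\in\max\mathcal{G}_{\le X}}[\hat 0,G]\to[\hat 0,X]$ is an isomorphism of posets, where $\max\mathcal{G}_{\le X}$ is the set of maximal elements of $\mathcal{G}\cap[\hat 0,X]$. An element $G\neq\hat 0$ of $\mathcal{L}$ is irreducible if $[\hat 0,G]$ is not a product of proper subposets; the set $\mathcal{G}_{\min}$ of irreducible elements is the unique minimal building set of $\mathcal{L}$. For a building set $\mathcal{G}$, the Feichtner--Yuzvinsky ring is the graded commutative ring $\mathrm{FY}(\mathcal{L},\mathcal{G})=\mathbb{Z}[h_G,\ G\in\mathcal{G}]/\mathcal{I}_{\mathrm{wond}}$, where $\mathcal{I}_{\mathrm{wond}}$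 is generated by $h_H$ for every atom $H$ and by $\prod_{G'\in\mathcal{A}}(h_G-h_{G'})$ for every $G\in\mathcal{G}$ and every antichain $\mathcal{A}$ in $\mathcal{G}$ with $\bigvee\mathcal{A}=G$. Each $h_G$ has weight 1 (cohomological degree 2). An algebra admits a quadratic Gröbner basis if it can be presented as the quotient of a polynomial ring on generators of weight 1 by a homogeneous ideal which, for some monomial order, has a Gröbner basis consisting of homogeneous elements of weight 2; over $\mathbb{Z}$ a Gröbner basis is understood with leading coefficients $\pm1$. (Here, the generators $h_H$ with $H$ an atom, which are zero, are discarded.) Koszulness is with respect to the weight grading: $\mathrm{Tor}^{A}_{i}(\mathbb{Z},\mathbb{Z})$ is concentrated in weight $i$ for all $i$. *)

(* Defs.v *)
From HB Require Import structures.
From mathcomp Require Import all_boot all_order all_algebra.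
From mathcomp Require Import generic_quotient ring_quotient.
From mathcomp.classical Require Import boolp.
From mathcomp.multinomials Require Import mpoly.

Set Implicit Arguments.
Unset Strict Implicit.
Unset Printing Implicit Defensive.

Import Order.TTheory GRing.Theory Num.Theory.

Section Lattices.
Local Open Scope order_scope.
Variables (d : Order.disp_t) (L : finTBLatticeType d).
Implicit Types (x y z : L) (C D K S : {set L}).

Definition itv_set x y : {set L} := [set z | x <= z <= y].

Definition is_chain C : bool := [forall x in C, forall y in C, x >=< y].

Definition is_max_chain x y C : bool :=
  maxset (fun D => is_chain D && (D \subset itv_set x y)) C.

Definition rank x : nat :=
  (\max_(C : {set L} | is_chain C && (C \subset itv_set \bot x)) #|C|).-1.

Definition is_atom x : bool := rank x == 1%N.

Definition geometric : Prop :=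
  [/\ forall x y C D, x <= y ->
        is_max_chain x y C -> is_max_chain x y D -> #|C| = #|D|,
      forall x y, (rank (x `&` y) + rank (x `|` y) <= rank x + rank y)%N
    & forall x, exists2 A : {set L},
        {in A, forall a, is_atom a} & x = \join_(a in A) a].

Definition is_sublattice S : bool :=
  [forall x in S, forall y in S, (x `&` y \in S) && (x `|` y \in S)].

Definition gen_sublattice S : {set L} :=
  \bigcap_(T : {set L} | is_sublattice T && (S \subset T)) T.

Definition distributive_on S : Prop :=
  {in S & &, forall x y z, x `&` (y `|` z) = (x `&` y) `|` (x `&` z)}.

Definition supersolvable : Prop :=
  exists2 D, is_max_chain \bot \top D &
    forall K, is_chain K -> distributive_on (gen_sublattice (D :|: K)).

(* [f] restricts to an isomorphism of posets from the product [A * B] onto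
   [C]; injectivity follows from order reflection. *)
Definition prod_poset_iso (A B C : {set L}) (f : {ffun L * L -> L}) : bool :=
  [&& [forall u in setX A B, f u \in C],
      [forall u in setX A B, forall v in setX A B,
         (f u <= f v) == (u.1 <= v.1) && (u.2 <= v.2)]
    & [forall z in C, exists u in setX A B, f u == z]].

(* Binary products suffice: a product of several proper subposets can be
   bracketed as a product of two of them. *)
Definition irreducible x : bool :=
  (x != \bot) &&
  ~~ [exists A : {set L}, exists B : {set L}, exists f : {ffun L * L -> L},
        [&& A \proper itv_set \bot x, B \proper itv_set \bot x
          & prod_poset_iso A B (itv_set \bot x) f]].

Definition Gmin : {set L} := [set x | irreducible x].

End Lattices.

Arguments geometric {d} L.
Arguments supersolvable {d} L.
Arguments Gmin {d} L.

Local Open Scope ring_scope.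

(* [ring_quotient] only puts a ring structure on quotients by proper ideals;
   the quotients here may be trivial. *)
Section GeneratedIdeal.
Local Open Scope quotient_scope.
Variables (R : comNzRingType) (S : R -> Prop).

Definition gen_ideal : R -> bool := fun p =>
  `[< exists2 s : seq (R * R), (forall u, u \in s -> S u.2) &
        p = \sum_(u <- s) u.1 * u.2 >].

Lemma gen_idealMr (a p : R) : p \in gen_ideal -> a * p \in gen_ideal.
Proof.
move=> /asboolP[s sS ->]; apply/asboolP.
exists [seq (a * u.1, u.2) | u <- s] => [u /mapP[v vs ->]|]; first exact: (sS v).
by rewrite big_map mulr_sumr; apply: eq_bigr => u _; rewrite mulrA.
Qed.

Lemma gen_ideal_zmod_closed : zmod_closed gen_ideal.
Proof.
split=> [|p q pI qI].
  by apply/asboolP; exists [::] => [u|]; rewrite ?in_nil ?big_nil.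
have := gen_idealMr (-1) qI; rewrite mulN1r.
move: pI => /asboolP[s sS ->] /asboolP[t tS ->]; apply/asboolP.
exists (s ++ t); last by rewrite big_cat.
by move=> u; rewrite mem_cat => /orP[/sS|/tS].
Qed.

HB.instance Definition _ :=
  GRing.isZmodClosed.Build R gen_ideal gen_ideal_zmod_closed.

Definition quot_ring := {ideal_quot (GRing.ZmodClosed.clone R gen_ideal _)}.

HB.instance Definition _ := GRing.Zmodule.on quot_ring.
HB.instance Definition _ := EqQuotient.on quot_ring.

Definition quot_pi (p : R) : quot_ring := \pi_quot_ring p.
Definition quot_one : quot_ring := quot_pi 1.
Definition quot_mul (a b : quot_ring) : quot_ring := quot_pi (repr a * repr b).

Lemma quot_piP (p q : R) : quot_pi p = quot_pi q <-> p - q \in gen_ideal.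
Proof. by rewrite Quotient.idealrBE; split=> /eqP. Qed.

Lemma quot_piM : {morph quot_pi : p q / p * q >-> quot_mul p q}.
Proof.
move=> p q; apply/quot_piP.
have rP x : x - repr (quot_pi x) \in gen_ideal.
  by apply/quot_piP; rewrite /quot_pi reprK.
set p' := repr _; set q' := repr _.
have -> : p * q - p' * q' = q * (p - p') + p' * (q - q').
  by rewrite !mulrBr [q * p]mulrC [q * p']mulrC addrA subrK.
by apply: rpredD; apply: gen_idealMr; apply: rP.
Qed.

Let piK (a : quot_ring) : quot_pi (repr a) = a. Proof. exact: reprK. Qed.

Let quot_mulA : associative quot_mul.
Proof.
by move=> a b c; rewrite -[a]piK -[b]piK -[c]piK -!quot_piM mulrA.
Qed.

Let quot_mulC : commutative quot_mul.
Proof. by move=> a b; rewrite -[a]piK -[b]piK -!quot_piM mulrC. Qed.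

Let quot_mul1 : left_id quot_one quot_mul.
Proof. by move=> a; rewrite -[a]piK -quot_piM mul1r. Qed.

Fact quot_pi_is_zmod_morphism : zmod_morphism quot_pi.
Proof. by move=> p q; rewrite /quot_pi raddfB. Qed.

HB.instance Definition _ :=
  GRing.isZmodMorphism.Build R quot_ring quot_pi quot_pi_is_zmod_morphism.

Let quot_mulDl : left_distributive quot_mul +%R.
Proof.
move=> a b c; rewrite -[a]piK -[b]piK -[c]piK.
by rewrite -raddfD -!quot_piM mulrDl raddfD.
Qed.

HB.instance Definition _ := GRing.Zmodule_isComPzRing.Build quot_ring
  quot_mulA quot_mulC quot_mul1 quot_mulDl.

Fact quot_pi_is_monoid_morphism : monoid_morphism quot_pi.
Proof. by split=> // p q; rewrite quot_piM. Qed.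

HB.instance Definition _ :=
  GRing.isMonoidMorphism.Build R quot_ring quot_pi quot_pi_is_monoid_morphism.

End GeneratedIdeal.

Section FeichtnerYuzvinsky.
Variables (d : Order.disp_t) (L : finTBLatticeType d) (G : {set L}).

(* The variable ['X_i] stands for [h_(enum_val i)]. *)
Definition antichain (A : {set 'I_#|G|}) : bool :=
  [forall i in A, forall j in A, (i != j) ==> (enum_val i >< enum_val j)%O].

Variant wond_rel : {mpoly int[#|G|]} -> Prop :=
| WondAtom (i : 'I_#|G|) of is_atom (enum_val i) : wond_rel 'X_i
| WondAntichain (i : 'I_#|G|) (A : {set 'I_#|G|}) of antichain A
    & (\join_(j in A) enum_val j)%O = enum_val i :
    wond_rel (\prod_(j in A) ('X_i - 'X_j)).

Definition FY : comPzRingType := quot_ring wond_rel.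

Definition FY_weight (w : nat) (a : FY) : Prop :=
  exists2 p : {mpoly int[#|G|]}, p \is w.-homog & a = quot_pi wond_rel p.

End FeichtnerYuzvinsky.

Arguments FY {d L} G.
Arguments FY_weight {d L} G w a.

Section Groebner.
Variable n : nat.
Implicit Types (le : rel 'X_{1..n}) (m : 'X_{1..n}) (p g : {mpoly int[n]}).

Definition monomial_order le : Prop :=
  [/\ total le, antisymmetric le, transitive le, forall m, le 0%MM m
    & forall m1 m2 m, le m1 m2 -> le (m1 + m)%MM (m2 + m)%MM].

Definition lead_mon le p m : Prop :=
  m \in msupp p /\ {in msupp p, forall m', le m' m}.

(* As leading coefficients are units, divisibility of leading monomials says
   that the leading terms of [gb] generate the ideal of leading terms of [I]. *)
Definition groebner_basis le (I : {mpoly int[n]} -> Prop)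
    (gb : seq {mpoly int[n]}) : Prop :=
  [/\ {in gb, forall g, I g},
      {in gb, forall g, exists2 m, lead_mon le g m & g@_m = 1 \/ g@_m = -1}
    & forall p m, I p -> lead_mon le p m ->
        exists g m', [/\ g \in gb, lead_mon le g m' & (m' <= m)%MM]].

Definition homogeneous_ideal (I : {mpoly int[n]} -> Prop) : Prop :=
  forall p w, I p -> I (pihomog mdeg w p).

End Groebner.

(* [W w] is the homogeneous component of weight [w] of the graded ring [A]; the
   ideal of the presentation is the kernel of [phi]. *)
Definition admits_quadratic_groebner_basis
    (A : comPzRingType) (W : nat -> A -> Prop) : Prop :=
  exists (n : nat) (phi : {rmorphism {mpoly int[n]} -> A}),
  let I p := phi p = 0 in
  [/\ forall a, exists p, a = phi p,
      forall w a, W w a <-> exists2 p, p \is w.-homog & a = phi p,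
      homogeneous_ideal I
    & exists (le : rel 'X_{1..n}) (gb : seq {mpoly int[n]}),
        [/\ monomial_order le, {in gb, forall g, g \is 2.-homog}
          & groebner_basis le I gb]].

(* Graded free left modules of finite rank are modules of row vectors:
   [cdeg i k] is the weight of the [k]-th basis element in homological degree
   [i], and the differential is [v |-> v *m cdiff i]. *)
Record free_complex (A : comPzRingType) := FreeComplex {
  crank : nat -> nat;
  cdeg : forall i, 'I_(crank i) -> nat;
  cdiff : forall i, 'M[A]_(crank i.+1, crank i);
  caug : 'cV[int]_(crank 0)
}.
Arguments cdeg {A} _ {i} _.

Section Koszul.
Variables (A : comPzRingType) (W : nat -> A -> Prop) (eps : {rmorphism A -> int}).
Implicit Type P : free_complex A.

Definition graded_complex P : Prop :=
  (forall k, cdeg P k <> 0%N -> caug P k 0 = 0) /\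
  forall i j k,
    if (cdeg P k <= cdeg P j)%N
    then W (cdeg P j - cdeg P k) (cdiff P i j k)
    else cdiff P i j k = 0.

(* Exactness of [... -> P_1 -> P_0 -> Z -> 0], where [A] acts on [Z] through
   [eps]. *)
Definition resolves_int P : Prop :=
  [/\ exists v : 'rV[A]_(crank P 0), map_mx eps v *m caug P = 1%:M,
      forall v : 'rV[A]_(crank P 0),
        map_mx eps v *m caug P = 0 <-> exists w, v = w *m cdiff P 0
    & forall i (v : 'rV[A]_(crank P i.+1)),
        v *m cdiff P i = 0 <-> exists w, v = w *m cdiff P i.+1].

Definition tensor_diff P i : 'M[int]_(crank P i.+1, crank P i) :=
  map_mx eps (cdiff P i).

Definition has_weight P i (w : nat) (v : 'rV[int]_(crank P i)) : Prop :=
  forall k, cdeg P k <> w -> v 0 k = 0.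

Definition is_cycle P i : 'rV[int]_(crank P i) -> Prop :=
  if i is i'.+1 then fun v => v *m tensor_diff P i' = 0 else fun=> True.

(* The weight [w] part of [H_i (Z (x)_A P)] is zero. *)
Definition Tor_weight_vanishes P i w : Prop :=
  forall v : 'rV[int]_(crank P i), has_weight w v -> is_cycle v ->
    exists2 u : 'rV[int]_(crank P i.+1),
      has_weight w u & v = u *m tensor_diff P i.

End Koszul.

(* [eps] is the augmentation [A -> A / A_(>0) = Z].  [Tor^A (Z, Z)] may be
   computed from any graded free resolution of [Z]; one of finite ranks exists
   as soon as [A] is a finitely generated algebra. *)
Definition koszul (A : comPzRingType) (W : nat -> A -> Prop) : Prop :=
  exists2 eps : {rmorphism A -> int},
    forall w a, (0 < w)%N -> W w a -> eps a = 0 &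
  exists P : free_complex A,
    [/\ graded_complex W P, resolves_int eps P
      & forall i w, w <> i -> Tor_weight_vanishes eps P i w].

(* Main.v *)
From HB Require Import structures.
Require Import Defs.
From mathcomp Require Import all_boot all_order all_algebra.
From mathcomp.classical Require Import boolp.
From mathcomp.multinomials Require Import mpoly.
From mathcomp Require Import ring zify.

Set Implicit Arguments.
Unset Strict Implicit.
Unset Printing Implicit Defensive.

Import Order.TTheory GRing.Theory Num.Theory.

(** Let [Delta : \bot = X 0 < X 1 < ... < X M = \top] be the given maximal
    chain, [G] the set of irreducible elements and [x_- = x `&` X k] for an
    element [x] that is new at level [k + 1], i.e. below [X k.+1] and not below
    [X k].  The elements of [Delta] are modular, so that meeting with [X k]
    commutes with joining elements below [X k], and a new [x] is recovered from
    [x_-] and any new element below [x].  It follows that [x_-] is irreducible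
    or [\bot] whenever [x] is irreducible, and that two irreducible elements
    that are new at the same level have an irreducible join
    ([Gmin_meet_flag], [Gmin_join_new]).

    Consequently a set of at least two irreducible elements whose join is
    irreducible contains two distinct elements with irreducible join
    ([pairwise_join_notin]), and merging such pairs writes every defining
    relation of the ring in terms of the quadrics
    [(h (a `|` b) - h a) * (h (a `|` b) - h b)], with [h = 0] on atoms
    ([antichain_relation], [FY_map_kernel]).

    Order the variables by decreasing level and, inside a level, so that smaller
    elements of the lattice give larger variables.  Two sorts of quadrics lie in
    the ideal.  If [x] and [y] are new at the same level and [c = x `|` y], then
    [h x * h y = h c_- * (h x + h y - h c)].  If [x] is new and [y] is old, and
    [y] is not the preferred representative among the irreducible [g] with the
    same join [g `|` x_-], then [h x * h y] is expressed by smaller monomials.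
    This gives a set of bad pairs of variables whose products are leading
    monomials ([bad_pair_quadric]).

    That these quadrics form a Groebner basis amounts to the linear independence
    of the monomials without bad pair.  It is proved by induction along the
    flag, for a larger family of ideals: [stratum_ideal k N] describes the part
    of the ring below [X k] restricted to the stratum of a nested set [N] of the
    wonderful compactification, where [h (f `|` a)] and [h a] agree for [f] in
    [N].  One level of the flag is modelled by a free module with basis [1] and
    one vector for each new irreducible element, on which the variables act by
    the product formula above, modulo a submodule [vanishing].  The actions
    commute modulo [vanishing] ([mulV_comm]) and the ideal acts by zero
    ([eval_stratum_ideal]); a normal monomial contains at most one new variable,
    and linear functionals on the module ([vanish_basis0], [vanish_residue])
    separate these cases and reduce to the strata one level below
    ([independence_step], [normal_independent]).

    Koszulness is deduced from the shape of the leading monomials alone.  If the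
    leading terms of a module of relations are generated by multiples of basis
    vectors by variables, together with the quadratic leading monomials of the
    ideal, then its linear generators have a module of syzygies of the same kind
    ([syzygy_class]), as for Schreyer's syzygies.  Starting from the augmentation
    ideal, one obtains a free resolution of the integers whose matrices have
    linear entries ([koszul_of_linear_resolution]), so that [Tor_i] is
    concentrated in weight [i]. *)

(** * Rank and atoms in a geometric lattice *)

Section GeometricLattice.
Local Open Scope order_scope.
Variables (d : Order.disp_t) (L : finTBLatticeType d).
Implicit Types (x y z u v w a b p q : L) (C D K S : {set L}).

Lemma chainP C : reflect {in C &, forall x y, x >=< y} (is_chain C).
Proof.
apply: (iffP 'forall_implyP) => [h x y xC yC|h x xC].
  by have /'forall_implyP := h x xC; apply.
by apply/'forall_implyP => y yC; apply: h.
Qed.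

Lemma chain_setU1 y C : is_chain C -> {in C, forall x, x >=< y} ->
  is_chain (y |: C).
Proof.
move=> /chainP cC h; apply/chainP => u v /setU1P[->|uC] /setU1P[->|vC].
- exact: comparablexx.
- by rewrite comparable_sym h.
- exact: h.
- exact: cC.
Qed.

Lemma chain_set0 : is_chain (set0 : {set L}).
Proof. by apply/chainP => x y; rewrite inE. Qed.

Definition chain_below x C := is_chain C && (C \subset itv_set \bot x).

Lemma chain_below1 x : chain_below x [set x].
Proof.
rewrite /chain_below sub1set inE le0x lexx andbT.
by rewrite -[[set x]]setU0 chain_setU1 ?chain_set0 // => y; rewrite inE.
Qed.

Lemma rank_ub x C : chain_below x C -> (#|C| <= (rank x).+1)%N.
Proof.
move=> xC; rewrite /rank prednK; first exact: leq_bigmax_cond.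
by apply: leq_trans (leq_bigmax_cond _ (chain_below1 x)); rewrite cards1.
Qed.

Lemma rank_witness x : exists2 C, chain_below x C & #|C| = (rank x).+1.
Proof.
have pos : (0 < #|[pred C | chain_below x C]|)%N.
  by apply/card_gt0P; exists [set x]; rewrite inE chain_below1.
have [C xC e] := eq_bigmax_cond (fun C : {set L} => #|C|) pos.
have xC' : chain_below x C by [].
exists C => //; rewrite /rank; move: (e); rewrite /= => ->; rewrite prednK //.
rewrite -[#|C|]e; apply: leq_trans (leq_bigmax_cond _ (chain_below1 x)).
by rewrite cards1.
Qed.

Lemma rank_lt x y : x < y -> (rank x < rank y)%N.
Proof.
move=> xy; have [C /andP[cC /subsetP sC] eC] := rank_witness x.
have lx z : z \in C -> z <= x by move/sC; rewrite inE => /andP[].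
have yC : y \notin C by apply/negP => /lx; rewrite lt_geF.
rewrite -eC -ltnS (_ : #|C|.+1 = #|y |: C|); last by rewrite cardsU1 yC.
apply: rank_ub; rewrite /chain_below chain_setU1 //=; last first.
  by move=> z /lx zx; rewrite /Order.comparable (le_trans zx (ltW xy)).
apply/subsetP => z /setU1P[->|/lx zx]; rewrite inE le0x ?lexx //=.
exact: le_trans zx (ltW xy).
Qed.

Lemma rank_le x y : x <= y -> (rank x <= rank y)%N.
Proof. by rewrite le_eqVlt => /predU1P[->//|/rank_lt/ltnW]. Qed.

Lemma rank_le_eq x y : x <= y -> (rank y <= rank x)%N -> x = y.
Proof. by rewrite le_eqVlt => /predU1P[//|/rank_lt]; rewrite ltnNge => /negP. Qed.

Lemma rank0 : rank (\bot : L) = 0%N.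
Proof.
have [C /andP[_ /subsetP sC] eC] := rank_witness \bot.
have := eC; rewrite (_ : C = [set \bot]) ?cards1; first by case.
have: C \subset [set \bot].
  by apply/subsetP => z /sC; rewrite !inE lex0 le0x.
by rewrite subset1 => /orP[/eqP//|/eqP C0]; move: eC; rewrite C0 cards0.
Qed.

Lemma atom_neq0 a : is_atom a -> a != \bot.
Proof. by rewrite /is_atom; apply: contraTneq => ->; rewrite rank0. Qed.

Lemma le_atom a x : is_atom a -> x <= a -> x = \bot \/ x = a.
Proof.
move=> /eqP ra; rewrite le_eqVlt => /predU1P[->|/rank_lt]; first by right.
rewrite ra ltnS leqn0 => /eqP rx; left; apply/esym/rank_le_eq; rewrite ?le0x //.
by rewrite rx.
Qed.

Hypothesis Lgeo : geometric L.

Lemma rank_semimod x y : (rank (x `&` y) + rank (x `|` y) <= rank x + rank y)%N.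
Proof. by case: Lgeo. Qed.

Lemma rank_joina y a : is_atom a -> (rank (y `|` a) <= (rank y).+1)%N.
Proof.
move=> /eqP ra; have := rank_semimod y a; rewrite ra addn1.
exact/leq_trans/leq_addl.
Qed.

Lemma joina_cover y a z : is_atom a -> y < z -> z <= y `|` a -> z = y `|` a.
Proof.
move=> aa /rank_lt yz za; apply: rank_le_eq => //.
exact: leq_trans (rank_joina y aa) yz.
Qed.

Lemma atomP x y : reflect (exists2 a, is_atom a & a <= x /\ ~~ (a <= y))
  (~~ (x <= y)).
Proof.
apply: (iffP negP) => [xy|[a _ [ax ay] xy]]; last first.
  by move: ay; rewrite (le_trans ax xy).
have [_ _ /(_ x)[A atA eA]] := Lgeo.
have [a /andP[aA ay]] : exists a, (a \in A) && ~~ (a <= y).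
  apply/existsP; apply: contra_notT xy => /existsPn h.
  rewrite eA; apply/joinsP => a aA.
  by have := h a; rewrite aA /= negbK.
by exists a; [exact: atA | split=> //; rewrite eA joins_sup].
Qed.

Lemma le_atomP x y : (forall a, is_atom a -> a <= x -> a <= y) -> x <= y.
Proof.
move=> h; apply/negPn/negP => /atomP[a aa [ax]].
by rewrite (h _ aa ax).
Qed.

End GeometricLattice.

(** * Irreducible elements *)

Section Irreducibles.
Local Open Scope order_scope.
Variables (d : Order.disp_t) (L : finTBLatticeType d).
Implicit Types (x y z u v w a b p q : L).

(** The lattice form of a decomposition [[\bot, x] = [\bot, y] * [\bot, z]] into
    two nontrivial intervals: the join map is bijective because its inverse is
    given by the meets with [y] and [z]. *)
Record direct_sum x y z : Prop := DirectSum {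
  dsum_neq0l : y != \bot;
  dsum_neq0r : z != \bot;
  dsum_join : y `|` z = x;
  dsum_atom : forall a, is_atom a -> a <= x -> a <= y \/ a <= z;
  dsum_meetl : forall u v, u <= y -> v <= z -> (u `|` v) `&` y = u;
  dsum_meetr : forall u v, u <= y -> v <= z -> (u `|` v) `&` z = v }.

Lemma direct_sumC x y z : direct_sum x y z -> direct_sum x z y.
Proof.
case=> y0 z0 yz at_ ml mr; split=> //; first by rewrite joinC.
- by move=> a aa /(at_ _ aa)[]; [right | left].
- by move=> u v uz vy; rewrite joinC mr.
- by move=> u v uz vy; rewrite joinC ml.
Qed.

Lemma direct_sum_meet x y z : direct_sum x y z -> y `&` z = \bot.
Proof. by case=> _ _ _ _ ml _; rewrite meetC -[z]join0x ml ?le0x. Qed.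

Lemma GminE x : (x \in Gmin L) = irreducible x.
Proof. by rewrite inE. Qed.

Lemma bot_notin_Gmin : \bot \notin Gmin L.
Proof. by rewrite GminE /irreducible eqxx. Qed.

Lemma prod_poset_isoP (A B C : {set L}) (f : {ffun L * L -> L}) :
  prod_poset_iso A B C f ->
  [/\ {in A & B, forall u v, f (u, v) \in C},
      forall u v u' v', u \in A -> v \in B -> u' \in A -> v' \in B ->
        (f (u, v) <= f (u', v')) = (u <= u') && (v <= v')
    & forall z, z \in C -> exists u v, [/\ u \in A, v \in B & f (u, v) = z]].
Proof.
case/and3P=> /'forall_implyP h1 /'forall_implyP h2 /'forall_implyP h3; split.
- by move=> u v uA vB; apply: (h1 (u, v)); rewrite inE uA vB.
- move=> u v u' v' uA vB uA' vB'.
  have /'forall_implyP h : [forall v0 in setX A B, (f (u, v) <= f v0) == (u <= v0.1) && (v <= v0.2)].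
    by apply: (h2 (u, v)); rewrite inE uA vB.
  by apply/eqP/(h (u', v')); rewrite inE uA' vB'.
- move=> z zC; have /'exists_andP[[u v] [/=]] := h3 z zC.
  by rewrite inE => /andP[/= uA vB] /eqP <-; exists u, v.
Qed.

(** The factors of a product decomposition have least and greatest elements; the
    images of the two pairs formed by one greatest and one least element are the
    two summands.  They are not [\bot] because the factors are proper, and an atom
    has only one component that differs from the least element. *)
Lemma reducible_direct_sum x : x != \bot -> x \notin Gmin L ->
  exists y z, direct_sum x y z.
Proof.
move=> x0; rewrite GminE /irreducible x0 /= negbK.
case/existsP=> A /existsP[B /existsP[f /and3P[pA pB iso]]].
have [fC fle fsurj] := prod_poset_isoP iso.
have itvE z : (z \in itv_set \bot x) = (z <= x) by rewrite inE le0x.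
have [|a0 [b0 [a0A b0B e0]]] := fsurj \bot; first by rewrite itvE le0x.
have [|a1 [b1 [a1A b1B e1]]] := fsurj x; first by rewrite itvE.
have a0_le u : u \in A -> a0 <= u.
  move=> uA; have := fle a0 b0 u b0 a0A b0B uA b0B.
  by rewrite e0 le0x => /esym/andP[].
have b0_le v : v \in B -> b0 <= v.
  move=> vB; have := fle a0 b0 a0 v a0A b0B a0A vB.
  by rewrite e0 le0x => /esym/andP[].
have le_a1 u : u \in A -> u <= a1.
  move=> uA; have := fle u b0 a1 b1 uA b0B a1A b1B.
  by rewrite e1 -itvE fC // => /esym/andP[].
have le_b1 v : v \in B -> v <= b1.
  move=> vB; have := fle a0 v a1 b1 a0A vB a1A b1B.
  by rewrite e1 -itvE fC // => /esym/andP[].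
pose y := f (a1, b0); pose z := f (a0, b1).
have yx : y <= x by rewrite -itvE fC.
have zx : z <= x by rewrite -itvE fC.
have f_join u v : u \in A -> v \in B -> f (u, b0) `|` f (a0, v) = f (u, v).
  move=> uA vB; apply/le_anti/andP; split.
    by rewrite leUx !fle // !lexx a0_le ?b0_le.
  have [|u' [v' [uA' vB' e']]] := fsurj (f (u, b0) `|` f (a0, v)).
    by rewrite itvE leUx -!itvE !fC.
  rewrite -e' fle //.
  have: f (u, b0) <= f (u', v') by rewrite e' leUl.
  have: f (a0, v) <= f (u', v') by rewrite e' leUr.
  by rewrite !fle // => /andP[_ ->] /andP[-> _].
have f_meetl u v : u \in A -> v \in B -> f (u, v) `&` y = f (u, b0).
  move=> uA vB; apply/le_anti/andP; split; last first.
    by rewrite lexI !fle // !lexx b0_le ?le_a1.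
  have [|u' [v' [uA' vB' e']]] := fsurj (f (u, v) `&` y).
    by rewrite itvE (le_trans (leIr _ _)).
  have: f (u', v') <= f (u, v) by rewrite e' leIl.
  have: f (u', v') <= y by rewrite e' leIr.
  by rewrite -e' !fle // => /andP[_ ->] /andP[-> _].
have f_meetr u v : u \in A -> v \in B -> f (u, v) `&` z = f (a0, v).
  move=> uA vB; apply/le_anti/andP; split; last first.
    by rewrite lexI !fle // !lexx a0_le ?le_b1.
  have [|u' [v' [uA' vB' e']]] := fsurj (f (u, v) `&` z).
    by rewrite itvE (le_trans (leIr _ _)).
  have: f (u', v') <= f (u, v) by rewrite e' leIl.
  have: f (u', v') <= z by rewrite e' leIr.
  by rewrite -e' !fle // => /andP[-> _] /andP[_ ->].
have below_y u : u <= y -> exists2 u', u' \in A & u = f (u', b0).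
  move=> uy; have [|u' [v' [uA' vB' e']]] := fsurj u.
    by rewrite itvE (le_trans uy).
  by exists u' => //; rewrite -(f_meetl _ v') // e' (meet_idPl uy).
have below_z u : u <= z -> exists2 v', v' \in B & u = f (a0, v').
  move=> uz; have [|u' [v' [uA' vB' e']]] := fsurj u.
    by rewrite itvE (le_trans uz).
  by exists v' => //; rewrite -(f_meetr u') // e' (meet_idPl uz).
have inj u v u' v' : u \in A -> v \in B -> u' \in A -> v' \in B ->
    f (u, v) = f (u', v') -> u = u' /\ v = v'.
  move=> uA vB uA' vB' e.
  have := lexx (f (u, v)); rewrite {2}e fle // => /andP[uu vv].
  have := lexx (f (u, v)); rewrite {1}e fle // => /andP[uu' vv'].
  by split; apply/le_anti/andP.
exists y, z; split.
- apply: contraTneq pB => y0; have [aa _] : a1 = a0 /\ b0 = b0.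
    by apply: inj; rewrite ?e0.
  have A1 u : u \in A -> u = a0.
    by move=> uA; apply/le_anti; rewrite a0_le // -{1}aa le_a1.
  have cardB : (#|itv_set \bot x| <= #|B|)%N.
    apply: leq_trans (leq_imset_card (fun v => f (a0, v)) B).
    apply/subset_leq_card/subsetP => w /fsurj[u [v [uA vB <-]]].
    by apply/imsetP; exists v => //; rewrite (A1 u).
  by apply/negP => /proper_card; rewrite ltnNge cardB.
- apply: contraTneq pA => z0; have [_ bb] : a0 = a0 /\ b1 = b0.
    by apply: inj; rewrite ?e0.
  have B1 v : v \in B -> v = b0.
    by move=> vB; apply/le_anti; rewrite b0_le // -{1}bb le_b1.
  have cardA : (#|itv_set \bot x| <= #|A|)%N.
    apply: leq_trans (leq_imset_card (fun u => f (u, b0)) A).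
    apply/subset_leq_card/subsetP => w /fsurj[u [v [uA vB <-]]].
    by apply/imsetP; exists u => //; rewrite (B1 v).
  by apply/negP => /proper_card; rewrite ltnNge cardA.
- by rewrite f_join.
- move=> a aa ax; have [|u [v [uA vB e]]] := fsurj a; first by rewrite itvE.
  have [au|au] : f (u, b0) = \bot \/ f (u, b0) = a.
    by apply: le_atom => //; rewrite -e fle // lexx b0_le.
    right; rewrite -e -f_join // au join0x fle //.
    by rewrite lexx le_b1.
  by left; rewrite -au fle // lexx le_a1.
- move=> u v /below_y[u' uA' ->] /below_z[v' vB' ->].
  by rewrite f_join // f_meetl.
- move=> u v /below_y[u' uA' ->] /below_z[v' vB' ->].
  by rewrite f_join // f_meetr.
Qed.

Hypothesis Lgeo : geometric L.

(** Here geometricity enters: an element is determined by the atoms below it, and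
    every atom below [x] lies in one of the two summands. *)
Lemma direct_sum_split x y z w : direct_sum x y z -> w <= x ->
  (w `&` y) `|` (w `&` z) = w.
Proof.
case=> _ _ _ at_ _ _ wx; apply/le_anti/andP; split; first by rewrite leUx !leIl.
apply: le_atomP => // a aa aw; have [ay|az] := at_ a aa (le_trans aw wx).
- by rewrite (le_trans _ (leUl _ _)) // lexI aw.
- by rewrite (le_trans _ (leUr _ _)) // lexI aw.
Qed.

Lemma direct_sum_reducible x y z : direct_sum x y z -> x \notin Gmin L.
Proof.
move=> ds; have yz0 := direct_sum_meet ds; have splitP := direct_sum_split ds.
case: (ds) => y0 z0 yzx _ ml mr.
have itvE w t : (w \in itv_set \bot t) = (w <= t) by rewrite inE le0x.
have yx : y <= x by rewrite -yzx leUl.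
have zx : z <= x by rewrite -yzx leUr.
rewrite GminE /irreducible negb_and !negbK; apply/orP; right.
apply/existsP; exists (itv_set \bot y); apply/existsP; exists (itv_set \bot z).
apply/existsP; exists [ffun u => u.1 `|` u.2].
have yNx : ~~ (x <= y).
  apply: contra z0 => xy; rewrite -lex0 -yz0 lexI lexx andbT.
  exact: le_trans zx xy.
have zNx : ~~ (x <= z).
  apply: contra y0 => xz; rewrite -lex0 -yz0 lexI lexx /=.
  exact: le_trans yx xz.
apply/and3P; split.
- rewrite properE; apply/andP; split.
    by apply/subsetP => w; rewrite !itvE => /le_trans; apply.
  by apply/subsetPn; exists x; rewrite !itvE ?lexx.
- rewrite properE; apply/andP; split.
    by apply/subsetP => w; rewrite !itvE => /le_trans; apply.
  by apply/subsetPn; exists x; rewrite !itvE ?lexx.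
apply/and3P; split.
- apply/'forall_implyP => -[u v]; rewrite inE !itvE /= ffunE /= => /andP[uy vz].
  by rewrite leUx (le_trans uy yx) (le_trans vz zx).
- apply/'forall_implyP => -[u v]; rewrite inE !itvE /= => /andP[uy vz].
  apply/'forall_implyP => -[u' v']; rewrite inE !itvE /= => /andP[uy' vz'].
  rewrite !ffunE /=; apply/eqP; apply/idP/andP => [le|[uu vv]]; last exact: leU2.
  have := leI2 le (lexx y); rewrite !ml // => uu.
  by have := leI2 le (lexx z); rewrite !mr // => vv.
- apply/'forall_implyP => w; rewrite itvE => wx.
  apply/'exists_andP; exists (w `&` y, w `&` z).
  by rewrite inE !itvE !leIr ffunE /= splitP.
Qed.

(** Otherwise the meets of [g] with the two summands would decompose [g]. *)
Lemma Gmin_direct_sum g x y z : g \in Gmin L -> direct_sum x y z -> g <= x ->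
  g <= y \/ g <= z.
Proof.
move=> gG ds gx; have e := direct_sum_split ds gx.
have [gy0|gy0] := eqVneq (g `&` y) \bot.
  by right; rewrite -e gy0 join0x leIr.
have [gz0|gz0] := eqVneq (g `&` z) \bot.
  by left; rewrite -e gz0 joinx0 leIr.
case: (ds) => _ _ _ at_ ml mr.
have: direct_sum g (g `&` y) (g `&` z).
  split=> //.
  - move=> a aa ag; have [ay|az] := at_ a aa (le_trans ag gx).
      by left; rewrite lexI ag.
    by right; rewrite lexI ag.
  - move=> u v; rewrite !lexI => /andP[ug uy] /andP[vg vz].
    by rewrite meetCA ml // (meet_idPr ug).
  - move=> u v; rewrite !lexI => /andP[ug uy] /andP[vg vz].
    by rewrite meetCA mr // (meet_idPr vg).
by move/direct_sum_reducible; rewrite gG.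
Qed.

Lemma atom_Gmin a : is_atom a -> a \in Gmin L.
Proof.
move=> aa; apply/negPn/negP => aG.
have [y [z ds]] := reducible_direct_sum (atom_neq0 aa) aG.
have yz0 := direct_sum_meet ds; case: (ds) => y0 z0 yza _ _ _.
have [|e|e] := le_atom aa (_ : y <= a); first by rewrite -yza leUl.
  by rewrite e eqxx in y0.
have [|f|f] := le_atom aa (_ : z <= a); first by rewrite -yza leUr.
  by rewrite f eqxx in z0.
by move: y0; rewrite -yz0 e f meetxx eqxx.
Qed.

(** A decomposition of the join would have to put both elements in one summand,
    since their meet is not [\bot]; but then their join lies in that summand. *)
Lemma Gmin_join x y : x \in Gmin L -> y \in Gmin L -> x `&` y != \bot ->
  x `|` y \in Gmin L.
Proof.
move=> xG yG xy0; apply/negPn/negP => nG.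
have x0 : x `|` y != \bot.
  apply: contra xy0; rewrite -!lex0; apply: le_trans.
  by rewrite (le_trans (leIl _ _)) ?leUl.
have [s [t ds]] := reducible_direct_sum x0 nG.
have st0 := direct_sum_meet ds; case: (ds) => s0 t0 st _ _ _.
have aux u : x `|` y <= u -> u = s \/ u = t -> False.
  move=> xyu [] e; subst u.
    by move: t0; rewrite -lex0 -st0 lexI lexx andbT (le_trans _ xyu) // -st leUr.
  by move: s0; rewrite -lex0 -st0 lexI lexx /= (le_trans _ xyu) // -st leUl.
have meet0 u v : x <= u -> y <= v -> u `&` v = \bot -> False.
  by move=> xu yv uv; move: xy0; rewrite -lex0 -uv leI2.
have [xs|xt] := Gmin_direct_sum xG ds (leUl _ _);
  have [ys|yt] := Gmin_direct_sum yG ds (leUr _ _).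
- by apply: (aux s); [rewrite leUx xs | left].
- exact: (meet0 _ _ xs yt).
- by apply: (meet0 _ _ xt ys); rewrite meetC.
- by apply: (aux t); [rewrite leUx xt | right].
Qed.

End Irreducibles.

(** * The flag of a supersolvable lattice *)

Section ModularFlag.
Local Open Scope order_scope.
Variables (d : Order.disp_t) (L : finTBLatticeType d).
Implicit Types (x y z u v w a b p q : L) (C D K S : {set L}).

Definition left_modular x :=
  forall y z, y <= z -> z `&` (y `|` x) = y `|` (z `&` x).

(** Distributivity is applied to the chain formed by [y] and [z]. *)
Lemma max_chain_left_modular D :
    (forall K, is_chain K -> distributive_on (gen_sublattice (D :|: K))) ->
  {in D, forall x, left_modular x}.
Proof.
move=> h x xD y z yz.
have cK : is_chain (y |: [set z]).
  have /andP[cz _] := chain_below1 z.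
  by apply: chain_setU1 => // w /set1P->; rewrite /Order.comparable yz orbT.
have sub : {subset D :|: (y |: [set z]) <= gen_sublattice (D :|: (y |: [set z]))}.
  by move=> w wS; apply/bigcapP => T /andP[_ /subsetP]; apply.
rewrite (h _ cK) ?(meet_idPr yz) //; apply: sub; rewrite !inE ?eqxx ?orbT //.
by rewrite xD.
Qed.

(** The consequences of supersolvability that are used below.  The sequence is
    allowed to become constant once it has reached [\top], which avoids carrying
    the length of the chain. *)
Record modular_flag (X : nat -> L) : Prop := ModularFlag {
  flag_bot : X 0%N = \bot;
  flag_top : exists N, X N = \top;
  flag_le : forall k, X k <= X k.+1;
  flag_meet : forall k y z, y <= X k ->
    (y `|` z) `&` X k = y `|` (z `&` X k);
  flag_new : forall k x z, x <= X k.+1 -> z <= x -> ~~ (z <= X k) ->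
    z `|` (x `&` X k) = x }.

Hypothesis Lgeo : geometric L.

(** Together with submodularity this says that a left modular element is modular
    in the sense of ranks.  Passing from a lower cover [y] of [z] above [x `&` z]
    to [z] raises the rank of the join with [x], for otherwise left modularity
    would give [z = y]. *)
Lemma left_modular_rank x z : left_modular x ->
  (rank x + rank z <= rank (x `|` z) + rank (x `&` z))%N.
Proof.
move=> mx; have [n] := ubnP (rank z); elim: n z => // n IHn z zn.
have [zx|zx] := boolP (z <= x); first by rewrite (join_idPl zx) (meet_idPr zx).
pose P y := (x `&` z <= y) && (y < z).
have Pxz : P (x `&` z).
  rewrite /P lexx lt_neqAle leIr andbT.
  by apply: contra zx => /eqP <-; rewrite leIl.
have [y /andP[xzy yz] ymax] := arg_maxnP (fun y => rank y) Pxz.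
have [a aa [az ay]] : exists2 a, is_atom a & a <= z /\ ~~ (a <= y).
  by apply/(atomP Lgeo); rewrite lt_geF.
have eya : y `|` a = z.
  apply/eqP; apply: contraT => ne; have yaz : y `|` a <= z by rewrite leUx az ltW.
  have := ymax (y `|` a); rewrite /P lt_neqAle ne yaz (le_trans xzy) ?leUl //.
  move=> /(_ isT) /= le_yaz; suff: (rank y < rank (y `|` a))%N by rewrite ltnNge le_yaz.
  by apply: rank_lt; rewrite lt_neqAle leUl andbT; apply: contra ay => /eqP ->; rewrite leUr.
have exy : x `&` y = x `&` z.
  by apply/le_anti; rewrite !lexI !leIl xzy (le_trans (leIr _ _) (ltW yz)).
have ltxy : x `|` y < x `|` z.
  rewrite lt_neqAle leU2 ?(ltW yz) // andbT; apply/negP => /eqP e.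
  have := mx y z (ltW yz); rewrite [y `|` x]joinC e (meet_idPl (leUr _ _)).
  by rewrite [z `&` x]meetC (join_idPl xzy) => ezy; rewrite ezy ltxx in yz.
have := IHn y (leq_trans (rank_lt yz) zn); rewrite exy => IH.
have := rank_joina Lgeo y aa; rewrite eya => rz.
apply: leq_trans (_ : (rank x + (rank y).+1 <= _)%N); first by rewrite leq_add2l.
by rewrite addnS; apply: leq_ltn_trans IH _; rewrite ltn_add2r rank_lt.
Qed.

(** A count of ranks: both sides have the same rank, by submodularity and
    [left_modular_rank]. *)
Lemma left_modular_meet x y z : left_modular x -> y <= x ->
  (y `|` z) `&` x = y `|` (z `&` x).
Proof.
move=> mx yx; apply/esym/rank_le_eq.
  by rewrite leUx !lexI leUl yx leIr (le_trans (leIl _ _)) ?leUr.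
set w := y `|` (z `&` x).
have wx : w <= x by rewrite /w leUx yx leIr.
have ewz : w `|` z = y `|` z.
  by rewrite /w -joinA (join_idPr (leIl _ _)).
have emz : w `&` z = z `&` x.
  apply/le_anti; rewrite !lexI leIr (le_trans (leIl _ _) wx) /=.
  by rewrite leIl (le_trans _ (leUr _ _)).
have := rank_semimod Lgeo w z; rewrite ewz emz => h1.
have := left_modular_rank z mx; rewrite [x `&` z]meetC => h2.
have := rank_semimod Lgeo x (y `|` z).
rewrite joinA (join_idPl yx) [x `&` (_ `|` _)]meetC => h3.
move: (rank ((y `|` z) `&` x)) (rank w) (rank (x `|` z)) (rank (z `&` x)) (rank x) (rank z) (rank (y `|` z)) h1 h2 h3.
clear; lia.
Qed.

Definition chain_succ D x := \meet_(c in D | x < c) c.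

Definition flag D k := iter k (chain_succ D) \bot.

(** The only point that is not immediate is [flag_new]: [z `|` X k] lies between
    two consecutive elements of a maximal chain, so it is the upper one, and left
    modularity of [X k] concludes. *)
Lemma max_chain_flag D : is_max_chain \bot \top D ->
  {in D, forall x, left_modular x} -> modular_flag (flag D).
Proof.
move=> /maxsetP[/andP[/chainP cD _] maxD] mD.
have ins z : {in D, forall c, c >=< z} -> z \in D.
  move=> h; rewrite -(maxD (z |: D)) ?setU11 ?subsetUr //.
  rewrite chain_setU1 //; last exact/chainP.
  by apply/subsetP => w _; rewrite inE le0x lex1.
have D0 : \bot \in D by apply: ins => c _; rewrite /Order.comparable le0x orbT.
have D1 : \top \in D by apply: ins => c _; rewrite /Order.comparable lex1.
have le_succ x : x <= chain_succ D x.
  by apply/meetsP => c /andP[_ /ltW].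
have succ_le x c : c \in D -> x < c -> chain_succ D x <= c.
  by move=> cD' xc; apply: meets_inf; rewrite cD'.
have gt_or x c : x \in D -> c \in D -> c <= x \/ chain_succ D x <= c.
  move=> xD cD'; have [e|ne] := eqVneq c x; first by left; rewrite e.
  have := cD _ _ xD cD'; rewrite /Order.comparable => /orP[xc|]; last by left.
  by right; apply: succ_le; rewrite // lt_neqAle eq_sym ne.
have cover x z : x \in D -> x <= z -> z <= chain_succ D x -> z \in D.
  move=> xD xz zs; apply: ins => c /(gt_or _ _ xD)[cx|sc].
    by rewrite /Order.comparable (le_trans cx xz).
  by rewrite /Order.comparable (le_trans zs sc) orbT.
have flD k : flag D k \in D.
  by elim: k => //= k IH; apply: cover IH (le_succ _) (lexx _).
have succ_lt x : x \in D -> x != \top -> x < chain_succ D x.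
  move=> xD x1; have P1 : (\top \in D) && (x < \top) by rewrite D1 lt_neqAle x1 lex1.
  have [c /andP[cD' xc] cmin] :=
    arg_minnP (P := fun c => (c \in D) && (x < c)) (fun c => rank c) P1.
  apply: lt_le_trans xc _; apply/meetsP => c' /andP[cD'' xc'].
  have := cD _ _ cD' cD''; rewrite /Order.comparable => /orP[//|c'c].
  have := cmin c'; rewrite cD'' xc' => /(_ isT) /= r.
  by rewrite (rank_le_eq c'c r).
have modF k : left_modular (flag D k) by apply: mD.
split=> //.
- exists (rank (\top : L)).+1; apply/eqP; apply: contraT => ne.
  have: forall k, flag D k = \top \/ (k <= rank (flag D k))%N.
    elim=> [|k [IH|IH]]; first by right.
      left; apply/eqP; rewrite eq_le lex1 /= -[X in X <= _]IH. exact: le_succ.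
    have [e|ne'] := eqVneq (flag D k) \top.
      left; apply/eqP; rewrite eq_le lex1 /= -[X in X <= _]e. exact: le_succ.
    by right; apply: leq_ltn_trans IH (rank_lt (succ_lt _ (flD k) ne')).
  move=> /(_ (rank (\top : L)).+1)[e|]; first by rewrite e eqxx in ne.
  by move/(leq_trans)/(_ (rank_le (lex1 _))); rewrite ltnn.
- by move=> k y z; apply: left_modular_meet.
- move=> k x z xS zx zk; rewrite -modF //.
  suff -> : z `|` flag D k = flag D k.+1 by apply/meet_idPl.
  have wD : z `|` flag D k \in D.
    by apply: (cover _ _ (flD k)); rewrite ?leUr // leUx (le_trans zx xS) /= le_succ.
  have [h|h] := gt_or _ _ (flD k) wD.
    by rewrite (le_trans (leUl _ _) h) in zk.
  by apply/le_anti; rewrite h andbT leUx (le_trans zx xS) /= le_succ.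
Qed.

End ModularFlag.

(** * Irreducible elements along a flag *)

Section FlagIrreducibles.
Local Open Scope order_scope.
Variables (d : Order.disp_t) (L : finTBLatticeType d) (X : nat -> L).
Hypotheses (Lgeo : geometric L) (Xflag : modular_flag X).
Implicit Types (x y z u v w a b p q g : L) (k : nat).

Lemma flag_le_trans i j : (i <= j)%N -> X i <= X j.
Proof.
move/subnK => <-; elim: (j - i)%N => [|m IHm]; first by rewrite lexx.
by rewrite addSn (le_trans IHm) ?flag_le.
Qed.

Lemma flag_low_neq0 k p q : p <= X k.+1 -> q <= X k.+1 ->
  ~~ (p <= X k) -> ~~ (q <= p) -> (p `|` q) `&` X k != \bot.
Proof.
move=> pk qk pN qp; apply: contra qp => /eqP e.
have pqk : p `|` q <= X k.+1 by rewrite leUx pk.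
have := flag_new Xflag pqk (leUl _ _) pN; rewrite e joinx0 => ->.
exact: leUr.
Qed.

Lemma flag_atom_new k x : x <= X k.+1 -> ~~ (x <= X k) ->
  exists2 p, is_atom p & [/\ p <= x, p <= X k.+1 & ~~ (p <= X k)].
Proof.
move=> xk /(atomP Lgeo)[p ap [px pN]]; exists p => //.
by rewrite px pN (le_trans px).
Qed.

(** A decomposition of the join would put [g] and [h] in different summands.  Take
    new atoms [p] below [g] and [q] below [h]: the line through them meets [X k]
    in an atom [r], which lies in one of the summands, and together with [p] or
    [q] it forces the other of these atoms into the same summand. *)
Lemma Gmin_join_new k g h : g \in Gmin L -> h \in Gmin L ->
    g <= X k.+1 -> h <= X k.+1 -> ~~ (g <= X k) -> ~~ (h <= X k) ->
  g `|` h \in Gmin L.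
Proof.
move=> gG hG gk hk gN hN; apply/negPn/negP => nG.
have gh0 : g `|` h != \bot.
  by apply: contra gN; rewrite -lex0 => /(le_trans (leUl _ _))/le_trans; apply; rewrite le0x.
have [y [z ds]] := reducible_direct_sum gh0 nG.
have yz0 := direct_sum_meet ds.
have [p ap [pg pk pN]] := flag_atom_new gk gN.
have [q aq [qh qk qN]] := flag_atom_new hk hN.
have one_side s t : direct_sum (g `|` h) s t -> g <= s -> h <= s -> False.
  move=> ds' gs hs; have := direct_sum_meet ds'; case: ds' => _ t0 e _ _ _ m0.
  move: t0; rewrite -lex0 -m0 lexI lexx andbT => /negP[].
  by apply: le_trans (_ : g `|` h <= s); rewrite -?e ?leUr // e leUx gs.
have two_sides s t : direct_sum (g `|` h) s t -> g <= s -> h <= t -> False.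
  move=> ds' gs ht; have st0 := direct_sum_meet ds'.
  have ps := le_trans pg gs; have qt := le_trans qh ht.
  have disj a : is_atom a -> a <= s -> a <= t -> False.
    by move=> aa as_ at_; have := atom_neq0 aa; rewrite -lex0 -st0 lexI as_ at_.
  have qp : ~~ (q <= p).
    by apply/negP => qp; apply: (disj q) => //; apply: le_trans qp ps.
  have [r ar [rpq r0]] : exists2 r, is_atom r & r <= (p `|` q) `&` X k /\ ~~ (r <= \bot).
    by apply/(atomP Lgeo); rewrite lex0 (flag_low_neq0 pk).
  move: rpq; rewrite lexI => /andP[rpq rk].
  have rpqE u v : is_atom u -> is_atom v -> ~~ (u <= X k) -> r <= u `|` v ->
      v <= u `|` r.
    move=> au av uN ruv; rewrite (joina_cover Lgeo (y := u) av _ (_ : u `|` r <= _)) ?leUr //.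
      rewrite lt_neqAle leUl andbT; apply: contra uN => /eqP e.
      have [|re|re] := le_atom au (_ : r <= u); first by rewrite e leUr.
        by move: r0; rewrite re lexx.
      by rewrite -re.
    by rewrite leUx leUl.
  case: (ds') => _ _ _ at_ _ _.
  have [|rs|rt] := at_ r ar; first by rewrite (le_trans rpq) // leU2.
    by apply: (disj q) => //; apply: le_trans (rpqE _ _ ap aq pN rpq) _; rewrite leUx ps.
  apply: (disj p) => //; apply: le_trans (rpqE q p aq ap qN _) _.
    by rewrite joinC.
  by rewrite leUx qt.
case: (Gmin_direct_sum Lgeo gG ds (leUl _ _));
  case: (Gmin_direct_sum Lgeo hG ds (leUr _ _)).
- by move=> hy gy; apply: one_side ds _ _.
- by move=> hz gy; apply: two_sides ds _ _.
- by move=> hy gz; apply: two_sides (direct_sumC ds) _ _.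
- by move=> hz gz; apply: one_side (direct_sumC ds) _ _.
Qed.

(** Suppose that [w = g `&` X k] is the direct sum of [y] and [z].  On the new
    atoms below [g], consider the equivalences [p `|` y = q `|` y] and
    [p `|` z = q `|` z].  The line through two new atoms meets [X k] in an atom
    below [y] or [z], so that any two new atoms are related by one of them.  A set
    is not the union of two proper equivalence relations, so one of the two is
    total; then [p0 `|` z] contains all the new atoms, and [g] is the direct sum of
    [y] and [p0 `|` z], or likewise with [y] and [z] exchanged. *)
Lemma Gmin_meet_flag_step k g : g \in Gmin L -> g <= X k.+1 -> ~~ (g <= X k) ->
  g `&` X k != \bot -> g `&` X k \in Gmin L.
Proof.
move=> gG gk gN w0; apply/negPn/negP => nG; set w := g `&` X k in w0 nG.
have [y [z ds]] := reducible_direct_sum w0 nG.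
have wg : w <= g by apply: leIl.
have wk : w <= X k by apply: leIr.
pose new p := [&& is_atom p, p <= g & ~~ (p <= X k)].
have newk p : new p -> p <= X k.+1 by case/and3P=> _ /le_trans h _; apply: h.
have eqvE s p q : s <= w -> new p -> new q -> q <= p `|` s -> p `|` s = q `|` s.
  move=> sw np nq qps; have /and3P[ap _ pN] := np; have /and3P[_ _ qN] := nq.
  have psk : p `|` s <= X k.+1.
    by rewrite leUx newk // (le_trans sw) // (le_trans wk) // flag_le.
  have := flag_new Xflag psk qps qN; rewrite [p `|` s]joinC.
  rewrite (flag_meet Xflag _ (le_trans sw wk)).
  have [->|e] := le_atom ap (leIl p (X k)); first by rewrite joinx0 => ->.
  by move: pN; rewrite -e leIr.
have dich p q : new p -> new q -> p `|` y = q `|` y \/ p `|` z = q `|` z.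
  move=> np nq; have [yw zw] : y <= w /\ z <= w.
    by case: (ds) => _ _ <- _ _ _; rewrite leUl leUr.
  have [qp|qp] := boolP (q <= p).
    by left; apply: eqvE => //; apply: le_trans qp (leUl _ _).
  have /and3P[ap pg pN] := np; have /and3P[aq qg qN] := nq.
  have [r ar [rpq r0]] : exists2 r, is_atom r & r <= (p `|` q) `&` X k /\ ~~ (r <= \bot).
    by apply/(atomP Lgeo); rewrite lex0 (flag_low_neq0 (newk _ np)) ?newk.
  move: rpq; rewrite lexI => /andP[rpq rk].
  have qpr : q <= p `|` r.
    rewrite (joina_cover Lgeo (y := p) aq _ (_ : p `|` r <= _)) ?leUr //; last first.
      by rewrite leUx leUl.
    rewrite lt_neqAle leUl andbT; apply: contra pN => /eqP e.
    have [|re|re] := le_atom ap (_ : r <= p); first by rewrite e leUr.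
      by move: r0; rewrite re lexx.
    by rewrite -re.
  case: (ds) => _ _ yzw at_ _ _; case: (at_ r ar).
  - by rewrite lexI rk (le_trans rpq) // leUx pg.
  - by move=> ry; left; apply: eqvE => //; apply: le_trans qpr _; rewrite leU2.
  - by move=> rz; right; apply: eqvE => //; apply: le_trans qpr _; rewrite leU2.
have [p0 ap0 [p0g _ p0N]] := flag_atom_new gk gN.
have np0 : new p0 by rewrite /new ap0 p0g.
have reduce s t : direct_sum w s t -> (forall q, new q -> q <= p0 `|` t) -> False.
  move=> dst tot; have st0 := direct_sum_meet dst.
  case: (dst) => s0 t0 stw at_ ml mr.
  have sw : s <= w by rewrite -stw leUl.
  have tw : t <= w by rewrite -stw leUr.
  have sk := le_trans sw wk; have tk := le_trans tw wk.
  pose t' := p0 `|` t.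
  have p0k : p0 `&` X k = \bot.
    have [->//|e] := le_atom ap0 (leIl p0 (X k)).
    by move: p0N; rewrite -e leIr.
  have t'k : t' `&` X k = t by rewrite /t' joinC flag_meet // p0k joinx0.
  have t'g : t' <= g by rewrite leUx p0g (le_trans tw).
  have stk u v : u <= s -> v <= t' -> (u `|` v) `&` X k = u `|` (v `&` X k).
    by move=> us _; apply: flag_meet => //; apply: le_trans us sk.
  have vk v : v <= t' -> v `&` X k <= t.
    by move=> vt; rewrite -t'k leI2.
  suff: direct_sum g s t' by move/(direct_sum_reducible Lgeo); rewrite gG.
  split=> //.
  - apply: contra t0; rewrite -!lex0; apply: le_trans; exact: leUr.
  - apply/le_anti; rewrite leUx (le_trans sw) // t'g /=.
    rewrite -(flag_new Xflag gk p0g p0N) -/w -stw !leUx leUl.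
    by rewrite (le_trans (leUl p0 t) (leUr _ _)) (le_trans (leUr t p0) (leUr _ _)).
  - move=> a aa ag; have [ak|ak] := boolP (a <= X k); last first.
      by right; apply: tot; rewrite /new aa ag.
    have [|as_|at'] := at_ a aa; [by rewrite lexI ag|by left|right].
    by apply: le_trans at' (leUr _ _).
  - move=> u v us vt; rewrite -[X in _ `&` X](meet_idPr sk) meetA stk // ml ?vk //.
  - move=> u v us vt; have [vXk|vN] := boolP (v <= X k).
      have uvk : u `|` v <= X k by rewrite leUx (le_trans us sk).
      rewrite -[LHS](meet_idPl (le_trans (leIl _ _) uvk)) -meetA t'k mr //.
      by rewrite -t'k lexI vt.
    have uvk : (u `|` v) `&` t' <= X k.+1 by rewrite (le_trans (leIr _ _)) // (le_trans t'g).
    have vuv : v <= (u `|` v) `&` t' by rewrite lexI leUr.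
    have := flag_new Xflag uvk vuv vN => <-; apply/join_idPl.
    have uvk' : u `|` (v `&` X k) <= X k by rewrite leUx (le_trans us sk) leIr.
    rewrite meetAC stk // -[X in X `&` _](meet_idPl uvk') -meetA.
    by rewrite [X k `&` _]meetC t'k mr ?vk // leIl.
have [tot|] := pselect (forall q, new q -> q <= p0 `|` z); first exact: (reduce y z).
move=> ntz; apply: (reduce _ _ (direct_sumC ds)) => q nq.
have [p1 np1 p1z] : exists2 p1, new p1 & ~~ (p1 <= p0 `|` z).
  apply: contra_notP ntz => h q' nq'; apply/negPn/negP => qz.
  by apply: h; exists q'.
have [->|e] := dich _ _ np0 nq; first exact: leUl.
have [e1|e1] := dich _ _ np0 np1; last by move: p1z; rewrite e1 leUl.
have [e2|e2] := dich _ _ nq np1; first by rewrite e1 -e2 leUl.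
by move: p1z; rewrite e e2 leUl.
Qed.

Lemma Gmin_meet_flag k g : g \in Gmin L ->
  g `&` X k \in Gmin L \/ g `&` X k = \bot.
Proof.
move=> gG; have [N XN] := flag_top Xflag.
have [gk|kN] := boolP (g <= X k); first by rewrite (meet_idPl gk); left.
have: g `&` X (N + k)%N \in Gmin L \/ g `&` X (N + k)%N = \bot.
  left; rewrite (meet_idPl _) // (le_trans (lex1 g)) // -XN flag_le_trans //.
  exact: leq_addr.
elim: N {XN} => // N IH [hG|h0]; last first.
  apply: IH; right; apply/eqP; rewrite -lex0 -h0 leI2 //; exact: flag_le.
have e : g `&` X (N + k)%N = (g `&` X (N.+1 + k)%N) `&` X (N + k)%N.
  by rewrite -meetA (meet_idPr (flag_le Xflag (N + k))).
apply: IH; rewrite e; have [h0|h0] := eqVneq (g `&` X (N.+1 + k)%N `&` X (N + k)%N) \bot.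
  by right.
have [hk|hk] := boolP (g `&` X (N.+1 + k)%N <= X (N + k)%N).
  by left; rewrite (meet_idPl hk).
by left; apply: Gmin_meet_flag_step; rewrite ?leIr.
Qed.

End FlagIrreducibles.

(** * Ideals and polynomial actions *)

Section Ideals.
Local Open Scope ring_scope.
Variable R : comNzRingType.
Implicit Types (S : R -> Prop) (a p q : R).

Inductive ideal S : R -> Prop :=
| ideal0 : ideal S 0
| ideal_incl p of S p : ideal S p
| idealD p q of ideal S p & ideal S q : ideal S (p + q)
| idealM a p of ideal S p : ideal S (a * p).

Lemma idealN S p : ideal S p -> ideal S (- p).
Proof. by rewrite -mulN1r; apply: idealM. Qed.

Lemma idealB S p q : ideal S p -> ideal S q -> ideal S (p - q).
Proof. by move=> hp hq; apply: idealD => //; apply: idealN. Qed.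

Lemma idealMr S a p : ideal S p -> ideal S (p * a).
Proof. by rewrite mulrC; apply: idealM. Qed.

Lemma ideal_eq S p q : ideal S q -> p = q -> ideal S p.
Proof. by move=> ? ->. Qed.

Lemma ideal_sub S S' : (forall p, S p -> ideal S' p) ->
  forall p, ideal S p -> ideal S' p.
Proof.
move=> h p; elim=> {p} [|p /h//|p q _ hp _ hq|a p _ hp].
- exact: ideal0.
- exact: idealD.
- exact: idealM.
Qed.

End Ideals.

Section PolynomialAction.
(** Operators that commute only modulo a stable subgroup [U] still make [V / U] a
    module over the polynomial ring.  Composing them in a fixed order defines the
    action of a monomial without forming the quotient. *)
Local Open Scope ring_scope.
Variables (n : nat) (V : zmodType) (U : V -> Prop).
Hypotheses (U0 : U 0) (UD : forall v w, U v -> U w -> U (v + w))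
  (UN : forall v, U v -> U (- v)).
Variables (op : 'I_n -> {additive V -> V}) (v0 : V).
Hypotheses (op_stable : forall i v, U v -> U (op i v))
  (op_comm : forall i j v, U (op i (op j v) - op j (op i v))).
Implicit Types (m : 'X_{1..n}) (p q : {mpoly int[n]}).

Let cong v w := U (v - w).

Let cong_refl v : cong v v. Proof. by rewrite /cong subrr. Qed.

Let cong_sym v w : cong v w -> cong w v.
Proof. by rewrite /cong => /UN; rewrite opprB. Qed.

Let cong_trans w v u : cong v w -> cong w u -> cong v u.
Proof. by rewrite /cong => h1 h2; have := UD h1 h2; rewrite addrA subrK. Qed.

Let cong_op i v w : cong v w -> cong (op i v) (op i w).
Proof. by rewrite /cong => /(op_stable i); rewrite raddfB. Qed.

Let cong_iter i j k v : cong (op i (iter k (op j) v)) (iter k (op j) (op i v)).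
Proof.
elim: k => //= k IHk; apply: cong_trans (op_comm _ _ _) _; exact: cong_op.
Qed.

Let cong_iter2 j k v w : cong v w -> cong (iter k (op j) v) (iter k (op j) w).
Proof. by move=> vw; elim: k => //= k; apply: cong_op. Qed.

Definition mon_act m (s : seq 'I_n) : V :=
  foldr (fun i v => iter (m i) (op i) v) v0 s.

Let mon_actS m i s : uniq s ->
  cong (mon_act (U_(i) + m)%MM s)
       (if i \in s then op i (mon_act m s) else mon_act m s).
Proof.
elim: s => //= j s IHs /andP[js us]; have := IHs us; rewrite inE mnmDE mnm1E.
have [e|ne] /= := eqVneq i j.
  by subst j; rewrite (negbTE js) add0n /= => h; apply/cong_op/cong_iter2.
rewrite add0n; case: ifP => is_ h.
  apply: cong_trans (cong_iter2 _ _ h) _; apply: cong_sym; exact: cong_iter.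
exact: cong_iter2.
Qed.

Definition poly_act p : V := \sum_(m <- msupp p) mon_act m (enum 'I_n) *~ p@_m.

Let poly_act_wide (t : seq 'X_{1..n}) p : uniq t -> {subset msupp p <= t} ->
  poly_act p = \sum_(m <- t) mon_act m (enum 'I_n) *~ p@_m.
Proof.
move=> ut st; rewrite (bigID (mem (msupp p))) /= [X in _ + X]big1 ?addr0.
  rewrite -big_filter; apply: perm_big; apply: uniq_perm.
  - exact: msupp_uniq.
  - exact: filter_uniq.
  - by move=> m; rewrite mem_filter; case: (boolP (m \in msupp p)) => // /st ->.
by move=> m /memN_msupp_eq0 ->; rewrite mulr0z.
Qed.

Lemma poly_actD p q : poly_act (p + q) = poly_act p + poly_act q.
Proof.
pose t := undup (msupp p ++ msupp q).
have ut : uniq t by apply: undup_uniq.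
have sp : {subset msupp p <= t} by move=> m; rewrite mem_undup mem_cat => ->.
have sq : {subset msupp q <= t}.
  by move=> m; rewrite mem_undup mem_cat => ->; rewrite orbT.
have spq : {subset msupp (p + q) <= t}.
  by move=> m /msuppD_le; rewrite mem_undup.
rewrite (poly_act_wide ut sp) (poly_act_wide ut sq) (poly_act_wide ut spq).
by rewrite -big_split; apply: eq_bigr => m _; rewrite mcoeffD mulrzDr.
Qed.

Lemma poly_actN p : poly_act (- p) = - poly_act p.
Proof.
rewrite /poly_act (perm_big _ (msuppN p)) -sumrN.
by apply: eq_bigr => m _; rewrite mcoeffN mulrNz.
Qed.

Lemma poly_actB p q : poly_act (p - q) = poly_act p - poly_act q.
Proof. by rewrite poly_actD poly_actN. Qed.

Lemma poly_act0 : poly_act 0 = 0.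
Proof. by rewrite /poly_act msupp0 big_nil. Qed.

Lemma poly_actX m : poly_act 'X_[m] = mon_act m (enum 'I_n).
Proof. by rewrite /poly_act msuppX big_seq1 mcoeffX eqxx. Qed.

Lemma poly_act1 : poly_act 1 = v0.
Proof.
rewrite -mpolyX0 poly_actX; elim: (enum 'I_n) => //= i s ->.
by rewrite mnm0E.
Qed.

HB.instance Definition _ :=
  GRing.isZmodMorphism.Build {mpoly int[n]} V poly_act poly_actB.

Let scaleMz c p : c *: p = p *~ c.
Proof. by rewrite -[c in LHS]intz scaler_int. Qed.

Lemma poly_act_mulX i p : cong (poly_act ('X_i * p)) (op i (poly_act p)).
Proof.
elim/mpolyind: p => [|c m p _ _ IH].
  by rewrite mulr0 poly_act0 raddf0.
rewrite mulrDr !poly_actD raddfD /cong opprD addrACA; apply: UD => //.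
rewrite -scalerAr -mpolyXD !scaleMz !raddfMz /= !poly_actX -mulrzDl.
have := mon_actS m i (enum_uniq 'I_n); rewrite mem_enum /=.
elim/int_rec: c => [|k IHk|k IHk] h; first by rewrite mulr0z.
  by rewrite intS mulrzDr mulr1z; apply: UD => //; apply: IHk.
by rewrite intS opprD mulrzDr mulrN1z; apply: UD; [apply: UN | apply: IHk].
Qed.

Lemma poly_act_stable a p : U (poly_act p) -> U (poly_act (a * p)).
Proof.
move=> hp; elim/mpolyind: a => [|c m a _ _ IH]; first by rewrite mul0r poly_act0.
rewrite mulrDl poly_actD; apply: UD => //.
rewrite scaleMz mulrzAl raddfMz /=.
suff h : U (poly_act ('X_[m] * p)).
  elim/int_rec: c => [|k IHk|k IHk]; first by rewrite mulr0z.
    by rewrite intS mulrzDr mulr1z; apply: UD.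
  by rewrite intS opprD mulrzDr mulrN1z; apply: UD => //; apply: UN.
rewrite mpolyXE_id; elim/big_rec: _ => [|i q _ IHq]; first by rewrite mul1r.
elim: (m i) => [|k IHk]; first by rewrite expr0 mul1r.
rewrite exprS -!mulrA; move: IHk; rewrite -!mulrA.
set r := 'X_i ^+ k * _ => hr; rewrite -[poly_act _](subrK (op i (poly_act r))).
by apply: UD; [exact: poly_act_mulX | exact: op_stable].
Qed.

Lemma poly_act_ideal (S : {mpoly int[n]} -> Prop) :
  (forall p, S p -> U (poly_act p)) -> forall p, ideal S p -> U (poly_act p).
Proof.
move=> h p; elim=> {p} [|p /h//|p q _ hp _ hq|a p _ hp].
- by rewrite poly_act0.
- by rewrite poly_actD; apply: UD.
- exact: poly_act_stable.
Qed.

End PolynomialAction.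

(** * Ideals of strata and normal monomials *)

Section Strata.
Local Open Scope order_scope.
Variables (d : Order.disp_t) (L : finTBLatticeType d) (X : nat -> L).
Hypotheses (Lgeo : geometric L) (Xflag : modular_flag X).
Implicit Types (x y z a b g : L) (k : nat) (N : {set L}).
Variables (n : nat) (e : 'I_n -> L).
Hypotheses (e_inj : injective e)
  (e_Gmin : forall i, (e i \in Gmin L) && ~~ is_atom (e i))
  (e_surj : forall x, x \in Gmin L -> ~~ is_atom x -> exists i, e i = x).
Hypothesis e_level : forall k i j, e i <= X k -> ~~ (e j <= X k) -> (j < i)%N.
Hypothesis e_anti : forall k i j, ~~ (e i <= X k) -> e j <= X k.+1 ->
  e i < e j -> (i < j)%N.
Variable M : nat.

Local Notation G := (Gmin L).
Local Notation R := {mpoly int[n]}.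

(** The class [h_x] as a polynomial: a variable for irreducible [x] that are not
    atoms and zero for atoms, which are not enumerated by [e]. *)
Definition hvar x : R := (\sum_(i | e i == x) 'X_i)%R.
Local Notation h := hvar.

Lemma hvar_e i : h (e i) = 'X_i.
Proof.
by rewrite /h (big_pred1 i) // => j; rewrite /= (inj_eq e_inj).
Qed.

Lemma hvar_notin x : (forall i, e i != x) -> h x = 0%R.
Proof. by move=> ex; rewrite /h big_pred0 // => i; apply/negbTE. Qed.

Lemma hvar_atom a : is_atom a -> h a = 0%R.
Proof.
move=> aa; apply: hvar_notin => i; apply: contraTneq aa => <-.
by case/andP: (e_Gmin i).
Qed.

(** The condition for two irreducible elements to be compatible in the nested set
    complex. *)
Definition nested x y := [|| x <= y, y <= x | x `|` y \notin G].

Definition nested_set N := {in N &, forall x y, nested x y}.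

(** The second family holds after restriction to the stratum of [N]: in the
    Feichtner-Yuzvinsky ring, [h (f `|` a) - h a] is annihilated by the class of the
    boundary divisor of [f]. *)
Variant stratum_rel k N : R -> Prop :=
| StratumJoin a b of a \in G & b \in G & a `|` b \in G & a `|` b <= X k :
    stratum_rel k N ((h (a `|` b) - h a) * (h (a `|` b) - h b))%R
| StratumCollapse f a of f \in N & a \in G & a <= X k & ~~ (a <= f)
    & f `|` a \in G :
    stratum_rel k N (h (f `|` a) - h a)%R.

Definition stratum_ideal k N := ideal (stratum_rel k N).

Lemma stratum_ideal_sub k N N' : N \subset N' ->
  forall p, stratum_ideal k N p -> stratum_ideal k N' p.
Proof.
move=> /subsetP NN; apply: ideal_sub => p [a b|f a /NN] *; apply: ideal_incl.
  exact: StratumJoin.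
exact: StratumCollapse.
Qed.

(** As [f] and [t `|` g] both lie above [t], this is an instance of [Gmin_join]. *)
Lemma Gmin_joinl f g t : f \in G -> g \in G -> t \in G -> t <= f ->
  t `|` g \in G -> f `|` g \in G.
Proof.
move=> fG gG tG tf tgG; rewrite -[f](join_idPl tf) -joinA.
apply: (Gmin_join Lgeo) => //; rewrite -lex0.
apply/negP => /(le_trans _) h0; have := bot_notin_Gmin L.
suff -> : \bot = t by rewrite tG.
by apply/le_anti; rewrite le0x /= h0 // lexI tf leUl.
Qed.

Lemma Gmin_neq0 g : g \in G -> g != \bot.
Proof. by apply: contraTneq => ->; apply: bot_notin_Gmin. Qed.

(** On the stratum of [f], all classes [h g] with the same [f `|` g] coincide.  One
    representative of such a class is kept: none if an atom occurs, as its class is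
    zero, and the largest index otherwise. *)
Definition excluded f i := [&& ~~ (e i <= f), f `|` e i \in G &
  [exists g in G, (f `|` g == f `|` e i) &&
    (is_atom g || [exists j, (e j == g) && (i < j)%N])]].

Section Level.
Variable k : nat.
Local Notation lo x := (x `&` X k).

Definition new x := (x <= X k.+1) && ~~ (x <= X k).

Lemma new_join x y : new x -> y <= X k.+1 -> new (x `|` y).
Proof.
move=> /andP[xT xH] yT; rewrite /new leUx xT yT /=.
by apply: contra xH; apply: le_trans (leUl _ _).
Qed.

Lemma new_split x z : new x -> z <= x -> ~~ (z <= X k) -> z `|` lo x = x.
Proof. by case/andP=> xT _; apply: flag_new. Qed.

Lemma lo_join y z : y <= X k -> lo (y `|` z) = y `|` lo z.
Proof. exact: flag_meet. Qed.

Lemma lo_joinr y z : y <= X k -> lo (z `|` y) = lo z `|` y.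
Proof. by move=> yH; rewrite joinC lo_join // joinC. Qed.

Lemma lo_joinnew z u v : new z -> z <= u -> z <= v -> u <= X k.+1 ->
  v <= X k.+1 -> lo (u `|` v) = lo u `|` lo v.
Proof.
move=> nz zu zv uT vT; have /andP[zT zH] := nz.
have nu : new u by rewrite -[u](join_idPr zu) new_join.
have nv : new v by rewrite -[v](join_idPr zv) new_join.
rewrite -[in LHS](new_split nu zu zH) -[in LHS](new_split nv zv zH).
rewrite joinACA joinxx [z `|` _]joinC lo_join ?leUx ?leIr //.
by apply/join_idPl; rewrite (le_trans _ (leUl _ _)) // leI2.
Qed.

(** The new atoms are those that meet [X k] trivially, because a new element is the
    join of a new atom and of its meet with [X k]. *)
Lemma new_atom x : new x -> is_atom x = (lo x == \bot).
Proof.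
move=> nx; have /andP[xT xH] := nx; apply/idP/eqP => [ax|x0].
  have [//|e0] := le_atom ax (leIl x (X k)).
  by rewrite -e0 leIr in xH.
have [p ap [px _ pH]] := flag_atom_new Lgeo xT xH.
by rewrite -(new_split nx px pH) x0 joinx0.
Qed.

Lemma new_eq x y z : new x -> z <= x -> z <= y -> y <= x -> ~~ (z <= X k) ->
  lo x <= y -> x = y.
Proof.
move=> nx zx zy yx zH xy; apply/le_anti; rewrite yx andbT.
by rewrite -(new_split nx zx zH) leUx zy xy.
Qed.

Lemma new_join_le x y z : new x -> z <= x -> ~~ (z <= X k) ->
  lo x <= lo y -> z <= y -> x <= y.
Proof.
move=> nx zx zH xy zy; rewrite -(new_split nx zx zH) leUx zy.
exact: le_trans xy (leIl _ _).
Qed.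

Lemma lo_Gmin x : x \in G -> new x -> ~~ is_atom x -> lo x \in G.
Proof.
move=> xG nx; rewrite new_atom // => x0.
by case: (Gmin_meet_flag Lgeo Xflag k xG) => // e0; rewrite e0 eqxx in x0.
Qed.

Lemma Gmin_joinnew x y : x \in G -> y \in G -> new x -> new y -> x `|` y \in G.
Proof. by move=> xG yG /andP[? ?] /andP[? ?]; apply: (Gmin_join_new Lgeo Xflag (k := k)). Qed.

Lemma new_nonatom_join x y : new x -> y <= X k.+1 -> ~~ is_atom x -> ~~ is_atom (x `|` y).
Proof.
move=> nx yT; rewrite !new_atom ?new_join // -!lex0; apply: contra.
by apply: le_trans; rewrite leI2 ?leUl.
Qed.

Lemma nested_lo f g : f \in G -> g \in G -> lo f != \bot -> lo g != \bot ->
  nested f g -> nested (lo f) (lo g).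
Proof.
have inG t : t \in G -> lo t != \bot -> lo t \in G.
  move=> tG t0; case: (Gmin_meet_flag Lgeo Xflag k tG) => // e0.
  by rewrite e0 eqxx in t0.
move=> fG gG f0 g0 /or3P[fg|gf|fg].
- by rewrite /nested leI2.
- by rewrite /nested (leI2 gf) ?orbT.
apply/or3P/Or33; apply: contra fg => lG; rewrite joinC.
apply: (Gmin_joinl gG fG (inG _ gG g0) (leIl _ _)); rewrite joinC.
exact: (Gmin_joinl fG (inG _ gG g0) (inG _ fG f0) (leIl _ _)).
Qed.

Lemma new_nonatom x y : x != \bot -> x < y -> ~~ is_atom y.
Proof.
move=> x0 xy; apply/negP => ay; have [e0|e0] := le_atom ay (ltW xy).
  by rewrite e0 eqxx in x0.
by rewrite e0 ltxx in xy.
Qed.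

(** The join [y `|` a] covers [y], and its meet with [X k] is larger than that of
    [y]; any atom in the difference can replace [a]. *)
Lemma new_join_atom y a : new y -> is_atom a -> a <= X k.+1 -> ~~ (a <= y) ->
  exists b, [/\ is_atom b, b <= X k, ~~ (b <= y), y `|` b = y `|` a
    & lo (y `|` a) = lo y `|` b].
Proof.
move=> ny aa aT ay; have /andP[_ yH] := ny.
have [b ab [bB bx]] : exists2 b, is_atom b & b <= lo (y `|` a) /\ ~~ (b <= lo y).
  apply/(atomP Lgeo); apply: contra ay => le.
  rewrite [leRHS](_ : y = y `|` a) ?leUr //; apply/esym/(new_eq (z := y)) => //.
  - exact: new_join.
  - exact: leUl.
  - exact: leUl.
  - by rewrite (le_trans le) ?leIl.
move: bB; rewrite lexI => /andP[bB bH].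
have by_ : ~~ (b <= y) by apply: contra bx; rewrite lexI bH andbT.
have eb : y `|` b = y `|` a.
  apply: (joina_cover Lgeo) => //; last by rewrite leUx leUl.
  rewrite lt_neqAle leUl andbT; apply: contra by_ => /eqP ->; exact: leUr.
by exists b; split=> //; rewrite -eb lo_joinr.
Qed.

End Level.

(** The products that are leading monomials: two variables of the same level, or a
    new variable and an old one that is redundant on the stratum of the meet of
    the new element with the flag. *)
Definition bad_pair i j := [exists k : 'I_M, new k (e i) &&
  (new k (e j) || (e j <= X k) && excluded (e i `&` X k) j)].

(** The monomials expected to form a basis modulo [stratum_ideal k N]. *)
Definition normal k N (m : 'X_{1..n}) :=
  (forall i, m i != 0%N -> e i <= X k /\ {in N, forall f, ~~ excluded f i}) /\
  (forall i j, (U_(i) + U_(j) <= m)%MM -> ~~ bad_pair i j).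

(** * One step of the flag as a module over the previous one *)

Section Fibre.
(** Below [X k.+1] and on the stratum of [N], the ring is modelled as a module over
    the polynomial ring in the old variables.  Here [F0] stands for the least new
    element of [N], or for [X k.+1] if there is none; [F0in] records the first
    case.  New elements below [F0] contribute basis vectors.  For the others,
    [h x] agrees with the class of [lo (x `|` F0)], which is old. *)
Variables (k : nat) (N : {set L}) (F0 : L).
Hypotheses (NG : {subset N <= G}) (NT : forall f, f \in N -> f <= X k.+1)
  (Nnest : nested_set N) (F0T : F0 <= X k.+1)
  (F0le : forall f, f \in N -> ~~ (f <= X k) -> F0 <= f)
  (F0in : forall x, new k x -> ~~ (x <= F0) -> F0 \in N /\ new k F0).

Local Notation lo x := (x `&` X k).
Local Notation new := (new k).
Local Notation V := {ffun L -> R}.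

(** The nested set that [N] induces one level below. *)
Definition lower_set := [set lo f | f in N] :\ \bot.

Local Notation I' := (stratum_ideal k lower_set).

Lemma lower_setP f : f \in N -> lo f != \bot -> lo f \in lower_set.
Proof. by move=> fN f0; rewrite inE in_set1 f0; apply/imsetP; exists f. Qed.

Lemma lower_join a b : a \in G -> b \in G -> a `|` b \in G -> a `|` b <= X k ->
  I' ((h (a `|` b) - h a) * (h (a `|` b) - h b))%R.
Proof. by move=> *; apply/ideal_incl/StratumJoin. Qed.

Lemma lower_collapse f a : f \in N -> lo f != \bot -> a \in G -> a <= X k ->
  ~~ (a <= lo f) -> lo f `|` a \in G -> I' (h (lo f `|` a) - h a)%R.
Proof. by move=> *; apply/ideal_incl/StratumCollapse => //; apply: lower_setP. Qed.

Definition moving x := [&& x \in G, new x, ~~ is_atom x & x <= F0].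

Lemma moving_join x y : moving x -> y \in G -> new y -> y <= F0 ->
  moving (x `|` y).
Proof.
case/and4P=> xG nx ax xF yG ny yF; have /andP[yT _] := ny.
by rewrite /moving (Gmin_joinnew xG yG nx ny) new_join // (new_nonatom_join nx) //= leUx xF.
Qed.

Lemma moving_joinl x b : moving x -> b \in G -> b <= X k -> x `|` b \in G ->
  x `|` b <= F0 -> moving (x `|` b).
Proof.
case/and4P=> xG nx ax xF bG bH xbG xbF.
have bT : b <= X k.+1 by apply: le_trans bH (flag_le Xflag k).
by rewrite /moving xbG xbF new_join // (new_nonatom_join nx).
Qed.

Lemma moving_lo x : moving x -> lo x \in G.
Proof. by case/and4P=> *; apply: lo_Gmin. Qed.

Definition vscale (r : R) (v : V) : V := [ffun y => r * v y]%R.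
(** The vector that stands for [h x].  It is zero unless [x] is moving, so that
    [E a = 0] for atoms, as for [hvar]. *)
Definition basis x : V := [ffun y => ((y == x) && moving x)%:R]%R.
(** The vector that stands for [1]; its index [\bot] is not irreducible, hence free. *)
Definition basis0 : V := [ffun y => (y == \bot)%:R]%R.
Local Notation E := basis.

Lemma vaddE (v w : V) y : ((v + w) y = v y + w y)%R. Proof. by rewrite ffunE. Qed.
Lemma voppE (v : V) y : ((- v) y = - v y)%R. Proof. by rewrite ffunE. Qed.
Lemma vscaleE r v y : (vscale r v y = r * v y)%R. Proof. by rewrite ffunE. Qed.
Lemma v0E y : ((0 : V) y = 0)%R. Proof. by rewrite ffunE. Qed.
Let vE := (vaddE, voppE, vscaleE, v0E).

Lemma basis_atom a : is_atom a -> E a = 0%R.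
Proof.
move=> aa; apply/ffunP => y; rewrite !ffunE /moving aa.
by rewrite !andbF.
Qed.

(** The relations of the model: the ideal of the level below, the rest
    [(h (x `|` b)_- - h b) * (h (x `|` b) - h x)] of the join relations for new [x] and
    old [b], and the collapsing of [f `|` x] to [x] for old [f] in [N]. *)
Inductive vanishing : V -> Prop :=
| Vanish0 : vanishing 0%R
| VanishD v w of vanishing v & vanishing w : vanishing (v + w)%R
| VanishZ r v of vanishing v : vanishing (vscale r v)
| VanishI0 r of I' r : vanishing (vscale r basis0)
| VanishI r x of I' r & moving x : vanishing (vscale r (E x))
| VanishJoin x b of moving x & b \in G & b <= X k & x `|` b \in G
    & x `|` b <= F0 :
    vanishing (vscale (h (lo (x `|` b)) - h b)%R (E (x `|` b) - E x)%R)
| VanishCollapse f x of f \in N & f <= X k & x \in G & new x & x <= F0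
    & f `|` x \in G & f `|` x <= F0 : vanishing (E (f `|` x) - E x)%R.

Local Notation U := vanishing.

Lemma vanish_eq w v : U w -> v = w -> U v. Proof. by move=> ? ->. Qed.

Lemma vanishN v : U v -> U (- v)%R.
Proof.
move=> /(VanishZ (-1)) u; apply: vanish_eq u _.
by apply/ffunP => y; rewrite !vE mulN1r.
Qed.

Lemma vanishB v w : U v -> U w -> U (v - w)%R.
Proof. by move=> uv /vanishN; apply: VanishD. Qed.

Lemma vanishIE r x : I' r -> U (vscale r (E x)).
Proof.
move=> hr; have [mx|nmx] := boolP (moving x); first exact: VanishI.
apply: vanish_eq Vanish0 _; apply/ffunP => y.
by rewrite !ffunE (negbTE nmx) andbF mulr0.
Qed.

(** The product of [h x] and [h g] for [x] and [g] new at the same level. *)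
Definition mulE x g : V := vscale (h (lo (x `|` g))) (E x + E g - E (x `|` g))%R.

(** Consistency of the product formula with [h a = 0]: the atom [a] may be replaced
    by an old atom [b] with the same join, and the claim becomes a vanishing join
    relation. *)
Lemma mulE_atom x a : moving x -> is_atom a -> new a -> a <= F0 -> U (mulE x a).
Proof.
move=> mx aa na aF; have aG := atom_Gmin aa; have /and4P[xG nx ax xF] := mx.
have [ax'|ax'] := boolP (a <= x).
  apply: vanish_eq Vanish0 _; rewrite /mulE (join_idPl ax') (basis_atom aa).
  by apply/ffunP => y; rewrite !vE; ring.
have /andP[aT _] := na; have [b [ab bH bx exb _]] := new_join_atom nx aa aT ax'.
have bG := atom_Gmin ab; have xaG := Gmin_joinnew xG aG nx na.
have := VanishJoin mx bG bH; rewrite exb leUx xF aF => /(_ xaG isT) u.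
apply: vanish_eq (vanishN u) _; apply/ffunP => y.
by rewrite /mulE (basis_atom aa) (hvar_atom ab) !vE; ring.
Qed.

Definition mulV x (v : V) : V :=
  (vscale (v \bot) (E x) + \sum_(g | moving g) vscale (v g) (mulE x g))%R.

Lemma mulVD x v w : (mulV x (v + w) = mulV x v + mulV x w)%R.
Proof.
rewrite /mulV addrACA -big_split /=; congr (_ + _)%R.
  by apply/ffunP => y; rewrite !vE mulrDl.
by apply: eq_bigr => g _; apply/ffunP => y; rewrite !vE mulrDl.
Qed.

Lemma vsum_E (I : Type) (r : seq I) (P : pred I) (F : I -> V) y :
  ((\sum_(i <- r | P i) F i) y = \sum_(i <- r | P i) F i y)%R.
Proof. by rewrite sum_ffunE. Qed.

Lemma mulVZ x r v : mulV x (vscale r v) = vscale r (mulV x v).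
Proof.
apply/ffunP => y; rewrite /mulV !vE !vsum_E mulrDr mulr_sumr mulrA.
by congr (_ + _)%R; apply: eq_bigr => g _; rewrite !vE; ring.
Qed.

Lemma mulV_basis x g : moving g -> mulV x (E g) = mulE x g.
Proof.
move=> mg; have /and4P[gG _ _ _] := mg.
rewrite /mulV (bigD1 g) //= big1 ?addr0 => [|g' /andP[_ ne]].
  apply/ffunP => y; rewrite !vE !ffunE eqxx mg [\bot == g]eq_sym.
  by rewrite (negbTE (Gmin_neq0 gG)) /= mul0r mul1r add0r.
by apply/ffunP => y; rewrite !vE ffunE (negbTE ne) mul0r.
Qed.

Lemma mulV_basis0 x : mulV x basis0 = E x.
Proof.
rewrite /mulV big1 ?addr0 => [|g /and4P[gG _ _ _]].
  by apply/ffunP => y; rewrite !vE ffunE eqxx mul1r.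
by apply/ffunP => y; rewrite !vE ffunE (negbTE (Gmin_neq0 gG)) mul0r.
Qed.

Lemma mulVN x v : (mulV x (- v) = - mulV x v)%R.
Proof.
have -> : (- v = vscale (-1) v)%R by apply/ffunP => y; rewrite !vE mulN1r.
by rewrite mulVZ; apply/ffunP => y; rewrite !vE mulN1r.
Qed.

Lemma mulV0 x : mulV x 0%R = 0%R.
Proof.
have e0 : (0 : V)%R = vscale 0%R 0%R by apply/ffunP => y; rewrite !vE mul0r.
by rewrite {1}e0 mulVZ; apply/ffunP => y; rewrite !vE mul0r.
Qed.

Lemma mulE_C x g : mulE x g = mulE g x.
Proof. by rewrite /mulE joinC [(E x + _)%R]addrC. Qed.

Lemma join_through x y z t : new (y `|` z) -> t <= y `|` z -> ~~ (t <= X k) ->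
  (x `|` t) `|` lo (y `|` z) = x `|` (y `|` z).
Proof. by move=> nyz tyz tH; rewrite -joinA (new_split nyz tyz tH). Qed.

(** The first membership is a join relation of the model for the old element
    [lo (y `|` z)] and the new one [x `|` t], and the second is the join relation of
    these elements one level below. *)
Lemma fibre_join x y z t : moving x -> moving y -> moving z -> t \in G ->
    new t -> t <= y `|` z ->
  [/\ U (vscale (h (lo (x `|` (y `|` z))) - h (lo (y `|` z)))%R
           (E (x `|` (y `|` z)) - E (x `|` t))%R)
    & I' ((h (lo (x `|` (y `|` z))) - h (lo (y `|` z))) *
          (h (lo (x `|` (y `|` z))) - h (lo (x `|` t))))%R].
Proof.
move=> mx my mz tG nt tyz.
have /and4P[xG nx _ xF] := mx; have /and4P[yG ny _ yF] := my.
have /and4P[zG nz _ zF] := mz; have /andP[tT tH] := nt.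
have myz : moving (y `|` z) by apply: moving_join.
have /and4P[yzG nyz _ yzF] := myz.
have mxt : moving (x `|` t) by apply: moving_join => //; apply: le_trans yzF.
have /and4P[xtG nxt _ xtF] := mxt.
have mw : moving (x `|` (y `|` z)) by apply: moving_join.
have /and4P[wG nw _ wF] := mw.
have e1 := join_through x nyz tyz tH.
have := VanishJoin mxt (moving_lo myz) (leIr _ _); rewrite e1 => /(_ wG wF) u.
have e2 : lo (y `|` z) `|` lo (x `|` t) = lo (x `|` (y `|` z)).
  by rewrite joinC -lo_joinr ?leIr // e1.
split=> //; have := lower_join (moving_lo myz) (moving_lo mxt).
by rewrite e2 => /(_ (moving_lo mw) (leIr _ _)).
Qed.

(** A symmetric expression for the triple product of [h x], [h y] and [h z]. *)
Definition triple x y z : V :=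
  let w := x `|` (y `|` z) in let hw := h (lo w) in
  (vscale (hw * hw) (E x + E y + E z - E (x `|` y) - E (x `|` z) - E (y `|` z) + E w)
   - vscale (hw * (hw - h (lo (x `|` y)))) (E x + E y - E (x `|` y))
   - vscale (hw * (hw - h (lo (x `|` z)))) (E x + E z - E (x `|` z))
   - vscale (hw * (hw - h (lo (y `|` z)))) (E y + E z - E (y `|` z)))%R.

(** Associativity of the product formula modulo the relations.  Reducing
    [mulV x (mulE y z)] to the symmetric [triple] requires
    [p * (E x - E w)] multiplied by [h (lo w)] to vanish for [w = x `|` y `|` z]
    and [p = h (lo w) - h (lo (y `|` z))].  This is obtained by passing through
    [x `|` a] for a new atom [a] below [y], using [mulE_atom]. *)
Lemma mulV_mulE x y z : moving x -> moving y -> moving z ->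
  U (mulV x (mulE y z) - triple x y z)%R.
Proof.
move=> mx my mz; have /and4P[xG nx _ xF] := mx; have /and4P[yG ny _ yF] := my.
have /and4P[zG nz _ zF] := mz.
have myz : moving (y `|` z) by apply: moving_join.
have /andP[yT yH] := ny.
have [a aa [ay aT aH]] := flag_atom_new Lgeo yT yH.
have na : new a by rewrite /new aT.
have aF := le_trans ay yF.
have [uy ry] := fibre_join mx my mz yG ny (leUl _ _).
have [uz rz] := fibre_join mx my mz zG nz (leUr _ _).
have [ua ra] := fibre_join mx my mz (atom_Gmin aa) na (le_trans ay (leUl _ _)).
have ux := mulE_atom mx aa na aF.
have -> : mulV x (mulE y z) = vscale (h (lo (y `|` z)))
    (mulE x y + mulE x z - mulE x (y `|` z))%R.
  by rewrite [mulE y z]/mulE mulVZ !mulVD mulVN !mulV_basis.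
move: uy ry uz rz ua ra ux; rewrite /triple /mulE (basis_atom aa).
set w := x `|` (y `|` z); set hw := h (lo w); set p := (hw - h (lo (y `|` z)))%R.
set hxa := h (lo (x `|` a)); set Exa := E (x `|` a).
move=> uy ry uz rz ua ra ux.
pose hxy := h (lo (x `|` y)); pose hxz := h (lo (x `|` z)).
have v1 := vanishIE x ry; have v2 := vanishIE y ry; have v3 := vanishIE (x `|` y) ry.
have v4 := vanishIE x rz; have v5 := vanishIE z rz; have v6 := vanishIE (x `|` z) rz.
have v7 := vanishIE x ra; have v8 := vanishIE (x `|` a) ra.
have c1 := vanishB (VanishD v1 v2) v3.
have c2 := vanishB (VanishD v4 v5) v6.
(* [c3] is [hw * p * (E x - E w)], obtained through the element [x `|` a]. *)
have c3 := VanishD (vanishN (VanishZ hw ua)) (VanishD (vanishB v7 v8) (VanishZ p ux)).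
apply: vanish_eq (vanishB (VanishD c1 c2) (VanishD c3 (VanishD (VanishZ hw uy) (VanishZ hw uz)))) _.
apply/ffunP => t; rewrite !vE /p /Exa; ring.
Qed.

Lemma mulV_mulE_comm x y z : moving x -> moving y -> moving z ->
  U (mulV x (mulE y z) - mulV y (mulE x z))%R.
Proof.
move=> mx my mz; apply: vanish_eq (vanishB (mulV_mulE mx my mz) (mulV_mulE my mx mz)) _.
apply/ffunP => t; rewrite /triple [y `|` (x `|` z)]joinCA [y `|` x]joinC !vE; ring.
Qed.

Lemma vanish_sum (I : Type) (r : seq I) (P : pred I) (F : I -> V) :
  (forall i, P i -> U (F i)) -> U (\sum_(i <- r | P i) F i)%R.
Proof. by move=> hF; elim/big_ind: _ => //; [apply: Vanish0 | apply: VanishD]. Qed.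

Lemma mulV_comm x y v : moving x -> moving y ->
  U (mulV x (mulV y v) - mulV y (mulV x v))%R.
Proof.
move=> mx my.
have ev t s : mulV t (mulV s v) = (vscale (v \bot) (mulV t (E s)) +
    \sum_(g | moving g) vscale (v g) (mulV t (mulE s g)))%R.
  rewrite [mulV s v]/mulV mulVD mulVZ; congr (_ + _)%R.
  elim/big_rec2: _ => [|g w1 w2 _ <-]; first exact: mulV0.
  by rewrite mulVD mulVZ.
rewrite !ev opprD addrACA; apply: VanishD.
  rewrite !mulV_basis // [mulE y x]mulE_C subrr; exact: Vanish0.
rewrite -sumrB; apply: vanish_sum => g mg.
apply: vanish_eq (VanishZ (v g) (mulV_mulE_comm mx my mg)) _.
by apply/ffunP => t; rewrite !vE; ring.
Qed.

(** Multiplication by a new class preserves each family of relations.  For a join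
    relation with old element [b], set [B = x `|` g]: the difference
    [h E2 - h b], with [E2] the old part of [g `|` b], is killed by
    [h (lo (B `|` b)) - h (lo B)] in the level below.  For a collapse by [f], the
    case [lo B <= f] is special: all new elements below [B] have the same join
    with [f], among them an atom, so that the corresponding vectors vanish. *)
Lemma vanish_stable x v : moving x -> U v -> U (mulV x v).
Proof.
move=> mx; have /and4P[xG nx ax xF] := mx; have /andP[xT xH] := nx.
elim=> {v} [|v w _ hv _ hw|r v _ hv|r hr|r g hr mg|g b mg bG bH gbG gbF|f g fN fH gG ng gF fgG fgF].
- by rewrite mulV0; apply: Vanish0.
- by rewrite mulVD; apply: VanishD.
- by rewrite mulVZ; apply: VanishZ.
- by rewrite mulVZ mulV_basis0; apply: vanishIE.
- rewrite mulVZ mulV_basis //.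
  apply: vanish_eq (vanishB (VanishD (vanishIE x (idealM (h (lo (x `|` g))) hr))
    (vanishIE g (idealM (h (lo (x `|` g))) hr)))
    (vanishIE (x `|` g) (idealM (h (lo (x `|` g))) hr))) _.
  by apply/ffunP => y; rewrite /mulE !vE; ring.
- have mgb := moving_joinl mg bG bH gbG gbF.
  have /and4P[gG ng _ gF] := mg.
  have mB : moving (x `|` g) by apply: moving_join.
  have [BG nB aB BF] := and4P mB.
  have mB' : moving (x `|` (g `|` b)) by case/and4P: mgb => *; apply: moving_join.
  rewrite mulVZ mulVD mulVN !mulV_basis // /mulE joinA.
  have [bB|bB] := boolP (b <= x `|` g).
    rewrite (join_idPl bB).
    apply: vanish_eq (VanishZ (h (lo (x `|` g))) (VanishJoin mg bG bH gbG gbF)) _.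
    by apply/ffunP => y; rewrite !vE; ring.
  move: mB'; rewrite joinA; set B := x `|` g in BG nB aB BF mB bB *.
  set B' := B `|` b => mB'; have [BG' nB' _ BF'] := and4P mB'.
  set E2 := lo (g `|` b); have E2G : E2 \in G := moving_lo mgb.
  have E2H : E2 <= X k by apply: leIr.
  have gb : g <= B by apply: leUr.
  have /andP[_ gH] := ng.
  have eB' : B `|` E2 = B'.
    have ngb : new (g `|` b) by case/and4P: mgb.
    have e0 : g `|` E2 = g `|` b := new_split ngb (leUl _ _) gH.
    by rewrite /B' -(join_idPl gb) -joinA e0 joinA.
  have loB' : lo B' = lo B `|` b by apply: lo_joinr.
  have loB'2 : lo B' = lo B `|` E2 by rewrite -eB' lo_joinr.
  have uB1 := VanishJoin mB bG bH BG' BF'.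
  have uB2 : U (vscale (h (lo B') - h E2)%R (E B' - E B)%R).
    by have := VanishJoin mB E2G E2H; rewrite eB' => /(_ BG' BF').
  have r1 : I' ((h (lo B') - h (lo B)) * (h (lo B') - h b))%R.
    rewrite loB'; apply: lower_join; rewrite -?loB' ?leIr ?moving_lo //.
  have r2 : I' ((h (lo B') - h (lo B)) * (h (lo B') - h E2))%R.
    rewrite loB'2; apply: lower_join; rewrite -?loB'2 ?leIr ?moving_lo //.
  have r3 : I' ((h (lo B') - h (lo B)) * (h E2 - h b))%R.
    have -> : ((h (lo B') - h (lo B)) * (h E2 - h b) =
       (h (lo B') - h (lo B)) * (h (lo B') - h b) - (h (lo B') - h (lo B)) * (h (lo B') - h E2))%R by ring.
    exact: idealB.
  have uBd := vanishB uB1 uB2.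
  have ug := VanishJoin mg bG bH gbG gbF.
  have w1 := vanishB (VanishD (vanishIE x r3) (vanishIE g r3)) (vanishIE B r3).
  apply: vanish_eq (VanishD w1 (vanishB (VanishZ (h (lo B')) ug) (VanishZ (h (lo B')) uBd))) _.
  by apply/ffunP => y; rewrite !vE -/E2; ring.
- have fG' := NG fN; have f0 := Gmin_neq0 fG'.
  have flo : lo f = f by apply/meet_idPl.
  have /andP[gT gH] := ng.
  have mfg : moving (f `|` g).
    rewrite /moving fgG fgF joinC new_join ?(le_trans fH) ?flag_le //= andbT.
    rewrite joinC; apply: (new_nonatom f0); rewrite lt_neqAle leUl andbT.
    by apply: contra gH => /eqP ef; apply: le_trans fH; rewrite ef leUr.
  have [_ nfg _ _] := and4P mfg.
  have mB : moving (x `|` g) by apply: moving_join.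
  have eB : x `|` (f `|` g) = f `|` (x `|` g) by rewrite joinCA.
  have mB' : moving (f `|` (x `|` g)) by rewrite -eB; apply: moving_join.
  have [BG nB _ BF] := and4P mB; have [BG' nB' _ BF'] := and4P mB'.
  have uB := VanishCollapse fN fH BG nB BF BG' BF'.
  have ug := VanishCollapse fN fH gG ng gF fgG fgF.
  have ud : U (mulV x (E g) - mulE x g)%R.
    have [ag|ag] := boolP (is_atom g).
      by rewrite basis_atom // mulV0 sub0r; apply/vanishN/mulE_atom.
    by rewrite mulV_basis ?subrr; [apply: Vanish0 | rewrite /moving gG ng ag].
  rewrite mulVD mulVN mulV_basis //.
  suff u : U (mulE x (f `|` g) - mulE x g)%R.
    apply: vanish_eq (vanishB u ud) _.
    by apply/ffunP => y; rewrite !vE; ring.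
  rewrite /mulE eB (lo_join (x `|` g) fH); move: uB ug {ud} mB mB' BG nB BF BG' nB' BF' eB.
  set B := x `|` g => uB ug mB mB' BG nB BF BG' nB' BF' eB.
  have [Bf|Bf] := boolP (lo B <= f); last first.
    have r : I' (h (f `|` lo B) - h (lo B))%R.
      have := lower_collapse fN; rewrite flo => /(_ (lo B) f0); apply => //.
      - exact: moving_lo.
      - exact: leIr.
      - by rewrite -lo_join //; apply: moving_lo.
    have w := vanishB (VanishD (vanishIE x r) (vanishIE g r)) (vanishIE B r).
    apply: vanish_eq (VanishD w (VanishZ (h (f `|` lo B)) (vanishB ug uB))) _.
    by apply/ffunP => y; rewrite !vE; ring.
  have loB' : lo (f `|` B) = f by rewrite lo_join // (join_idPl Bf).
  have eqB t : t <= B -> ~~ (t <= X k) -> f `|` t = f `|` B.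
    move=> tB tH; apply/esym/(new_eq nB' _ _ _ tH).
    - by rewrite (le_trans tB) // leUr.
    - exact: leUr.
    - by rewrite leU2.
    - by rewrite loB' leUl.
  have efx : f `|` x = f `|` B by apply: eqB => //; apply: leUl.
  have efg : f `|` g = f `|` B by apply: eqB => //; apply: leUr.
  have [a aa [aX aT aH]] := flag_atom_new Lgeo xT xH.
  have efa : f `|` a = f `|` B by apply: eqB => //; apply: le_trans aX (leUl _ _).
  have ux : U (E (f `|` B) - E x)%R.
    by rewrite -efx; apply: VanishCollapse; rewrite ?efx.
  have ua : U (E (f `|` B))%R.
    have na : new a by rewrite /new aT.
    have := VanishCollapse fN fH (atom_Gmin aa) na (le_trans aX xF).
    by rewrite efa (basis_atom aa) subr0 => /(_ BG' BF').
  rewrite efg in ug *.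
  have uT := vanishB (VanishD (vanishB ua ux) uB) ug.
  apply: vanish_eq (vanishB (VanishZ (h (f `|` lo B)) (vanishB ua ux)) (VanishZ (h (lo B)) uT)) _.
  by apply/ffunP => y; rewrite !vE; ring.
Qed.

(** The old class that agrees with [h x] when [x] is not moving. *)
Definition shadow x : R :=
  if [&& x \in G, new x & ~~ is_atom x] then h (lo (x `|` F0)) else h x.

Definition act x (v : V) : V := if moving x then mulV x v else vscale (shadow x) v.

Lemma actB x : zmod_morphism (act x).
Proof.
move=> v w; rewrite /act; case: ifP => _; first by rewrite mulVD mulVN.
by apply/ffunP => y; rewrite !vE mulrDr mulrN.
Qed.

HB.instance Definition _ x := GRing.isZmodMorphism.Build V V (act x) (actB x).

Lemma vanish_act x v : U v -> U (act x v).
Proof.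
by rewrite /act; case: ifP => mx uv; [apply: vanish_stable | apply: VanishZ].
Qed.

Lemma act_comm x y v : U (act x (act y v) - act y (act x v))%R.
Proof.
rewrite /act; case: ifP => mx; case: ifP => my.
- exact: mulV_comm.
- by rewrite mulVZ subrr; apply: Vanish0.
- by rewrite mulVZ subrr; apply: Vanish0.
- apply: vanish_eq Vanish0 _; apply/ffunP => t; rewrite !vE; ring.
Qed.

(** The value of a polynomial on the unit vector of the model. *)
Definition eval (q : R) : V :=
  poly_act (fun i => act (e i) : {additive V -> V}) basis0 q.

Lemma eval_mulX i q : U (eval ('X_i * q) - act (e i) (eval q))%R.
Proof.
apply: (poly_act_mulX Vanish0 VanishD vanishN) => *.
  exact: vanish_act.
exact: act_comm.
Qed.

Lemma evalB q r : eval (q - r)%R = (eval q - eval r)%R.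
Proof. exact: poly_actB. Qed.

Lemma act_notin x v : (forall i, e i != x) -> act x v = 0%R.
Proof.
move=> ex; have ng : ~~ ((x \in G) && ~~ is_atom x).
  by apply/negP => /andP[xG ax]; have [i /eqP] := e_surj xG ax; apply/negP.
have -> : act x v = vscale (h x) v.
  rewrite /act /moving /shadow; case: (x \in G) ng => //=; rewrite negbK => ->.
  by rewrite !andbF.
by rewrite hvar_notin //; apply/ffunP => y; rewrite !vE mul0r.
Qed.

Lemma eval_hvar x q : U (eval (h x * q) - act x (eval q))%R.
Proof.
have [/existsP[i /eqP <-]|/existsPn ex] := boolP [exists i, e i == x].
  by rewrite hvar_e; apply: eval_mulX.
rewrite (hvar_notin ex) act_notin // mul0r /eval poly_act0 subrr; exact: Vanish0.
Qed.

Lemma eval_hvar1 x : U (eval (h x) - act x basis0)%R.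
Proof.
have := eval_hvar x 1; rewrite mulr1 [eval 1](_ : _ = basis0) //.
exact: poly_act1.
Qed.

Lemma eval_join x y z :
  let w := (act x basis0 - act z basis0)%R in
  U (act x w - act y w)%R -> U (eval ((h x - h y) * (h x - h z)))%R.
Proof.
move=> w uw; rewrite mulrBl evalB.
have ew : U (eval (h x - h z) - w)%R.
  apply: vanish_eq (vanishB (eval_hvar1 x) (eval_hvar1 z)) _.
  by rewrite evalB /w; apply/ffunP => t; rewrite !vE; ring.
have ux := eval_hvar x (h x - h z); have uy := eval_hvar y (h x - h z).
have vx := vanish_act x ew; have vy := vanish_act y ew.
apply: vanish_eq (VanishD (vanishB (VanishD ux vx) (VanishD uy vy)) uw) _.
by rewrite !raddfB /=; apply/ffunP => t; rewrite !vE; ring.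
Qed.

Lemma act_fixed x v : x <= X k -> act x v = vscale (h x) v.
Proof. by move=> xH; rewrite /act /shadow /moving /new xH !andbF. Qed.

Lemma act_basis0 x : new x -> x \in G -> x <= F0 -> act x basis0 = E x.
Proof.
move=> nx xG xF; rewrite /act; case: ifP => mx; first by rewrite mulV_basis0.
have ax : is_atom x by apply: contraFT mx => ax; rewrite /moving xG nx ax.
rewrite /shadow ax !andbF hvar_atom // basis_atom //.
by apply/ffunP => y; rewrite !vE mul0r.
Qed.

Lemma act_basis x g : x \in G -> new x -> x <= F0 -> g \in G -> new g -> g <= F0 ->
  U (act x (E g) - mulE x g)%R.
Proof.
move=> xG nx xF gG ng gF; have [ax|ax] := boolP (is_atom x).
  have -> : act x (E g) = 0%R.
    rewrite /act /moving ax !andbF /= /shadow ax !andbF hvar_atom //.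
    by apply/ffunP => y; rewrite !vE mul0r.
  rewrite sub0r; apply: vanishN; have [ag|ag] := boolP (is_atom g); last first.
    by rewrite mulE_C; apply: mulE_atom => //; rewrite /moving gG ng ag.
  have [gx|gx] := boolP (g <= x).
    apply: vanish_eq Vanish0 _; rewrite /mulE (join_idPl gx) !basis_atom //.
    by apply/ffunP => y; rewrite !vE; ring.
  have /andP[gT _] := ng; have [b [ab _ _ _ eb]] := new_join_atom nx ag gT gx.
  apply: vanish_eq Vanish0 _; move: ax; rewrite (new_atom nx) => /eqP lx.
  rewrite /mulE eb lx join0x hvar_atom //.
  by apply/ffunP => y; rewrite !vE mul0r.
have mx : moving x by rewrite /moving xG nx ax.
rewrite {1}/act mx; have [ag|ag] := boolP (is_atom g).
  by rewrite basis_atom // mulV0 sub0r; apply/vanishN/mulE_atom.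
by rewrite mulV_basis ?subrr; [apply: Vanish0 | rewrite /moving gG ng ag].
Qed.

Lemma act_shadow x v : ~~ (x <= F0) -> act x v = vscale (shadow x) v.
Proof. by move=> xF; rewrite /act /moving (negbTE xF) !andbF. Qed.

Lemma lo_joinF0 x : x \in G -> new x -> ~~ (x <= F0) ->
  [/\ F0 \in N, new F0, F0 \in G, moving F0 \/ is_atom F0 & lo (x `|` F0) \in G].
Proof.
move=> xG nx xF; have [fN nF] := F0in nx xF; have FG := NG fN.
split=> //.
  have [aF|aF] := boolP (is_atom F0); [by right | left].
  by rewrite /moving FG nF aF lexx.
apply: lo_Gmin; first exact: (Gmin_joinnew xG FG nx nF).
  exact: new_join.
rewrite joinC; apply: (new_nonatom (Gmin_neq0 FG)); rewrite lt_neqAle leUl andbT.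
by apply: contra xF => /eqP ->; apply: leUr.
Qed.

(** For an atom [x] the shadow is zero; as [x] can be replaced by an old atom, the
    class of [lo (x `|` F0)] collapses to the class of that atom, which is zero. *)
Lemma shadow_new x : x \in G -> new x -> ~~ (x <= F0) ->
  I' (shadow x - h (lo (x `|` F0)))%R.
Proof.
move=> xG nx xF; have [fN nF FG _ DG] := lo_joinF0 xG nx xF.
rewrite /shadow xG nx /=; have [ax|ax] := boolP (is_atom x) => /=; last first.
  by rewrite subrr; apply: ideal0.
rewrite hvar_atom // sub0r; apply: idealN; have /andP[xT _] := nx.
have [b [ab bH bF eb elo]] := new_join_atom nF ax xT xF.
rewrite joinC elo; have [F00|F00] := eqVneq (lo F0) \bot.
  by rewrite F00 join0x hvar_atom //; apply: ideal0.
have := lower_collapse fN F00 (atom_Gmin ab) bH; rewrite (hvar_atom ab) subr0.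
apply; last by rewrite -elo joinC.
by apply: contra bF => /le_trans; apply; apply: leIl.
Qed.

(** The join relation acts by zero.  The cases depend on the positions of [a] and
    [b] with respect to [X k] and [F0]. *)
Section JoinRelation.
Variables a b : L.
Hypotheses (aG : a \in G) (bG : b \in G) (cG : a `|` b \in G)
  (cT : a `|` b <= X k.+1).
Local Notation c := (a `|` b).
Let w := (act c basis0 - act b basis0)%R.

Let aT : a <= X k.+1. Proof. exact: le_trans (leUl _ _) cT. Qed.
Let bT : b <= X k.+1. Proof. exact: le_trans (leUr _ _) cT. Qed.

Lemma join_vanish_old : c <= X k -> U (act c w - act a w)%R.
Proof.
move=> cH; have aH := le_trans (leUl _ _) cH; have bH := le_trans (leUr _ _) cH.
rewrite /w !act_fixed //.
apply: vanish_eq (VanishI0 (lower_join aG bG cG cH)) _.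
by apply/ffunP => t; rewrite !vE; ring.
Qed.

Lemma join_vanish_moving_new : c <= F0 -> new a -> new b -> U (act c w - act a w)%R.
Proof.
move=> cF na nb; have nc : new c by apply: new_join.
have aF := le_trans (leUl _ _) cF; have bF := le_trans (leUr _ _) cF.
rewrite /w !act_basis0 // !raddfB /=.
have := vanishB (vanishB (act_basis cG nc cF cG nc cF) (act_basis cG nc cF bG nb bF))
  (vanishB (act_basis aG na aF cG nc cF) (act_basis aG na aF bG nb bF)).
move=> u; apply: vanish_eq u _; rewrite /mulE joinxx -joinA joinxx joinA joinxx.
by apply/ffunP => t; rewrite !vE; ring.
Qed.

Lemma join_vanish_moving_old : c <= F0 -> new a -> b <= X k -> U (act c w - act a w)%R.
Proof.
move=> cF na bH; have nc : new c by apply: new_join.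
have aF := le_trans (leUl _ _) cF.
rewrite /w (act_fixed _ bH) act_basis0 // !raddfB /=.
have eZ t v : act t (vscale (h b) v) = vscale (h b) (act t v).
  rewrite /act; case: ifP => _; first by rewrite mulVZ.
  by apply/ffunP => y; rewrite !vE; ring.
rewrite !eZ !act_basis0 //.
have := vanishB (act_basis cG nc cF cG nc cF) (act_basis aG na aF cG nc cF).
rewrite /mulE joinxx joinA joinxx => u.
suff u2 : U (vscale (h (lo c) - h b)%R (E c - E a)%R).
  by apply: vanish_eq (VanishD u u2) _; apply/ffunP => t; rewrite !vE; ring.
have [ma|ma] := boolP (moving a); first exact: VanishJoin.
have aa : is_atom a by apply: contraR ma => aa; rewrite /moving aG na aa.
move: aa; rewrite (new_atom na) => /eqP la; rewrite lo_joinr // la join0x subrr.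
by apply: vanish_eq Vanish0 _; apply/ffunP => t; rewrite !vE mul0r.
Qed.

Lemma join_vanish_mixed : ~~ (c <= F0) -> new a -> a <= F0 ->
  U (act c w - act a w)%R.
Proof.
move=> cF na aF; have nc : new c by apply: new_join.
suff uw : U w by apply: vanishB; apply: vanish_act.
have [fN nF FG mF DG] := lo_joinF0 cG nc cF.
have bF : ~~ (b <= F0) by apply: contra cF; rewrite leUx aF.
have eF : c `|` F0 = b `|` F0 by rewrite joinAC (join_idPr aF) joinC.
rewrite /w !act_shadow //.
suff r : I' (shadow c - shadow b)%R.
  by apply: vanish_eq (VanishI0 r) _; apply/ffunP => t; rewrite !vE; ring.
have rc := shadow_new cG nc cF.
have [bH|bH] := boolP (b <= X k); last first.
  have nb : new b by rewrite /new bT.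
  apply: ideal_eq (idealB rc (shadow_new bG nb bF)) _.
  by rewrite eF; ring.
have -> : shadow b = h b by rewrite /shadow /new bH !andbF.
suff r2 : I' (h (lo (c `|` F0)) - h b)%R by apply: ideal_eq (idealD rc r2) _; ring.
rewrite eF joinC lo_joinr //; have [F00|F00] := eqVneq (lo F0) \bot.
  by rewrite F00 join0x subrr; apply: ideal0.
apply: lower_collapse => //; last by rewrite -lo_joinr // joinC -eF.
by apply: contra bF => /le_trans; apply; apply: leIl.
Qed.

Lemma join_vanish_shadow : new a -> ~~ (a <= F0) -> b <= X k \/ new b /\ ~~ (b <= F0) ->
  U (act c w - act a w)%R.
Proof.
move=> na aF bP; have nc : new c by apply: new_join.
have cF : ~~ (c <= F0) by apply: contra aF; apply: le_trans (leUl _ _).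
have [fN nF FG _ ZG] := lo_joinF0 cG nc cF.
have [_ _ _ _ YG] := lo_joinF0 aG na aF.
have rc := shadow_new cG nc cF; have ra := shadow_new aG na aF.
suff r : I' ((shadow c - shadow a) * (h (lo (c `|` F0)) - (if (b <= X k)%O then h b else h (lo (b `|` F0)))))%R.
  have [sb hsb eb] : exists2 sb, I' sb &
      act b basis0 = vscale ((if (b <= X k)%O then h b else h (lo (b `|` F0))) + sb)%R basis0.
    case: ifP bP => bH [|[nb bF]] //.
    - by move=> _; exists 0%R; [apply: ideal0 | rewrite addr0 act_fixed].
    - by case/andP: nb => _; rewrite bH.
    - exists (shadow b - h (lo (b `|` F0)))%R; first exact: shadow_new.
      by rewrite act_shadow // addrC subrK.
  rewrite /w eb !(act_shadow _ cF) !(act_shadow _ aF).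
  have r' := idealD (idealD r (idealM (shadow c - shadow a)%R rc))
    (idealN (idealM (shadow c - shadow a)%R hsb)).
  by apply: vanish_eq (VanishI0 r') _; apply/ffunP => t; rewrite !vE; ring.
have /andP[FT _] := nF; have /andP[cT' _] := nc.
have naF : new (a `|` F0) by apply: new_join.
set B := (if _ then _ else _).
have r : I' ((h (lo (c `|` F0)) - h (lo (a `|` F0))) * (h (lo (c `|` F0)) - B))%R.
  rewrite /B; case: ifP bP => bH [|[nb bF]] //.
  - move=> _; have e1 : lo (c `|` F0) = lo (a `|` F0) `|` b.
      by rewrite joinAC lo_joinr.
    by rewrite e1; apply: lower_join; rewrite -?e1 // leIr.
  - by case/andP: nb => _; rewrite bH.
  - have [_ _ _ _ BG] := lo_joinF0 bG nb bF.
    have e1 : lo (c `|` F0) = lo (a `|` F0) `|` lo (b `|` F0).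
      rewrite -(lo_joinnew nF) ?leUr ?leUx ?aT ?bT ?FT //.
      by rewrite joinACA joinxx.
    by rewrite e1; apply: lower_join; rewrite -?e1 // leIr.
apply: ideal_eq (idealD r (idealMr (h (lo (c `|` F0)) - B)%R (idealB rc ra))) _.
by ring.
Qed.

End JoinRelation.

(** The relation is symmetric in [a] and [b], so that [a] may be assumed new as
    soon as the join is. *)
Lemma eval_join_relation a b : a \in G -> b \in G -> a `|` b \in G ->
  a `|` b <= X k.+1 -> U (eval ((h (a `|` b) - h a) * (h (a `|` b) - h b))%R).
Proof.
move=> aG bG cG cT; have aT := le_trans (leUl _ _) cT; have bT := le_trans (leUr _ _) cT.
have [cH|cH] := boolP (a `|` b <= X k).
  by apply: eval_join; apply: join_vanish_old.
wlog aH : a b aG bG cG cT aT bT cH / ~~ (a <= X k) => [wl|].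
  have [aH|aH] := boolP (a <= X k); last exact: wl.
  have bH : ~~ (b <= X k) by apply: contra cH; rewrite leUx aH.
  by rewrite mulrC joinC; apply: wl; rewrite // joinC.
have na : new a by rewrite /new aT.
have [cF|cF] := boolP (a `|` b <= F0).
  apply: eval_join; have [bH|bH] := boolP (b <= X k).
    exact: join_vanish_moving_old.
  by apply: join_vanish_moving_new; rewrite // /new bT.
have [aF|aF] := boolP (a <= F0); first by apply: eval_join; apply: join_vanish_mixed.
have [bH|bH] := boolP (b <= X k).
  by apply: eval_join; apply: join_vanish_shadow => //; left.
have nb : new b by rewrite /new bT.
have [bF|bF] := boolP (b <= F0); last first.
  by apply: eval_join; apply: join_vanish_shadow => //; right.
rewrite mulrC joinC; apply: eval_join; apply: join_vanish_mixed; rewrite // joinC //.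
Qed.

Lemma eval_collapse x y : U (act x basis0 - act y basis0)%R -> U (eval (h x - h y)).
Proof.
move=> u; rewrite evalB.
apply: vanish_eq (VanishD (vanishB (eval_hvar1 x) (eval_hvar1 y)) u) _.
by apply/ffunP => t; rewrite !vE; ring.
Qed.

(** The nestedness of [N] is used here, to compare an old [f] with [F0]. *)
Lemma eval_collapse_relation f a : f \in N -> a \in G -> a <= X k.+1 ->
  ~~ (a <= f) -> f `|` a \in G -> U (eval (h (f `|` a) - h a)%R).
Proof.
move=> fN aG aT af cG; apply: eval_collapse; set c := f `|` a in cG *.
have fG := NG fN; have f0 := Gmin_neq0 fG; have fT := NT fN.
have cT : c <= X k.+1 by rewrite leUx fT.
have fc : f < c by rewrite lt_leAnge leUl /= /c leUx lexx.
have atc : ~~ is_atom c := new_nonatom f0 fc.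
have scal r s : I' (r - s)%R -> U (vscale r basis0 - vscale s basis0)%R.
  move=> /VanishI0 u; apply: vanish_eq u _.
  by apply/ffunP => t; rewrite !vE; ring.
have [fH|fH] := boolP (f <= X k).
  have flo : lo f = f by apply/meet_idPl.
  have coll t : t \in G -> t <= X k -> ~~ (t <= f) -> f `|` t \in G -> I' (h (f `|` t) - h t)%R.
    by move=> *; have := lower_collapse (a := t) fN; rewrite flo; apply.
  have [aH|aH] := boolP (a <= X k).
    have cH : c <= X k by rewrite leUx fH.
    by rewrite !act_fixed //; apply/scal/coll.
  have na : new a by rewrite /new aT.
  have nc : new c by rewrite /c joinC; apply: new_join.
  have clo : lo c = f `|` lo a by rewrite /c lo_join.
  have [aF|aF] := boolP (a <= F0).
    have fF : f <= F0.
      apply/negPn/negP => fF; have cF : ~~ (c <= F0).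
        by apply: contra fF; apply: le_trans (leUl _ _).
      have [FN nF FG _ _] := lo_joinF0 cG nc cF; have /andP[_ FH] := nF.
      have := Nnest fN FN; rewrite /nested (negbTE fF) /= => /orP[Ff|].
        by rewrite (le_trans Ff fH) in FH.
      by rewrite joinC (Gmin_joinl FG fG aG aF) // joinC.
    have cF : c <= F0 by rewrite leUx fF.
    by rewrite !act_basis0 //; apply: VanishCollapse.
  have [FN nF FG _ DG] := lo_joinF0 aG na aF; have /andP[FT FH] := nF.
  have cF : ~~ (c <= F0) by apply: contra aF; apply: le_trans (leUr _ _).
  have rc := shadow_new cG nc cF; have ra := shadow_new aG na aF.
  rewrite !act_shadow //; apply: scal.
  suff r : I' (h (lo (c `|` F0)) - h (lo (a `|` F0)))%R.
    by apply: ideal_eq (idealD (idealB rc ra) r) _; ring.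
  have eD : lo (c `|` F0) = f `|` lo (a `|` F0) by rewrite /c -joinA (lo_join _ fH).
  set D := lo (a `|` F0) in DG eD *.
  have DH : D <= X k by apply: leIr.
  (* If [D <= f], no collapse is available, but nestedness of [f] and [F0] forces
     [f <= D]: otherwise [f `|` F0] would be the irreducible [c]. *)
  have [Df|Df] := boolP (D <= f); last first.
    rewrite eD; apply: coll => //; rewrite -eD.
    by have [] := lo_joinF0 cG nc cF.
  rewrite eD; suff fD : f <= D by rewrite (join_idPr fD) subrr; apply: ideal0.
  have := Nnest fN FN; rewrite /nested => /or3P[fF|Ff|].
  - by rewrite lexI fH (le_trans fF) ?leUr.
  - by rewrite (le_trans Ff fH) in FH.
  have naF : new (a `|` F0) by apply: new_join.
  have aFc : a `|` F0 <= c.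
    apply: (new_join_le naF (z := a)); rewrite ?leUl //.
    - by rewrite clo (le_trans Df) // leUl.
    - exact: leUr.
  have Fc : F0 <= c by apply: le_trans aFc; apply: leUr.
  suff -> : f `|` F0 = c by rewrite cG.
  apply/esym/(new_eq nc Fc); rewrite ?leUr ?leUx ?Fc ?leUl //.
  rewrite clo leUx leUl /= (le_trans _ (leUl f F0)) // (le_trans _ Df) // /D.
  by rewrite leI2 // leUl.
have Ff := F0le fN fH; have nf : new f by rewrite /new fT.
have nc : new c by apply: new_join.
have cF : ~~ (c <= F0) by apply: contra af => /(le_trans (leUr _ _))/le_trans; apply.
have [FN nF FG _ _] := lo_joinF0 cG nc cF; have /andP[FT FH] := nF.
have Fc : F0 <= c by apply: le_trans Ff (leUl _ _).
have rc := shadow_new cG nc cF; rewrite (join_idPl Fc) in rc.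
have cloG := lo_Gmin cG nc atc.
have [aH|aH] := boolP (a <= X k).
  rewrite act_shadow // act_fixed //; apply: scal.
  suff r : I' (h (lo c) - h a)%R by apply: ideal_eq (idealD rc r) _; ring.
  have ec : lo c = lo f `|` a by rewrite /c lo_joinr.
  rewrite ec; have [f00|f00] := eqVneq (lo f) \bot.
    by rewrite f00 join0x subrr; apply: ideal0.
  apply: lower_collapse => //; last by rewrite -ec.
  by apply: contra af => /le_trans; apply; apply: leIl.
have na : new a by rewrite /new aT.
have aF : ~~ (a <= F0) by apply: contra af => /le_trans; apply.
have ra := shadow_new aG na aF.
rewrite !act_shadow //; apply: scal.
suff r : I' (h (lo c) - h (lo (a `|` F0)))%R.
  by apply: ideal_eq (idealD (idealB rc ra) r) _; ring.
have [ef|nef] := eqVneq f F0.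
  by rewrite /c ef joinC subrr; apply: ideal0.
have naF : new (a `|` F0) by apply: new_join.
have ec : lo c = lo f `|` lo (a `|` F0).
  rewrite -lo_join ?leIr //; congr (_ `&` _).
  by rewrite /c -[in LHS](new_split nf Ff FH) [F0 `|` lo f]joinC -joinA [F0 `|` a]joinC.
have atf : ~~ is_atom f.
  by apply: (new_nonatom (Gmin_neq0 FG)); rewrite lt_neqAle eq_sym nef.
rewrite ec; apply: lower_collapse => //.
- by rewrite -(new_atom nf).
- by have [] := lo_joinF0 aG na aF.
- exact: leIr.
- apply: contra af => le; apply: le_trans (leUl a F0) _.
  by apply: (new_join_le naF (z := F0)); rewrite ?leUr.
- by rewrite -ec.
Qed.

Lemma eval_stratum_ideal q : stratum_ideal k.+1 N q -> U (eval q).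
Proof.
apply: (poly_act_ideal Vanish0 VanishD vanishN) => [*|*|r]; first exact: vanish_act.
  exact: act_comm.
by case=> *; [apply: eval_join_relation | apply: eval_collapse_relation].
Qed.

(** * Independence of the normal monomials *)

(** The coefficient of the unit vector detects the monomials without new
    variable. *)
Lemma vanish_basis0 v : U v -> I' (v \bot).
Proof.
have E0 x : E x \bot = 0%R.
  rewrite ffunE; case: eqP => //= <-; rewrite /moving.
  by rewrite (negbTE (bot_notin_Gmin L)).
elim=> {v} [|v w _ hv _ hw|r v _ hv|r hr|r g hr mg|g b mg bG bH gbG gbF|f g fN fH gG ng gF fgG fgF];
  rewrite !vE ?E0.
- exact: ideal0.
- exact: idealD.
- exact: idealM.
- by rewrite ffunE eqxx mulr1.
- by rewrite mulr0; apply: ideal0.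
- by rewrite subrr mulr0; apply: ideal0.
- by rewrite subrr; apply: ideal0.
Qed.

(** When [lo g <= f], the element [g] has the same join with [f] as any new atom
    below it, so that its class vanishes on the stratum of [f]. *)
Definition killed g := [exists f in N, (f <= X k) && (lo g <= f)].

(** The functional that detects [h g1].  It sums over all the surviving vectors below
    [g1], so that the two sides of a join or collapse relation have the same residue
    up to the relations of the stratum of [lo g1]. *)
Definition residue g1 (v : V) : R :=
  (\sum_(g | [&& moving g, (g <= g1)%O & ~~ killed g]) v g)%R.

Lemma residueD g1 v w : residue g1 (v + w)%R = (residue g1 v + residue g1 w)%R.
Proof. by rewrite /residue -big_split; apply: eq_bigr => g _; rewrite vE. Qed.

Lemma residueZ g1 r v : residue g1 (vscale r v) = (r * residue g1 v)%R.
Proof. by rewrite /residue mulr_sumr; apply: eq_bigr => g _; rewrite vE. Qed.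

Lemma residueB g1 v w : residue g1 (v - w)%R = (residue g1 v - residue g1 w)%R.
Proof. by rewrite /residue -sumrB; apply: eq_bigr => g _; rewrite !vE. Qed.

Lemma residue_basis g1 x :
  residue g1 (E x) = ([&& moving x, (x <= g1)%O & ~~ killed x]%:R)%R.
Proof.
rewrite /residue; case hx: [&& _, _ & _].
  rewrite (bigD1 x) //= big1 => [|g /andP[_ /negbTE ne]]; last by rewrite ffunE ne.
  by rewrite ffunE eqxx addr0; case/and3P: hx => ->.
rewrite big1 // => g hg; rewrite ffunE; case: eqP => // e0.
by rewrite -e0 hg in hx.
Qed.

(** A relation between [x] and [x `|` b] is seen by the residue only if exactly one
    of the two elements is counted: either [b] is not below [lo g1], or some [f] in
    [N] kills [x] and not [x `|` b].  In both cases [h (lo (x `|` b))] and [h b]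
    collapse to the same class, on the stratum of [lo g1] or of [f]. *)
Lemma vanish_residue g1 v : moving g1 ->
    (forall f, f \in N -> f <= X k -> f <= g1 \/ f `|` g1 \notin G) ->
  U v -> stratum_ideal k (lo g1 |: lower_set) (residue g1 v).
Proof.
move=> mg1 closed1; set J := stratum_ideal k _.
have JI r : I' r -> J r by apply: stratum_ideal_sub; apply: subsetUr.
have wG := moving_lo mg1.
have collapse f x b : f \in lo g1 |: lower_set -> f \in G -> f <= X k ->
    moving x -> b \in G -> b <= X k -> x `|` b \in G -> moving (x `|` b) ->
    lo x <= f -> ~~ (b <= f) -> J (h (lo (x `|` b)) - h b)%R.
  move=> fN fG fH mx bG bH xbG mxb xf bf.
  have eE : lo (x `|` b) = lo x `|` b by apply: lo_joinr.
  have EG := moving_lo mxb; have xG := moving_lo mx.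
  have fE : f `|` lo (x `|` b) = f `|` b.
    by rewrite eE joinA (join_idPl xf).
  have fEG : f `|` lo (x `|` b) \in G.
    rewrite joinC; apply: (Gmin_join Lgeo) => //.
    apply: contra (Gmin_neq0 xG); rewrite -!lex0; apply: le_trans.
    by rewrite lexI xf eE leUl.
  have r1 : J (h (f `|` lo (x `|` b)) - h (lo (x `|` b)))%R.
    apply/ideal_incl/StratumCollapse => //; first exact: leIr.
    by apply: contra bf; apply: le_trans; rewrite eE leUr.
  have r2 : J (h (f `|` b) - h b)%R.
    by apply/ideal_incl/StratumCollapse => //; rewrite -fE.
  by apply: ideal_eq (idealB r2 r1) _; rewrite fE; ring.
have killedP x f : f \in N -> f <= X k -> lo x <= f -> killed x.
  by move=> *; apply/'exists_andP; exists f; split => //; apply/andP.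
elim=> {v} [|v w _ hv _ hw|r v _ hv|r hr|r x hr mx|x b mx bG bH xbG xbF|f x fN fH xG nx xF fxG fxF].
- by rewrite /residue big1 => [|g _]; [apply: ideal0 | rewrite vE].
- by rewrite residueD; apply: idealD.
- by rewrite residueZ; apply: idealM.
- rewrite residueZ /residue big1 ?mulr0; first exact: ideal0.
  move=> g /andP[/and4P[gG _ _ _] _]; rewrite ffunE.
  by rewrite (negbTE (Gmin_neq0 gG)).
- by rewrite residueZ; apply/idealMr/JI.
- have mxb := moving_joinl mx bG bH xbG xbF.
  rewrite residueZ residueB !residue_basis mx mxb /=.
  have eE : lo (x `|` b) = lo x `|` b by apply: lo_joinr.
  have [bg|bg] := boolP (x `|` b <= g1).
    have xg : x <= g1 by apply: le_trans bg; apply: leUl.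
    rewrite xg /=; have [/'exists_andP[f [fN /andP[fH xbf]]]|nk'] := boolP (killed (x `|` b)).
      rewrite (killedP x f) //; first by rewrite subrr mulr0; apply: ideal0.
      by apply: le_trans xbf; rewrite eE leUl.
    have [/'exists_andP[f [fN /andP[fH xf]]]|nk] := boolP (killed x); last first.
      by rewrite subrr mulr0; apply: ideal0.
    rewrite subr0 mulr1; apply: (collapse f) => //.
    + rewrite inE -(_ : lo f = f); last exact/meet_idPl.
      rewrite lower_setP ?orbT //; rewrite (_ : lo f = f) ?Gmin_neq0 ?NG //.
      exact/meet_idPl.
    + exact: NG.
    + apply: contra nk' => bf; apply: (killedP _ f) => //.
      by rewrite eE leUx xf.
  rewrite /= sub0r; have [xg|xg] := boolP (x <= g1); last first.
    by rewrite oppr0 mulr0; apply: ideal0.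
  apply: idealMr; apply: (collapse (lo g1)) => //.
  - by rewrite setU11.
  - exact: leIr.
  - by rewrite leI2.
  - by apply: contra bg; rewrite lexI bH andbT leUx xg.
- have flo : lo (f `|` x) = f `|` lo x by apply: lo_join.
  have f0 := Gmin_neq0 (NG fN); have /andP[xT xH] := nx.
  have fx : f < f `|` x.
    rewrite lt_neqAle leUl andbT; apply: contra xH => /eqP ef.
    by apply: le_trans fH; rewrite ef leUr.
  have mfx : moving (f `|` x).
    by rewrite /moving fxG fxF joinC new_join ?NT // joinC (new_nonatom f0 fx).
  rewrite residueB residue_basis mfx /=.
  have [ax|ax] := boolP (is_atom x).
    rewrite basis_atom // (killedP _ f) //; last first.
      by move: ax; rewrite flo (new_atom nx) => /eqP ->; rewrite joinx0.
    rewrite andbF sub0r /residue big1 ?oppr0; first exact: ideal0.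
    by move=> g _; rewrite vE.
  have mx : moving x by rewrite /moving xG nx ax.
  rewrite residue_basis mx /=.
  have -> : (f `|` x <= g1) = (x <= g1).
    rewrite leUx; have [xg|_] := boolP (x <= g1); last by rewrite andbF.
    rewrite andbT; have [//|fg] := closed1 f fN fH.
    have /and4P[g1G _ _ _] := mg1; case/negP: fg; rewrite joinC.
    by apply: (Gmin_joinl g1G (NG fN) xG xg); rewrite joinC.
  have -> : killed (f `|` x) = killed x.
    apply/idP/idP => /'exists_andP[f' [fN' /andP[fH' le]]].
      by apply: (killedP _ f') => //; apply: le_trans le; rewrite flo leUr.
    have := Nnest fN fN'; rewrite /nested => /or3P[ff|ff|ff].
    - by apply: (killedP _ f') => //; rewrite flo leUx ff.
    - by apply: (killedP _ f) => //; rewrite flo leUx lexx (le_trans le).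
    - case/negP: ff; rewrite joinC; apply: (Gmin_joinl (NG fN') (NG fN) (moving_lo mx) le).
      by rewrite joinC -flo; apply: moving_lo.
  by rewrite subrr; apply: ideal0.
Qed.

Lemma lower_Gmin : {subset lower_set <= G}.
Proof.
move=> x; rewrite inE in_set1 => /andP[x0 /imsetP[f fN ex]].
case: (Gmin_meet_flag Lgeo Xflag k (NG fN)) => e0; first by rewrite ex.
by rewrite ex e0 eqxx in x0.
Qed.

Lemma lower_le f : f \in lower_set -> f <= X k.
Proof. by rewrite inE => /andP[_ /imsetP[g _ ->]]; apply: leIr. Qed.

Lemma lower_nested : nested_set lower_set.
Proof.
move=> x y; rewrite !inE => /andP[x0 /imsetP[f fN ex]] /andP[y0 /imsetP[g gN ey]].
by rewrite ex ey nested_lo -?ex -?ey ?NG ?Nnest.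
Qed.

Lemma lower_excluded f i : f \in N -> lo f != \bot -> e i <= X k ->
  excluded (lo f) i -> excluded f i.
Proof.
move=> fN f0 iH /and3P[if_ fiG /'exists_and3P[g [gG /eqP eg alt]]].
have fG := NG fN.
have efi t : f `|` (lo f `|` t) = f `|` t by rewrite joinA (join_idPl (leIl _ _)).
apply/and3P; split.
- by apply: contra if_ => le; rewrite lexI le.
- rewrite -efi; apply: (Gmin_join Lgeo) => //.
  by apply: contra f0; rewrite -!lex0; apply: le_trans; rewrite lexI leIl leUl.
- apply/'exists_and3P; exists g; split => //.
  by rewrite -(efi g) eg efi.
Qed.

Lemma normal_lower m : normal k.+1 N m ->
  (forall i, new (e i) -> m i = 0%N) -> normal k lower_set m.
Proof.
move=> [nv np] old; split=> // i mi; have [iT iN] := nv i mi.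
have iH : e i <= X k.
  by apply: contraNT mi => iH; rewrite old // /new iT.
split=> // f; rewrite inE => /andP[f0 /imsetP[g gN ef]].
rewrite in_set1 ef in f0 *; apply: contra (iN g gN); exact: lower_excluded.
Qed.

Hypothesis kM : (k < M)%N.

(** The new variables of a normal monomial are the surviving ones: a variable that
    is not below [F0], not closed under the old elements of [N], or killed would be
    excluded by an element of [N]; and a second new variable would form a bad
    pair. *)
Lemma normal_new m i : normal k.+1 N m -> new (e i) -> m i != 0%N ->
  [/\ moving (e i),
     forall f, f \in N -> f <= X k -> f <= e i \/ f `|` e i \notin G,
     ~~ killed (e i) &
     forall j, new (e j) -> (m - U_(i))%MM j = 0%N].
Proof.
move=> [nv np] ni mi; have [iT iN] := nv i mi.
have /andP[_ iH] := ni; have /andP[iG ai] := e_Gmin i.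
have iF : e i <= F0.
  apply/negPn/negP => iF; have [FN nF FG _ lG] := lo_joinF0 iG ni iF.
  have /andP[FT FH] := nF.
  case/negP: (iN _ FN); rewrite /excluded iF joinC (Gmin_joinnew iG FG ni nF) /=.
  have niF := new_join ni FT.
  have eK := new_split niF (leUr _ _) FH.
  apply/existsP; exists (lo (e i `|` F0)); rewrite lG eK eqxx /=.
  have [//|al] := boolP (is_atom _); have [j ej] := e_surj lG al.
  apply/existsP; exists j; rewrite ej eqxx; apply: (e_level (k := k)) => //.
  by rewrite ej leIr.
have closed1 f : f \in N -> f <= X k -> f <= e i \/ f `|` e i \notin G.
  move=> fN fH; have [fiG|] := boolP (f `|` e i \in G); last by right.
  left; apply: contraR (iN f fN) => fi; rewrite /excluded fiG /=.
  rewrite (contra (fun le => le_trans le fH) iH) /=.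
  have nfi : new (f `|` e i) by rewrite joinC new_join ?NT.
  have afi : ~~ is_atom (f `|` e i) by rewrite joinC (new_nonatom_join ni) ?NT.
  have [j ej] := e_surj fiG afi.
  apply/existsP; exists (f `|` e i); rewrite fiG joinA joinxx eqxx /=.
  apply/orP; right; apply/existsP; exists j; rewrite ej eqxx /=.
  apply: (e_anti (k := k) iH); rewrite ej; first by case/andP: nfi.
  by rewrite lt_neqAle leUr andbT; apply: contra fi => /eqP ->; apply: leUl.
split=> //.
- by rewrite /moving iG ni ai.
- apply/negP => /'exists_andP[f [fN /andP[fH lf]]].
  have loG := lo_Gmin iG ni ai.
  have [fi|] := closed1 f fN fH; last first.
    apply/negP/negPn/(Gmin_join Lgeo); [exact: NG | exact: iG |].
    by apply: contra (Gmin_neq0 loG); rewrite -!lex0; apply: le_trans; rewrite lexI lf leIl.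
  have ef : f = lo (e i) by apply/le_anti; rewrite lf lexI fi fH.
  have [a aa [aI aT aH]] := flag_atom_new Lgeo iT iH.
  case/negP: (iN f fN); rewrite /excluded (join_idPr fi) iG.
  rewrite (contra (fun le => le_trans le fH) iH) /=.
  apply/existsP; exists a; rewrite atom_Gmin // aa joinC ef /= andbT.
  by apply/eqP/(new_split ni aI aH).
- move=> j nj; apply/eqP; rewrite -leqn0 leqNgt; apply/negP => mj.
  have le_ijm : (U_(i) + U_(j) <= m)%MM.
    apply/mnm_lepP => t; rewrite mnmDE !mnm1E.
    move: mj; rewrite mnmBE mnm1E; have [<-|ne] := eqVneq i j => /=.
      by case: (eqVneq i t) => [<-|_] //=; rewrite subn_gt0.
    rewrite subn0; have [<-|] := eqVneq i t => /=; last by case: (eqVneq j t) => [<-|].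
    by move=> _; rewrite eq_sym (negbTE ne) addn0 lt0n.
  have /negP[] := np i j le_ijm.
  by apply/existsP; exists (Ordinal kM) => /=; rewrite ni nj.
Qed.

(** The condition that old variables form no bad pair with [e i] is exactly
    normality on the stratum of [lo (e i)]. *)
Lemma normal_quotient m i : normal k.+1 N m -> new (e i) -> m i != 0%N ->
  normal k (lo (e i) |: lower_set) (m - U_(i))%MM.
Proof.
move=> nm ni mi; have [mvi closed1 nk old] := normal_new nm ni mi.
have mle j : ((m - U_(i))%MM j <= m j)%N by rewrite mnmBE leq_subr.
have nm' : normal k.+1 N (m - U_(i))%MM.
  case: nm => nv np; split=> [j|j t] h1.
    by apply: nv; apply: contra h1; rewrite -!leqn0; apply: leq_trans.
  apply: np; apply/mnm_lepP => s; apply: leq_trans (mle s); exact/mnm_lepP.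
have [nv' np'] := normal_lower nm' old.
split=> // j mj; have [jH jN] := nv' j mj; split=> // f.
rewrite in_setU1 => /predU1P[ef|]; last exact: jN.
rewrite {f}ef.
have ij : i != j.
  by apply/negP => /eqP eij; move: ni; rewrite eij /new jH andbF.
have le_ijm : (U_(i) + U_(j) <= m)%MM.
  apply/mnm_lepP => t; rewrite mnmDE !mnm1E.
  move: mj; rewrite mnmBE mnm1E (negbTE ij) subn0.
  have [<-|] := eqVneq i t => /=; last by case: (eqVneq j t) => [<-|] //= _; rewrite lt0n.
  by move=> _; rewrite eq_sym (negbTE ij) addn0 lt0n.
case: nm => _ /(_ _ _ le_ijm)/existsPn/(_ (Ordinal kM)).
by rewrite ni jH /= negb_or => /andP[].
Qed.

Lemma vmulrz (v : V) (c : int) : (v *~ c)%R = vscale c%:~R%R v.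
Proof.
elim/int_rec: c => [|c IHc|c IHc].
- by rewrite mulr0z; apply/ffunP => y; rewrite !vE mulr0z mul0r.
- rewrite intS !mulrzDr mulr1z {}IHc.
  by apply/ffunP => y; rewrite !vE; ring.
- rewrite intS opprD !mulrzDr !mulrN1z {}IHc.
  by apply/ffunP => y; rewrite !vE; ring.
Qed.

Lemma scale_int (c : int) q : (c *: q = c%:~R * q :> R)%R.
Proof. by rewrite mulrzl -[c in LHS]intz scaler_int. Qed.

Lemma evalZ c q : eval (c *: q)%R = vscale c%:~R%R (eval q).
Proof. by rewrite -vmulrz scale_int mulrzl /eval raddfMz. Qed.

Definition fixed_mon (m : 'X_{1..n}) := [forall i, new (e i) ==> (m i == 0%N)].

Lemma fixed_monP (m : 'X_{1..n}) : reflect (forall i, new (e i) -> m i = 0%N) (fixed_mon m).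
Proof. by apply: (iffP 'forall_implyP) => h1 i ni; apply/eqP/h1. Qed.

Lemma eval_fixed (m : 'X_{1..n}) q : (forall i, m i != 0%N -> e i <= X k) ->
  U (eval ('X_[m] * q) - vscale 'X_[m] (eval q))%R.
Proof.
move=> mH; rewrite mpolyXE_id.
pose P (r : R) := forall q, U (eval (r * q) - vscale r (eval q))%R.
suff: P (\prod_(i < n) 'X_i ^+ m i)%R by apply.
have P1 : P 1%R.
  move=> r; apply: vanish_eq Vanish0 _; rewrite mul1r.
  by apply/ffunP => y; rewrite !vE; ring.
have PM r s : P r -> P s -> P (r * s)%R.
  move=> Pr Ps q'; rewrite -mulrA.
  apply: vanish_eq (VanishD (Pr (s * q')%R) (VanishZ r (Ps q'))) _.
  by apply/ffunP => y; rewrite !vE; ring.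
elim/big_ind: _ => // i _; have [->|mi] := eqVneq (m i) 0%N; first by rewrite expr0.
have Pi : P 'X_i.
  by move=> r; have := eval_mulX i r; rewrite act_fixed ?mH // hvar_e.
by elim: (m i) => [|s IHs]; rewrite ?expr0 // exprS; apply: PM.
Qed.

(** The value of a normal monomial in the model; for such a monomial the sum has at
    most one term. *)
Definition linear_form (m : 'X_{1..n}) : V :=
  if fixed_mon m then vscale 'X_[m] basis0
  else (\sum_(i | new (e i) && (m i != 0%N)) vscale 'X_[m - U_(i)] (E (e i)))%R.

Lemma eval_normal m : normal k.+1 N m -> U (eval 'X_[m] - linear_form m)%R.
Proof.
move=> nm; rewrite /linear_form; case: ifP => [/fixed_monP fm|/negbT].
  rewrite -[X in eval X]mulr1; have := eval_fixed (m := m) 1%R.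
  rewrite [eval 1](_ : _ = basis0); last exact: poly_act1.
  apply=> i mi; have [iT _] := nm.1 i mi.
  by apply: contraNT mi => iH; rewrite fm // /new iT.
rewrite negb_forall => /existsP[i]; rewrite negb_imply => /andP[ni mi].
have [mvi _ _ old] := normal_new nm ni mi.
have em : m = (m - U_(i) + U_(i))%MM.
  rewrite submK //; apply/mnm_lepP => j; rewrite mnm1E.
  by case: (eqVneq i j) => [<-|]; rewrite ?lt0n.
rewrite (big_pred1 i) => [|j]; last first.
  rewrite /=; apply/andP/eqP => [[nj mj]|->//].
  apply/eqP/negPn/negP => ji; have := old j nj.
  by rewrite mnmBE mnm1E eq_sym (negbTE ji) subn0 => e0; rewrite e0 in mj.
rewrite {1}em mpolyXD; have h1 := eval_fixed (m := (m - U_(i))%MM) 'X_i.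
have h2 := eval_hvar1 (e i); rewrite hvar_e in h2.
have /and4P[iG ni' _ iF] := mvi; rewrite act_basis0 // in h2.
have uf : U (eval ('X_[m - U_(i)] * 'X_i) - vscale 'X_[m - U_(i)] (eval 'X_i))%R.
  apply: h1 => j mj; have mj' : m j != 0%N.
    by apply: contra mj; rewrite mnmBE => /eqP ->; rewrite sub0n.
  have [jT _] := nm.1 j mj'; apply: contraNT mj => jH.
  by rewrite old // /new jT.
apply: vanish_eq (VanishD uf (VanishZ 'X_[m - U_(i)] h2)) _.
by apply/ffunP => y; rewrite !vE; ring.
Qed.

Lemma mcoeff_sum_mon (s : seq 'X_{1..n}) (P : pred 'X_{1..n})
    (f : 'X_{1..n} -> 'X_{1..n}) (c : 'X_{1..n} -> int) m :
    uniq s -> m \in s -> P m ->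
    {in [pred t | t \in s & P t] &, injective f} ->
  ((\sum_(t <- s | P t) c t *: 'X_[f t])@_(f m) = c m :> int)%R.
Proof.
move=> us ms Pm inj; rewrite raddf_sum -big_filter /=.
rewrite (bigD1_seq m) ?mem_filter ?filter_uniq ?Pm //= mcoeffZ mcoeffX eqxx mulr1.
rewrite big1_seq ?addr0 //= => t; rewrite mem_filter => /and3P[tm Pt ts].
rewrite mcoeffZ mcoeffX (inj_in_eq inj) ?inE ?ts ?ms //.
by rewrite (negbTE tm) mulr0.
Qed.

Hypothesis IHk : forall N', {subset N' <= G} -> (forall f, f \in N' -> f <= X k) ->
  nested_set N' -> forall q, {in msupp q, forall m, normal k N' m} ->
  stratum_ideal k N' q -> q = 0%R.

(** Let [q] be a combination of normal monomials in the ideal.  The coefficient of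
    the unit vector shows that the part of [q] without new variables is zero.  For a
    new variable, the residue at the corresponding element involves the smaller new
    elements as well; by induction on the rank these do not occur, so that the
    quotient by the variable lies in the ideal of a stratum one level below. *)
Lemma independence_step q : {in msupp q, forall m, normal k.+1 N m} ->
  stratum_ideal k.+1 N q -> q = 0%R.
Proof.
move=> nq /eval_stratum_ideal uq.
pose w := (\sum_(m <- msupp q) vscale (q@_m)%:~R (linear_form m))%R.
have uw : U w.
  have : U (eval q - w)%R.
    have evalD r s : eval (r + s)%R = (eval r + eval s)%R by apply: poly_actD.
    rewrite [X in eval X]mpolyE (big_morph eval evalD (poly_act0 _ _)) /w -sumrB big_seq.
    apply: vanish_sum => m mq; rewrite evalZ.
    apply: vanish_eq (VanishZ (q@_m)%:~R (eval_normal (nq m mq))) _.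
    by apply/ffunP => y; rewrite !vE; ring.
  move=> /(vanishB uq) u; apply: vanish_eq u _.
  by apply/ffunP => y; rewrite !vE; ring.
have supp_sum (P : pred 'X_{1..n}) f t :
    t \in msupp (\sum_(m <- msupp q | P m) q@_m *: 'X_[f m] : R)%R ->
    exists m, [/\ m \in msupp q, P m & t = f m].
  move/msupp_sum_le/flattenP => [s /mapP[m]]; rewrite mem_filter => /andP[Pm mq] ->.
  by move/msuppZ_le; rewrite msuppX inE => /eqP ->; exists m.
have old0 m : m \in msupp q -> fixed_mon m -> (q@_m = 0)%R.
  move=> mq fm; pose q0 := (\sum_(m <- msupp q | fixed_mon m) q@_m *: 'X_[m] : R)%R.
  have q00 : q0 = 0%R.
    apply: (IHk lower_Gmin lower_le lower_nested).
      move=> t /(supp_sum _ id)[m' [mq' fm' ->]]; apply: normal_lower; first exact: nq.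
      exact/fixed_monP.
    apply: ideal_eq (vanish_basis0 uw) _.
    rewrite /w vsum_E /q0 big_mkcond; apply: eq_bigr => t _.
    rewrite vE /linear_form; case: ifP => ft.
      by rewrite vE ffunE eqxx mulr1 -scale_int.
    rewrite vsum_E big1 ?mulr0 // => i _; rewrite vE ffunE.
    rewrite [X in X && _](_ : _ = false) ?mulr0 //.
    by apply/negbTE; rewrite eq_sym Gmin_neq0 //; case/andP: (e_Gmin i).
  have := mcoeff_sum_mon (fun m => q@_m)%R (msupp_uniq q) mq fm (f := id).
  by rewrite -/q0 q00 mcoeff0 => <- // ? ?.
have new0 i : new (e i) -> forall m, m \in msupp q -> m i = 0%N.
  have [r] := ubnP (rank (e i)); elim: r i => // r IHr i ri ni m mq.
  apply/eqP; apply: contraT => mi.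
  have [mvi closed1 nk _] := normal_new (nq m mq) ni mi.
  pose qi := (\sum_(m <- msupp q | m i != 0%N) q@_m *: 'X_[m - U_(i)] : R)%R.
  have nested_i f : f \in N -> nested (e i) f.
    move=> fN; have [fH|fH] := boolP (f <= X k).
      by case: (closed1 f fN fH) => [le|]; rewrite /nested ?le ?orbT // joinC => ->; rewrite !orbT.
    by rewrite /nested (le_trans _ (F0le fN fH)) //; case/and4P: mvi.
  have lG := moving_lo mvi.
  have qi0 : qi = 0%R.
    apply: (IHk (N' := lo (e i) |: lower_set)).
    - by move=> f /setU1P[->//|]; apply: lower_Gmin.
    - by move=> f /setU1P[->|]; [apply: leIr | apply: lower_le].
    - have nestedP f : f \in lower_set -> nested (lo (e i)) f.
        rewrite inE => /andP[f0 /imsetP[g gN eg]]; rewrite in_set1 in f0.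
        have /andP[iG _] := e_Gmin i.
        by rewrite eg; apply: (nested_lo iG (NG gN) (Gmin_neq0 lG) _ (nested_i _ gN)); rewrite -eg.
      have nestedC x y : nested x y -> nested y x.
        by rewrite /nested joinC orbCA.
      move=> f g /setU1P[->|fN] /setU1P[->|gN].
      + by rewrite /nested lexx.
      + exact: nestedP.
      + by apply/nestedC/nestedP.
      + exact: lower_nested.
    - move=> t /(supp_sum _ (fun m => (m - U_(i))%MM))[m' [mq' mi' ->]].
      by apply: normal_quotient => //; apply: nq.
    apply: ideal_eq (vanish_residue mvi closed1 uw) _.
    rewrite /w -/(residue _ _) (big_morph (residue (e i)) (residueD _) (_ : _ = 0)%R); last first.
      by rewrite /residue big1 // => g _; rewrite vE.
    rewrite /qi big_mkcond; apply: eq_big_seq => t tq.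
    rewrite residueZ /linear_form; have [/fixed_monP ft|_] := boolP (fixed_mon t).
      rewrite (ft i ni) eqxx /= residueZ /residue big1 ?mulr0 // => g /andP[/and4P[gG _ _ _] _].
      by rewrite ffunE (negbTE (Gmin_neq0 gG)).
    rewrite (big_morph (residue (e i)) (residueD _) (_ : _ = 0)%R); last first.
      by rewrite /residue big1 // => g _; rewrite vE.
    have only_i j : new (e j) && (t j != 0%N) -> j != i ->
        residue (e i) (vscale 'X_[t - U_(j)] (E (e j))) = 0%R.
      move=> /andP[nj tj] ji; rewrite residueZ residue_basis.
      case le: (e j <= e i)%O; last by rewrite andbF mulr0.
      have rk : (rank (e j) < rank (e i))%N.
        by apply: rank_lt; rewrite lt_neqAle le andbT (inj_eq e_inj).
      case/negP: tj; apply/eqP.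
      exact: (IHr j (leq_trans rk (ltnSE ri)) nj t tq).
    have [ti|ti] := eqVneq (t i) 0%N.
      rewrite big1 ?mulr0 // => j hj; apply: only_i => //.
      by apply: contraTneq hj => ->; rewrite ti andbF.
    rewrite (bigD1 i) ?ni ?ti //= big1 ?addr0; last by move=> j /andP[hj ji]; apply: only_i.
    by rewrite residueZ residue_basis mvi nk lexx mulr1 scale_int.
  have subI : {in [pred t : 'X_{1..n} | t \in msupp q & t i != 0%N] &, injective (fun t => (t - U_(i))%MM)}.
    move=> s t; rewrite !inE => /andP[_ si] /andP[_ ti] est.
    have le1 (u : 'X_{1..n}) : u i != 0%N -> (U_(i) <= u)%MM.
      move=> ui; apply/mnm_lepP => j; rewrite mnm1E.
      by case: (eqVneq i j) => [<-|]; rewrite ?lt0n.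
    by rewrite -(submK (le1 _ si)) -(submK (le1 _ ti)) est.
  have := mcoeff_sum_mon (fun m => q@_m)%R (msupp_uniq q) mq mi subI.
  by rewrite -/qi qi0 mcoeff0 => e0; rewrite mcoeff_msupp -e0 eqxx in mq.
apply/eqP; rewrite -msupp_eq0; case es: (msupp q) => [//|m s].
have mq : m \in msupp q by rewrite es inE eqxx.
have fm : fixed_mon m by apply/fixed_monP => i ni; apply: new0.
by have := old0 m mq fm; move: mq; rewrite mcoeff_msupp => /eqP.
Qed.

End Fibre.

(** Induction along the flag.  Two new elements of [N] have an irreducible join, so
    that nestedness makes them comparable: the new elements of [N] form a chain, and
    [F0] is its least element. *)
Theorem normal_independent k N : (k <= M)%N -> {subset N <= G} ->
    (forall f, f \in N -> f <= X k) -> nested_set N ->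
  forall q, {in msupp q, forall m, normal k N m} -> stratum_ideal k N q -> q = 0%R.
Proof.
elim: k N => [|k IHk] N kM NG NT Nnest q nq.
  elim=> {nq} [//|p rel|p r _ -> _ ->|p r _ ->]; last 2 first.
  - by rewrite addr0.
  - by rewrite mulr0.
  have X0 x : x <= X 0 -> x \in G -> False.
    by rewrite flag_bot // lex0 => /eqP ->; apply/negP/bot_notin_Gmin.
  case: rel => [a b _ _ cG c0|f a _ aG a0 _ _].
    by case: (X0 _ c0).
  by case: (X0 _ a0).
have [F0 [F0T F0le F0in]] : exists F0, [/\ F0 <= X k.+1,
    forall f, f \in N -> ~~ (f <= X k) -> F0 <= f
    & forall x, new k x -> ~~ (x <= F0) -> F0 \in N /\ new k F0].
  pose P f := (f \in N) && ~~ (f <= X k).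
  have [/existsP[f Pf]|/existsPn none] := boolP [exists f, P f]; last first.
    exists (X k.+1); split=> // [f fN fH|x /andP[xT _]]; last by rewrite xT.
    by have := none f; rewrite /P fN fH.
  have [F0 /andP[FN FH] Fmin] := arg_minnP (fun f => rank f) Pf.
  exists F0; split=> [|f' fN' fH'|x _ _]; first exact: NT.
    have := Nnest _ _ FN fN'; rewrite /nested => /or3P[//|le|/negP[]].
      have := Fmin f'; rewrite /P fN' fH' => /(_ isT) /= r.
      by rewrite (rank_le_eq le r).
    by apply: (Gmin_joinnew (k := k)); rewrite ?NG // /new NT.
  by rewrite /new FN NT.
apply: (independence_step NG NT Nnest F0T F0le F0in kM) nq.
by move=> N' *; apply: (IHk N') => //; apply: ltnW.
Qed.

(** * Quadratic relations with prescribed leading monomials *)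

Definition small_quadric i j (r : R) := r \is 2.-homog /\
  {in msupp r, forall m, (m < (U_(i) + U_(j))%MM)%O}.

Lemma small_quadricB i j r s : small_quadric i j r -> small_quadric i j s ->
  small_quadric i j (r - s)%R.
Proof.
move=> [hr lr] [hs ls]; split; first by rewrite rpredB.
by move=> m /msuppB_le; rewrite mem_cat => /orP[/lr|/ls].
Qed.

Lemma small_quadricD i j r s : small_quadric i j r -> small_quadric i j s ->
  small_quadric i j (r + s)%R.
Proof.
move=> [hr lr] [hs ls]; split; first by rewrite rpredD.
by move=> m /msuppD_le; rewrite mem_cat => /orP[/lr|/ls].
Qed.

Lemma hvarP x : h x = 0%R \/ exists2 a, e a = x & h x = 'X_a.
Proof.
have [/existsP[a /eqP ea]|/existsPn none] := boolP [exists a, e a == x].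
  by right; exists a => //; rewrite -ea hvar_e.
by left; apply: hvar_notin.
Qed.

Lemma small_quadric_hh i j x y :
  (forall a b : 'I_n, e a = x -> e b = y -> ((U_(a) + U_(b))%MM < (U_(i) + U_(j))%MM)%O) ->
  small_quadric i j (h x * h y)%R.
Proof.
have s0 : small_quadric i j 0%R.
  by split; [apply: rpred0 | move=> m; rewrite msupp0].
case: (hvarP x) => [->|[a ea ->]] hab; first by rewrite mul0r.
case: (hvarP y) => [->|[b eb ->]]; first by rewrite mulr0.
rewrite -mpolyXD; split; first by rewrite dhomogX /= mdegD !mdeg1.
by move=> m; rewrite msuppX inE => /eqP ->; apply: hab.
Qed.

Lemma ltm1 (a b : 'I_n) : (b < a)%N -> (U_(a)%MM < U_(b)%MM)%O.
Proof.
move=> ba; apply/ltmcP; first by rewrite !mdeg1.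
exists b => [j jb|]; rewrite !mnm1E.
  have /negbTE -> : a != j by rewrite -val_eqE /= neq_ltn (ltn_trans jb ba) orbT.
  by have /negbTE -> : b != j by rewrite -val_eqE /= neq_ltn jb orbT.
by rewrite eqxx; have /negbTE -> : a != b by rewrite -val_eqE /= neq_ltn ba orbT.
Qed.

Local Notation I := (stratum_ideal M set0).
Hypothesis XM : X M = \top.

Let joinI a b : a \in G -> b \in G -> a `|` b \in G ->
  I ((h (a `|` b) - h a) * (h (a `|` b) - h b))%R.
Proof. by move=> *; apply/ideal_incl/StratumJoin => //; rewrite XM lex1. Qed.

(** With [l] the old part of the join [c] and [a] a new atom below [c], the
    relations of [(e i, e j)], [(l, e i)], [(l, e j)] and [(l, a)] combine to the
    product formula, because [h a = 0]. *)
Lemma bad_pair_new k i j : new k (e i) -> new k (e j) ->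
  exists2 r, small_quadric i j r & I ('X_i * 'X_j - r)%R.
Proof.
move=> ni nj; have /andP[iT iH] := ni; have /andP[jT jH] := nj.
have /andP[iG ai] := e_Gmin i; have /andP[jG aj] := e_Gmin j.
set c := e i `|` e j; set l := c `&` X k.
have cG : c \in G := Gmin_joinnew iG jG ni nj.
have nc : new k c by apply: new_join.
have ac : ~~ is_atom c by apply: (new_nonatom_join ni).
have lG : l \in G by apply: lo_Gmin.
have lc t : t <= c -> ~~ (t <= X k) -> l `|` t = c.
  by move=> tc tH; rewrite joinC; apply: new_split.
have /andP[cT cH] := nc; have [a aa [ac' aT aH]] := flag_atom_new Lgeo cT cH.
have rel t : t \in G -> t <= c -> ~~ (t <= X k) -> I ((h c - h l) * (h c - h t))%R.
  by move=> tG tc tH; rewrite -(lc t tc tH); apply: joinI; rewrite ?lc.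
have lH s : e s = l -> e s <= X k by move=> ->; apply: leIr.
have hi u : e u = c -> (U_(u)%MM <= U_(i)%MM)%O.
  move=> eu; have [->//|ui] := eqVneq u i.
  apply/ltW/ltm1/(e_anti (k := k)); rewrite ?eu //.
  rewrite lt_neqAle leUl andbT; apply: contra ui => /eqP e1.
  by apply/eqP/e_inj; rewrite eu -e1.
exists (h l * h (e i) + h l * h (e j) - h l * h c)%R.
  apply: small_quadricB; first apply: small_quadricD; apply: small_quadric_hh.
  - move=> s t es /e_inj ->; rewrite addmC; apply: lemc_lt_add => //.
    exact/ltm1/(e_level (k := k))/jH/lH.
  - move=> s t es /e_inj ->; rewrite ltmc_add2l.
    exact/ltm1/(e_level (k := k))/iH/lH.
  - move=> s t es et; rewrite addmC; apply: lemc_lt_add; first exact: hi.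
    exact/ltm1/(e_level (k := k))/jH/lH.
have := idealB (idealB (joinI iG jG cG) (rel _ iG (leUl _ _) iH)) (rel _ jG (leUr _ _) jH).
move=> r1; have := idealD r1 (rel a (atom_Gmin aa) ac' aH).
rewrite (hvar_atom aa) !hvar_e => r2; apply: ideal_eq r2 _.
by rewrite -/c; ring.
Qed.

(** If [g] witnesses that [e j] is excluded, then [e i `|` g = e i `|` e j = c] and the
    difference of the join relations of [(e i, e j)] and [(e i, g)] is
    [(h c - h (e i)) * (h g - h (e j))]. *)
Lemma bad_pair_old k i j : new k (e i) -> e j <= X k -> excluded (e i `&` X k) j ->
  exists2 r, small_quadric i j r & I ('X_i * 'X_j - r)%R.
Proof.
move=> ni jH /and3P[jl fG /'exists_and3P[g [gG /eqP eg alt]]].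
have /andP[iT iH] := ni; have /andP[iG ai] := e_Gmin i; have /andP[jG _] := e_Gmin j.
have lG := lo_Gmin iG ni ai; set l := e i `&` X k in lG jl fG eg.
have li : l <= e i by apply: leIl.
have eit t : e i `|` (l `|` t) = e i `|` t by rewrite joinA (join_idPl li).
set c := e i `|` e j; have ecg : e i `|` g = c by rewrite -eit eg eit.
have cG : c \in G.
  rewrite /c -eit; apply: (Gmin_join Lgeo) => //.
  apply: contra (Gmin_neq0 lG); rewrite -!lex0; apply: le_trans.
  by rewrite lexI li leUl.
have r1 := joinI iG jG cG.
have r2 : I ((h c - h (e i)) * (h c - h g))%R by rewrite -ecg; apply: joinI; rewrite ?ecg.
have ci u : e u = c -> (U_(u)%MM < U_(i)%MM)%O.
  move=> eu; apply/ltm1/(e_anti (k := k)) => //.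
    by rewrite eu leUx iT (le_trans jH) ?flag_le.
  rewrite eu lt_neqAle leUl andbT; apply: contra jl => /eqP e1.
  by rewrite lexI jH andbT e1 leUr.
have gj u : e u = g -> (U_(u)%MM < U_(j)%MM)%O.
  move=> eu; apply: ltm1; case/orP: alt => [ag|/existsP[t /andP[/eqP et jt]]].
    by have /andP[_ /negP[]] := e_Gmin u; rewrite eu.
  by have -> : u = t by apply: e_inj; rewrite eu et.
exists (h (e i) * h g + h c * h (e j) - h c * h g)%R.
  apply: small_quadricB; first apply: small_quadricD; apply: small_quadric_hh.
  - by move=> s t /e_inj -> /gj; rewrite ltmc_add2r.
  - by move=> s t /ci + /e_inj ->; rewrite ltmc_add2l.
  - by move=> s t /ci su /gj tu; apply: ltm_add.
rewrite !hvar_e in r1 r2 *; apply: ideal_eq (idealB r1 r2) _.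
by ring.
Qed.

Lemma bad_pair_quadric i j : bad_pair i j ->
  exists2 r, small_quadric i j r & I ('X_i * 'X_j - r)%R.
Proof.
case/existsP=> k /andP[ni /orP[nj|/andP[jH ex]]].
  exact: bad_pair_new ni nj.
exact: bad_pair_old ni jH ex.
Qed.

Lemma no_bad_pair_independent q :
    {in msupp q, forall m i j, (U_(i) + U_(j) <= m)%MM -> ~~ bad_pair i j} ->
  I q -> q = 0%R.
Proof.
move=> nq; apply: (normal_independent (leqnn M)).
- by move=> f; rewrite inE.
- by move=> f; rewrite inE.
- by move=> f g; rewrite inE.
- move=> m mq; split; last exact: nq.
  by move=> i _; rewrite XM lex1; split=> // f; rewrite inE.
Qed.

End Strata.

(** * Leading monomials from independence *)

Section QuadraticReduction.
Local Open Scope ring_scope.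
Variables (n : nat) (I : {mpoly int[n]} -> Prop) (bad : rel 'I_n).
Hypotheses (I0 : I 0) (ID : forall p q, I p -> I q -> I (p + q))
  (IM : forall a p, I p -> I (a * p)).
Hypothesis quad : forall i j, bad i j -> exists2 r : {mpoly int[n]},
  {in msupp r, forall m, (m < (U_(i) + U_(j))%MM)%O} & I ('X_i * 'X_j - r).
Implicit Types (p q r : {mpoly int[n]}) (m t : 'X_{1..n}).

Definition bad_free m := forall i j, (U_(i) + U_(j) <= m)%MM -> ~~ bad i j.

Lemma bad_freePn m : ~ bad_free m ->
  exists i j, bad i j /\ (U_(i) + U_(j) <= m)%MM.
Proof.
move=> h; apply: contra_notP h => h i j le; apply/negP => b.
by apply: h; exists i, j.
Qed.

(** Existence of a normal form whose monomials satisfy [B]; taking [B] to be an upper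
    bound keeps track of leading monomials. *)
Definition reduces (B : 'X_{1..n} -> Prop) p := exists q,
  [/\ {in msupp q, forall t, bad_free t}, {in msupp q, forall t, B t} & I (p - q)].

Lemma reduces_sum B p : {in msupp p, forall m, reduces B 'X_[m]} -> reduces B p.
Proof.
move=> h; rewrite [p]mpolyE big_seq; elim/big_ind: _ => [|p1 p2 [q1 [b1 B1 i1]] [q2 [b2 B2 i2]]|m mp].
- by exists 0; split=> [m|m|]; rewrite ?msupp0 // subrr.
- exists (q1 + q2); split=> [m /msuppD_le|m /msuppD_le|].
  + by rewrite mem_cat => /orP[/b1|/b2].
  + by rewrite mem_cat => /orP[/B1|/B2].
  + by rewrite opprD addrACA; apply: ID.
have [q [bq Bq iq]] := h m mp; exists (p@_m *: q); split=> [t /msuppZ_le /bq//|t /msuppZ_le /Bq//|].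
by rewrite -scalerBr -mul_mpolyC; apply: IM.
Qed.

Lemma reduces_mon m : reduces (fun t => (t <= m)%O) 'X_[m].
Proof.
elim/(well_founded_ind (@ltom_wf n)): m => m IHm.
have [nf|/bad_freePn[i [j [b le]]]] := pselect (bad_free m).
  by exists 'X_[m]; split=> [t|t|]; rewrite ?msuppX ?inE ?subrr // => /eqP ->.
have [r rlt rI] := quad b; pose m' := (m - (U_(i) + U_(j)))%MM.
have em : m = (m' + (U_(i) + U_(j)))%MM by rewrite submK.
have [q [bq Bq iq]] : reduces (fun t => (t < m)%O) ('X_[m'] * r).
  apply: reduces_sum => t /msuppM_le/allpairsP[[t1 t2] /=].
  rewrite msuppX inE => -[/eqP -> /rlt t2lt ->].
  have lt : ((m' + t2)%MM < m)%O by rewrite em ltmc_add2r.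
  have [q [bq Bq iq]] := IHm _ lt; exists q; split=> // s /Bq sle.
  exact: le_lt_trans sle lt.
exists q; split=> // [t /Bq/ltW//|].
have := ID (IM 'X_[m'] rI) iq; rewrite mulrBr addrA subrK.
by rewrite -!mpolyXD -em.
Qed.

Hypothesis indep : forall q, {in msupp q, forall m, bad_free m} -> I q -> q = 0.

(** If the leading monomial of [p] had no bad pair, replacing the other monomials by
    their normal forms would give a nonzero combination of monomials without bad
    pairs in the ideal. *)
Lemma lead_bad p : I p -> p != 0 ->
  exists i j, bad i j /\ (U_(i) + U_(j) <= mlead p)%MM.
Proof.
move=> pI p0; apply: bad_freePn => nf.
set m := mlead p; pose p' := p - p@_m *: 'X_[m].
have p'lt t : t \in msupp p' -> (t < m)%O.
  move=> tp'; have : t \in msupp p.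
    move: tp'; rewrite !mcoeff_msupp mcoeffB mcoeffZ mcoeffX.
    have [<-|ne] := eqVneq m t; last by rewrite mulr0 subr0.
    by rewrite mulr1 subrr eqxx.
  move/msupp_le_mlead; rewrite le_eqVlt => /predU1P[tm|//].
  move: tp'; rewrite mcoeff_msupp mcoeffB mcoeffZ mcoeffX tm eqxx mulr1.
  by rewrite subrr eqxx.
have [q [bq Bq iq]] : reduces (fun t => (t < m)%O) p'.
  apply: reduces_sum => t /p'lt lt; have [q [bq Bq iq]] := reduces_mon t.
  by exists q; split=> // s /Bq sle; apply: le_lt_trans sle lt.
have e0 : p@_m *: 'X_[m] + q = 0.
  apply: indep => [t /msuppD_le|].
    rewrite mem_cat => /orP[/msuppZ_le|/bq//].
    by rewrite msuppX inE => /eqP ->.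
  have := ID pI (IM (-1) iq); rewrite mulN1r /p'.
  by congr I; move: (_ *: _) => u; ring.
have := congr1 (mcoeff m) e0; rewrite mcoeffD mcoeffZ mcoeffX eqxx mulr1 mcoeff0.
rewrite [q@_m]memN_msupp_eq0 ?addr0; last by apply/negP => /Bq; rewrite ltxx.
by apply/eqP; rewrite -mcoeff_msupp mlead_supp.
Qed.

End QuadraticReduction.

(** * Linear resolutions from quadratic leading monomials *)

Lemma ltn_digit n a b x y : (x < n)%N -> (y < n)%N ->
  (a * n + x < b * n + y)%N = (a < b)%N || (a == b) && (x < y)%N.
Proof.
move=> xn yn; case: (ltngtP a b) => [ab|ba|->] /=; last by rewrite ltn_add2l.
  have h : (a.+1 * n <= b * n)%N by rewrite leq_mul2r ab orbT.
  apply: leq_trans (leq_addr _ _); apply: leq_trans h.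
  by rewrite mulSn addnC ltn_add2r.
have h : (b.+1 * n <= a * n)%N by rewrite leq_mul2r ba orbT.
apply/negbTE; rewrite -leqNgt; apply: leq_trans (leq_addr _ _); apply: leq_trans h.
by rewrite mulSn addnC leq_add2r ltnW.
Qed.

Section LinearResolution.
Local Open Scope ring_scope.
Variables (n : nat) (I : {mpoly int[n]} -> Prop) (bad : rel 'I_n).
Hypotheses (I0 : I 0) (ID : forall p q, I p -> I q -> I (p + q))
  (IM : forall a p, I p -> I (a * p)).
Hypothesis quad : forall i j, bad i j -> exists r : {mpoly int[n]},
  [/\ r \is 2.-homog, {in msupp r, forall m, (m < (U_(i) + U_(j))%MM)%O}
    & I ('X_i * 'X_j - r)].
Hypothesis lead : forall p, I p -> p != 0 ->
  exists i j, bad i j /\ (U_(i) + U_(j) <= mlead p)%MM.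
Local Notation R := {mpoly int[n]}.
Implicit Types (p q : R) (m t : 'X_{1..n}).

(** Terms of a free module are compared by the monomial obtained after giving the
    basis vector [k] the monomial weight [t k], ties being broken by [tau k]; this
    is the order that makes Schreyer's syzygies have known leading terms. *)
Definition key := ('X_{1..n} * nat)%type.
Implicit Types K : key.

Definition key_lt K1 K2 :=
  (K1.1 < K2.1)%O || (K1.1 == K2.1) && (K1.2 < K2.2)%N.

Lemma key_ind (P : key -> Prop) :
  (forall K, (forall K', key_lt K' K -> P K') -> P K) -> forall K, P K.
Proof.
move=> h [m s]; elim/(well_founded_ind (@ltom_wf n)): m s => m IHm s.
elim/ltn_ind: s => s IHs; apply: h => -[m' s']; rewrite /key_lt /= => /orP[/IHm//|].
by move=> /andP[/eqP -> /IHs].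
Qed.

Lemma key_trans : transitive key_lt.
Proof.
move=> [m2 s2] [m1 s1] [m3 s3]; rewrite /key_lt /=.
move=> /orP[l12|/andP[/eqP -> s12]] /orP[l23|/andP[/eqP <- s23]].
- by rewrite (lt_trans l12 l23).
- by rewrite l12.
- by rewrite l23.
- by rewrite eqxx (ltn_trans s12 s23) orbT.
Qed.

Lemma key_irr K : ~~ key_lt K K.
Proof. by rewrite /key_lt ltxx ltnn andbF. Qed.

Lemma key_total K1 K2 : K1 != K2 -> key_lt K1 K2 || key_lt K2 K1.
Proof.
case: K1 K2 => [m1 s1] [m2 s2]; rewrite /key_lt /= xpair_eqE.
by case: ltgtP => //= _; case: ltngtP.
Qed.

Lemma key_le_trans K1 K2 K3 : K1 = K2 \/ key_lt K1 K2 -> key_lt K2 K3 -> key_lt K1 K3.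
Proof. by case=> [->//|]; apply: key_trans. Qed.

Section Module.
Variable r : nat.
Variables (t : 'I_r -> 'X_{1..n}) (tau : 'I_r -> nat).
Implicit Types (v : 'rV[R]_r) (k : 'I_r).

Definition tkey k m : key := ((m + t k)%MM, tau k).

Definition leading v k m := (v 0 k)@_m != 0 /\
  forall k' m', (v 0 k')@_m' != 0 -> (k', m') = (k, m) \/ key_lt (tkey k' m') (tkey k m).

Definition below v K := forall k m, (v 0 k)@_m != 0 -> key_lt (tkey k m) K.

Hypothesis tau_inj : injective tau.

Lemma tkey_inj k m k' m' : tkey k m = tkey k' m' -> (k, m) = (k', m').
Proof.
move=> ekey; have /tau_inj ek := congr1 snd ekey; subst k'.
by have /eqP := congr1 fst ekey; rewrite /= eqm_add2r => /eqP ->.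
Qed.

Lemma leading_exists v : v != 0 -> exists k m, leading v k m.
Proof.
move=> v0; pose s := [seq (k, m) | k <- enum 'I_r, m <- msupp (v 0 k)].
have sP k m : ((k, m) \in s) = ((v 0 k)@_m != 0).
  rewrite -mcoeff_msupp; apply/allpairsPdep/idP => [[k' [m' [_ h [-> ->]]]]//|h].
  by exists k, m; rewrite mem_enum.
have sne : s != [::].
  apply: contra v0 => /eqP s0; apply/eqP/rowP => k; rewrite mxE.
  apply/mpolyP => m; rewrite mcoeff0; apply/eqP.
  by have := sP k m; rewrite s0 in_nil => /esym/negbFE.
have [x xs xmax] : exists2 x, x \in s &
    forall y, y \in s -> y = x \/ key_lt (tkey y.1 y.2) (tkey x.1 x.2).
  elim: s {sP} sne => //= x s IHs _; have [->|/IHs[y ys ymax]] := eqVneq s [::].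
    by exists x; rewrite ?mem_head // => y; rewrite inE => /eqP ->; left.
  have [exy|nxy] := eqVneq (tkey x.1 x.2) (tkey y.1 y.2).
    exists y; first by rewrite inE ys orbT.
    move=> z; rewrite inE => /predU1P[->|]; last exact: ymax.
    by left; have := tkey_inj exy; rewrite -!surjective_pairing.
  have /orP[xy|yx] := key_total nxy.
    exists y; first by rewrite inE ys orbT.
    by move=> z; rewrite inE => /predU1P[->|/ymax//]; right.
  exists x; first by rewrite mem_head.
  move=> z; rewrite inE => /predU1P[->|/ymax zy]; first by left.
  by right; apply: key_le_trans yx; case: zy => [->|]; [left|right].
case: x xs xmax => k m /=; rewrite sP => km xmax; exists k, m; split=> // k' m' km'.
by apply: xmax; rewrite sP.
Qed.

End Module.

(** The submodules [N] of relations that admit linear generators [f_(k, i)], with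
    leading term [x_i e_k], for [i] in [V k].  The leading terms of [N] are
    generated by these and by the bad pairs, as [N] contains the multiples of the
    basis vectors by the ideal. *)
Record linear_class r (N : 'rV[R]_r -> Prop) (t : 'I_r -> 'X_{1..n})
    (tau : 'I_r -> nat) (V : 'I_r -> {set 'I_n}) : Prop := LinearClass {
  lc_add : forall v w, N v -> N w -> N (v + w);
  lc_scale : forall a v, N v -> N (a *: v);
  lc_ideal : forall v : 'rV[R]_r, (forall k, I (v 0 k)) -> N v;
  lc_inj : injective tau;
  lc_gen : forall k i, i \in V k -> exists f : 'rV[R]_r,
    [/\ N f, forall k', f 0 k' \is 1.-homog, (f 0 k)@_U_(i) = 1
      & leading t tau f k U_(i)];
  lc_lead : forall v k m, N v -> leading t tau v k m ->
    (exists2 i, i \in V k & m i != 0%N) \/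
    exists i j, bad i j /\ (U_(i) + U_(j) <= m)%MM }.

Lemma mcoeff_mulX_neq0 s p m : ('X_[s] * p)@_m != 0 ->
  exists2 m', m = (s + m')%MM & p@_m' != 0.
Proof.
rewrite -mcoeff_msupp mulrC (perm_mem (msuppMX _ _)) => /mapP[m' pm' ->].
by exists m' => //; rewrite -mcoeff_msupp.
Qed.

Lemma mcoeff_mulX s p m : ('X_[s] * p)@_(s + m) = p@_m.
Proof. by rewrite mulrC mcoeffMX. Qed.

Lemma mcoeffB_neq0 p q m : (p - q)@_m != 0 -> p@_m != 0 \/ q@_m != 0.
Proof.
rewrite mcoeffB; have [->|] := eqVneq p@_m 0; last by left.
by rewrite sub0r oppr_eq0; right.
Qed.

Section Step.
Variables (r : nat) (N : 'rV[R]_r -> Prop) (t : 'I_r -> 'X_{1..n}).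
Variables (tau : 'I_r -> nat) (V : 'I_r -> {set 'I_n}).
Hypothesis lc : linear_class N t tau V.

Definition gen_index : {set 'I_r * 'I_n} := [set x | x.2 \in V x.1].
Local Notation r' := #|gen_index|.
Definition gk (rho : 'I_r') : 'I_r := (enum_val rho).1.
Definition gi (rho : 'I_r') : 'I_n := (enum_val rho).2.

Lemma giP rho : gi rho \in V (gk rho).
Proof. by have := enum_valP rho; rewrite inE. Qed.

Lemma gen_indexP k i : i \in V k -> exists rho, gk rho = k /\ gi rho = i.
Proof.
move=> iV; have h : (k, i) \in gen_index by rewrite inE.
by exists (enum_rank_in h (k, i)); rewrite /gk /gi enum_rankK_in.
Qed.

Lemma g_inj rho rho' : gk rho = gk rho' -> gi rho = gi rho' -> rho = rho'.
Proof.
rewrite /gk /gi => e1 e2; apply: enum_val_inj.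
by rewrite [LHS]surjective_pairing e1 e2 -surjective_pairing.
Qed.

Definition t' rho := (U_(gi rho) + t (gk rho))%MM.
Definition tau' rho := (tau (gk rho) * n + gi rho)%N.
(** The leading variables of the syzygies: [x_j] times the generator
    [f_(k, i)] is divisible by another leading term if [x_j x_i] is a bad pair or if
    [f_(k, j)] exists; the order [j < i] keeps one syzygy for each pair. *)
Definition V' rho : {set 'I_n} := [set j | [|| bad (gi rho) j, bad j (gi rho)
  | (j \in V (gk rho)) && (j < gi rho)%N]].

Lemma tau'_lt rho rho' : (tau' rho < tau' rho')%N =
  (tau (gk rho) < tau (gk rho'))%N || (gk rho == gk rho') && (gi rho < gi rho')%N.
Proof.
rewrite /tau'.
have h1 := ltn_ord (gi rho); have h2 := ltn_ord (gi rho').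
by rewrite -(inj_eq (lc_inj lc)); apply: ltn_digit.
Qed.

Lemma tau'_inj : injective tau'.
Proof.
move=> rho rho' e.
have := tau'_lt rho rho'; have := tau'_lt rho' rho; rewrite e ltnn.
move=> /esym/norP[h1 h2] /esym/norP[h3 h4].
have ek : gk rho = gk rho'.
  by apply: (lc_inj lc); case: ltngtP h1 h3.
move: h2 h4; rewrite ek eqxx /= => h2 h4; apply: g_inj => //.
by apply/val_inj; case: ltngtP h2 h4.
Qed.

Lemma gen_rows : exists f : 'I_r' -> 'rV[R]_r, forall rho,
  [/\ N (f rho), forall k, f rho 0 k \is 1.-homog,
    (f rho 0 (gk rho))@_U_(gi rho) = 1
    & leading t tau (f rho) (gk rho) U_(gi rho)].
Proof.
have /choice[f hf] : forall rho, exists g : 'rV[R]_r, [/\ N g,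
    forall k, g 0 k \is 1.-homog, (g 0 (gk rho))@_U_(gi rho) = 1
    & leading t tau g (gk rho) U_(gi rho)].
  by move=> rho; apply: (lc_gen lc); apply: giP.
by exists f.
Qed.

Variable f : 'I_r' -> 'rV[R]_r.
Hypothesis fP : forall rho, [/\ N (f rho), forall k, f rho 0 k \is 1.-homog,
    (f rho 0 (gk rho))@_U_(gi rho) = 1
    & leading t tau (f rho) (gk rho) U_(gi rho)].

Definition rows : 'M[R]_(r', r) := \matrix_(rho, k) f rho 0 k.

Definition below' (w : 'rV[R]_r') K := forall rho m, (w 0 rho)@_m != 0 ->
  key_lt ((m + t' rho)%MM, tau (gk rho)) K.

Lemma rows_mul (w : 'rV[R]_r') k : (w *m rows) 0 k = \sum_rho w 0 rho * f rho 0 k.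
Proof. by rewrite mxE; apply: eq_bigr => rho _; rewrite mxE. Qed.

Lemma sub_leading (v : 'rV[R]_r) s k m (c : int) (f0 : 'rV[R]_r) : 
    leading t tau v k (s + m)%MM -> c = (v 0 k)@_(s + m) ->
    leading t tau f0 k m -> (f0 0 k)@_m = 1 ->
  below t tau (v - (c *: 'X_[s]) *: f0) (tkey t tau k (s + m)%MM).
Proof.
move=> [v0 vl] ec [f0k fl] f1 k' m'; rewrite !mxE -scalerAl.
have key_add k1 m1 k2 m2 : key_lt (tkey t tau k1 m1) (tkey t tau k2 m2) ->
    key_lt (tkey t tau k1 (s + m1)%MM) (tkey t tau k2 (s + m2)%MM).
  by rewrite /key_lt /= -!addmA ltmc_add2r eqm_add2l.
have [[-> ->]|ne] := pselect ((k', m') = (k, (s + m)%MM)).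
  by rewrite mcoeffB mcoeffZ mcoeff_mulX f1 mulr1 ec subrr eqxx.
case/mcoeffB_neq0 => [/vl[]//|].
rewrite mcoeffZ mulf_eq0 => /norP[_ /mcoeff_mulX_neq0[m1 em1 /fl[[e1 e2]|lt]]].
  by case: ne; rewrite em1 e1 e2.
by rewrite em1; apply: key_add.
Qed.

Definition single rho p : 'rV[R]_r' := \row_s (if s == rho then p else 0).

Lemma single_mul rho p : single rho p *m rows = p *: f rho.
Proof.
apply/rowP => k; rewrite rows_mul (bigD1 rho) //= big1 ?addr0 ?mxE ?eqxx //.
by move=> s /negbTE ne; rewrite mxE ne mul0r.
Qed.

Definition quadric_row k p : 'rV[R]_r := \row_k' (if k' == k then p else 0).

Lemma quadric_rowP k i j p : {in msupp p, forall m, (m < (U_(i) + U_(j))%MM)%O} ->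
    I ('X_i * 'X_j - p) ->
  [/\ N (quadric_row k ('X_i * 'X_j - p)),
      leading t tau (quadric_row k ('X_i * 'X_j - p)) k (U_(i) + U_(j))%MM
    & (quadric_row k ('X_i * 'X_j - p) 0 k)@_(U_(i) + U_(j)) = 1].
Proof.
move=> plt pI.
have c1 : ('X_i * 'X_j - p)@_(U_(i) + U_(j)) = 1.
  rewrite mcoeffB -mpolyXD mcoeffX eqxx memN_msupp_eq0 ?subr0 //.
  by apply/negP => /plt; rewrite ltxx.
split; last by rewrite mxE eqxx.
  by apply: (lc_ideal lc) => k'; rewrite mxE; case: eqP.
split; first by rewrite mxE eqxx c1.
move=> k' m'; rewrite mxE; have [->|_] := eqVneq k' k; last by rewrite mcoeff0 eqxx.
case/mcoeffB_neq0; rewrite -?mpolyXD.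
  by rewrite mcoeffX; have [<-|_] := eqVneq (U_(i) + U_(j))%MM m'; [left | rewrite eqxx].
by rewrite -mcoeff_msupp => /plt lt; right; rewrite /key_lt /= ltmc_add2l lt.
Qed.

(** Division with remainder zero, since a leading term that does not come from the
    generators comes from a bad pair, hence from the ideal.  Quotients of a
    homogeneous vector are homogeneous because the generators are linear. *)
Lemma division K v : N v -> below t tau v K -> exists w,
  [/\ below' w K, forall k, I ((v - w *m rows) 0 k)
    & forall d, (forall k, v 0 k \is d.+1.-homog) -> forall rho, w 0 rho \is d.-homog].
Proof.
elim/key_ind: K v => K IH v Nv bv.
have [v0|v0] := eqVneq v 0.
  exists 0; split=> [rho m|k|d _ rho].
  - by rewrite mxE mcoeff0 eqxx.
  - by rewrite v0 mul0mx subrr mxE.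
  - by rewrite mxE rpred0.
have [k [m vl]] := leading_exists t (lc_inj lc) v0.
have K1K := bv k m vl.1; set c := (v 0 k)@_m.
have mdegE d : (forall k, v 0 k \is d.+1.-homog) -> mdeg m = d.+1.
  by move=> /(_ k)/dhomogP; apply; rewrite mcoeff_msupp vl.1.
have [[i iV mi]|[i [j [bij le]]]] := lc_lead lc Nv vl.
  have [rho [ek ei]] := gen_indexP iV; have [Nf fh f1 fl] := fP rho.
  rewrite ek ei in f1 fl; pose s := (m - U_(i))%MM.
  have em : m = (s + U_(i))%MM.
    rewrite submK //; apply/mnm_lepP => u; rewrite mnm1E.
    by case: (eqVneq i u) => [<-|]; rewrite ?lt0n.
  have bv' : below t tau (v - (c *: 'X_[s]) *: f rho) (tkey t tau k m).
    by rewrite em; apply: sub_leading; rewrite -?em.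
  have Nv' : N (v - (c *: 'X_[s]) *: f rho).
    by rewrite -scaleNr; apply: (lc_add lc) => //; apply: (lc_scale lc).
  have [w' [bw iw hw]] := IH _ K1K _ Nv' bv'.
  pose u := single rho (c *: 'X_[s]).
  exists (w' + u); split=> [s' m'|k'|d vh s'].
  - rewrite !mxE mcoeffD; have [w0|/bw lt _] := eqVneq (w' 0 s')@_m' 0; last first.
      exact: key_trans lt K1K.
    rewrite w0 add0r; have [->|_] := eqVneq s' rho; last by rewrite mcoeff0 eqxx.
    rewrite mcoeffZ mcoeffX mulf_eq0 negb_or => /andP[_].
    have [<- _|_] := eqVneq s m'; last by rewrite eqxx.
    by rewrite /t' ei ek addmA -em.
  - by have := iw k'; rewrite mulmxDl single_mul [w' *m _ + _]addrC opprD addrA.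
  - rewrite !mxE rpredD //; last first.
      case: eqP => _; last exact: rpred0.
      rewrite rpredZ // dhomogX /=; have := mdegE d vh.
      by rewrite em mdegD mdeg1 addn1 => -[->].
    apply: hw => k'; rewrite !mxE rpredB // -scalerAl rpredZ //.
    have := mdegE d vh; rewrite em mdegD mdeg1 => e1.
    by rewrite -e1 dhomogM ?dhomogX.
have [q [qh qlt qI]] := quad bij; pose s := (m - (U_(i) + U_(j)))%MM.
have em : m = (s + (U_(i) + U_(j)))%MM by rewrite submK.
have [Nf fl f1] := quadric_rowP k qlt qI; set f0 := quadric_row _ _ in Nf fl f1.
have bv' : below t tau (v - (c *: 'X_[s]) *: f0) (tkey t tau k m).
  by rewrite em; apply: sub_leading; rewrite -?em.
have Nv' : N (v - (c *: 'X_[s]) *: f0).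
  by rewrite -scaleNr; apply: (lc_add lc) => //; apply: (lc_scale lc).
have [w' [bw iw hw]] := IH _ K1K _ Nv' bv'.
exists w'; split=> [s' m' /bw lt|k'|d vh]; first exact: key_trans lt K1K.
  have iq : I ((c *: 'X_[s]) * f0 0 k') by apply: IM; rewrite mxE; case: eqP.
  have := ID (iw k') iq; congr I; rewrite !mxE.
  by move: (\sum_i _) (if _ then _ else _) (c *: _) => *; ring.
apply: hw => k'; rewrite !mxE rpredB // -scalerAl rpredZ //.
case: eqP => _; last by rewrite mulr0 rpred0.
have := mdegE d vh; rewrite em mdegD => e1; rewrite -e1 dhomogM ?dhomogX //.
by rewrite mdegD !mdeg1 rpredB // -mpolyXD dhomogX /= mdegD !mdeg1.
Qed.

Definition syzygy (w : 'rV[R]_r') := forall k, I ((w *m rows) 0 k).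

Lemma leading_mulX (v : 'rV[R]_r) s k m : leading t tau v k m ->
  leading t tau ('X_[s] *: v) k (s + m)%MM.
Proof.
move=> [v0 vl]; split; first by rewrite mxE mcoeff_mulX.
move=> k' m'; rewrite mxE => /mcoeff_mulX_neq0[m1 -> /vl[[-> ->]|lt]]; first by left.
by right; move: lt; rewrite /key_lt /= -!addmA ltmc_add2r eqm_add2l.
Qed.

(** The syzygies come from vectors [v] of lower order that differ from
    [x_j f_rho] by a multiple of another generator or by an element of the ideal:
    dividing [v] completes the syzygy without changing its leading term. *)
Lemma syzygy_gen rho j v (x : 'rV[R]_r') :
    N v -> (forall k, v 0 k \is 2.-homog) ->
    below t tau v (tkey t tau (gk rho) (U_(j) + U_(gi rho))%MM) ->
    (forall k, I (('X_j *: f rho - x *m rows - v) 0 k)) ->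
    (forall s, x 0 s \is 1.-homog) ->
    (forall s m, (x 0 s)@_m != 0 -> key_lt (tkey t' tau' s m) (tkey t' tau' rho U_(j))) ->
  exists g : 'rV[R]_r', [/\ syzygy g, forall s, g 0 s \is 1.-homog,
    (g 0 rho)@_U_(j) = 1 & leading t' tau' g rho U_(j)].
Proof.
move=> Nv vh bv xI xh xb; have [w [bw wI wh]] := division Nv bv.
have {}wh s : w 0 s \is 1.-homog by apply: wh.
have wb s m : (w 0 s)@_m != 0 -> key_lt (tkey t' tau' s m) (tkey t' tau' rho U_(j)).
  move/bw; rewrite /key_lt /= /t' !addmA => /orP[->//|/andP[-> lt]].
  by rewrite (tau'_lt s rho) lt orbT.
have nr s m : key_lt (tkey t' tau' s m) (tkey t' tau' rho U_(j)) ->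
    (s, m) <> (rho, U_(j)%MM).
  by move=> + [es em]; rewrite es em (negbTE (key_irr _)).
have g1 : (((single rho 'X_j - x) - w) 0 rho)@_U_(j) = 1.
  rewrite !mxE eqxx !mcoeffB mcoeffX eqxx.
  have [->|/xb/nr//] := eqVneq (x 0 rho)@_U_(j) 0.
  by have [->|/wb/nr//] := eqVneq (w 0 rho)@_U_(j) 0; rewrite !subr0.
exists (single rho 'X_j - x - w); split=> //.
- move=> k; have e : (single rho 'X_j - x - w) *m rows =
      ('X_j *: f rho - x *m rows - v) + (v - w *m rows).
    by rewrite !mulmxBl single_mul addrA subrK.
  by rewrite e mxE; apply: ID.
- move=> s; rewrite !mxE; apply: rpredB (wh s); apply: rpredB (xh s).
  by have [_|_] := eqVneq s rho; rewrite ?rpred0 // dhomogX /= mdeg1.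
- split=> [|s m]; first by rewrite g1.
  rewrite !mxE => /mcoeffB_neq0[/mcoeffB_neq0[]|/wb]; [|by move/xb; right|by right].
  have [->|_] := eqVneq s rho; last by rewrite mcoeff0 eqxx.
  rewrite mcoeffX; have [<-|_] := eqVneq U_(j)%MM m; first by left.
  by rewrite eqxx.
Qed.

(** The heart of the construction.  Let [w] be a syzygy with leading term
    [m e_rho] that is not divisible by a variable of [V' rho], where [rho] is the
    generator with leading term [x_i e_k].  In coordinate [k] of the product of [w]
    with the generators, all the other contributions are smaller than [m x_i], which
    is thus the leading monomial of an element of the ideal and contains a bad pair.  The
    pair does not involve [i], as its other variable would be in [V' rho]; hence it
    divides [m]. *)
Lemma syzygy_class : linear_class syzygy t' tau' V'.
Proof.
split.
- by move=> v w hv hw k; rewrite mulmxDl mxE; apply: ID.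
- by move=> a v hv k; rewrite -scalemxAl mxE; apply: IM.
- move=> v hv k; rewrite rows_mul; elim/big_ind: _ => // rho _.
  by rewrite mulrC; apply: IM.
- exact: tau'_inj.
- move=> rho j; rewrite inE => jV; have [Nf fh f1 fl] := fP rho.
  have xfl := leading_mulX U_(j) fl.
  have xf1 : (('X_j *: f rho) 0 (gk rho))@_(U_(j) + U_(gi rho)) = 1.
    by rewrite mxE mcoeff_mulX.
  have Nxf : N ('X_j *: f rho) by apply: (lc_scale lc).
  have X1 i : ('X_i : R) \is 1.-homog by rewrite dhomogX /= mdeg1.
  have [/andP[jV' ji]|] := boolP ((j \in V (gk rho)) && (j < gi rho)%N).
    have [s [es ej]] := gen_indexP jV'; have [Ns sh s1 sl] := fP s.
    rewrite es ej in sl s1.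
    pose v := 'X_j *: f rho - (1 *: 'X_(gi rho)) *: f s.
    apply: (@syzygy_gen rho j v (single s 'X_(gi rho))).
    + rewrite /v -scaleNr; apply: (lc_add lc) => //; exact: (lc_scale lc).
    + by move=> k; rewrite /v scale1r !mxE rpredB // -[2%N]/(1 + 1)%N dhomogM.
    + rewrite /v addmC; apply: sub_leading => //; last by rewrite addmC.
      by rewrite addmC.
    + by move=> k; rewrite single_mul /v scale1r subrr mxE.
    + by move=> s'; rewrite mxE; have [_|_] := eqVneq s' s; rewrite ?rpred0.
    + move=> s' m; rewrite mxE; have [->|_] := eqVneq s' s; last by rewrite mcoeff0 eqxx.
      rewrite mcoeffX; have [<- _|_] := eqVneq U_(gi rho)%MM m; last by rewrite eqxx.
      have eA : (U_(gi rho) + (U_(j) + t (gk rho)) = U_(j) + (U_(gi rho) + t (gk rho)))%MM.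
        by rewrite !addmA [(U_(j) + U_(gi rho))%MM]addmC.
      rewrite /key_lt /= /t' es ej eA eqxx /= tau'_lt es ej eqxx ji /=.
      by rewrite !orbT.
  rewrite andbC => nV; have [a [b [bab eab]]] : exists a b, bad a b /\
      (U_(a) + U_(b) = U_(j) + U_(gi rho) :> 'X_{1..n})%MM.
    case/or3P: jV => [bij|bij|]; first by exists (gi rho), j; rewrite addmC.
      by exists j, (gi rho).
    by rewrite andbC (negbTE nV).
  have [q [qh qlt qI]] := quad bab.
  have [Nq ql q1] := quadric_rowP (gk rho) qlt qI; set u := quadric_row _ _ in Nq ql q1.
  pose v := 'X_j *: f rho - (1 *: 'X_[0]) *: u.
  apply: (@syzygy_gen rho j v 0).
  + rewrite /v -scaleNr; apply: (lc_add lc) => //; exact: (lc_scale lc).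
  + move=> k; rewrite /v scale1r mpolyX0 scale1r !mxE rpredB //.
      by rewrite -[2%N]/(1 + 1)%N dhomogM.
    have [_|_] := eqVneq k (gk rho); last exact: rpred0.
    by rewrite rpredB // -mpolyXD dhomogX /= mdegD !mdeg1.
  + rewrite /v -[X in tkey _ _ _ X]add0m; apply: sub_leading; rewrite ?add0m ?xf1 -?eab //.
    by rewrite eab.
  + move=> k; rewrite mul0mx /v scale1r mpolyX0 scale1r subr0 opprB addrC subrK !mxE.
    by have [_|_] := eqVneq k (gk rho).
  + by move=> s; rewrite mxE rpred0.
  + by move=> s m; rewrite mxE mcoeff0 eqxx.
- move=> w rho m Nw [wm wl].
  have [[i [iV mi]]|noV] := pselect (exists i, i \in V' rho /\ m i != 0%N).
    by left; exists i.
  right; set i := gi rho in noV *; set k := gk rho in noV *.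
  have {}noV j : j \in V' rho -> m j = 0%N.
    by move=> jV; apply/eqP; apply: contraT => mj; case: noV; exists j.
  pose T := (m + U_(i))%MM; pose p := (w *m rows) 0 k.
  have main s m1 m2 : (w 0 s)@_m1 != 0 -> (f s 0 k)@_m2 != 0 ->
      ((m1 + m2)%MM < T)%O \/ [/\ s = rho, m1 = m & m2 = U_(i)%MM].
    move=> w1 f2; have [_ _ _ fl] := fP s.
    have hb : (m1 + m2 + t k)%MM = (m1 + (m2 + t k))%MM by rewrite addmA.
    have hc : (T + t k)%MM = (m + t' rho)%MM by rewrite /T /t' addmA.
    have le1 : ((m2 + t k)%MM <= t' s)%O.
      by case: (fl.2 _ _ f2) => [[-> ->]//|/orP[/ltW//|/andP[/= /eqP -> _]]].
    have le2 : ((m1 + t' s)%MM <= (m + t' rho)%MM)%O.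
      by case: (wl _ _ w1) => [[-> ->]//|/orP[/ltW//|/andP[/= /eqP -> _]]].
    have [lt|ge] := boolP ((m1 + m2 + t k)%MM < (T + t k)%MM)%O.
      by left; move: lt; rewrite ltmc_add2l.
    have e12 : (m2 + t k)%MM = t' s.
      apply/eqP; apply: contraNT ge => ne; rewrite hb hc; apply: lt_le_trans le2.
      by rewrite ltmc_add2r lt_neqAle ne.
    have e23 : (m1 + t' s)%MM = (m + t' rho)%MM.
      apply/eqP; apply: contraNT ge => ne; rewrite hb hc e12.
      by rewrite lt_neqAle ne.
    right; have [[ek em2]|] := fl.2 _ _ f2; last first.
      rewrite /key_lt /= e12 ltxx eqxx /= => tk.
      have [[es _]|] := wl _ _ w1; first by rewrite es ltnn in tk.
      rewrite /key_lt /= e23 ltxx eqxx /= tau'_lt => /orP[tk'|/andP[/eqP ek _]].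
        by have := ltn_trans tk tk'; rewrite ltnn.
      by rewrite ek ltnn in tk.
    have [[es em1]|] := wl _ _ w1; first by rewrite em2 es em1.
    rewrite /key_lt /= e23 ltxx eqxx /= tau'_lt -ek ltnn eqxx /= => lt_i.
    have sV : gi s \in V' rho by rewrite inE -/k -/i lt_i andbT ek giP !orbT.
    have := congr1 (fun u : 'X_{1..n} => u (gi s)) e23.
    rewrite /t' -ek -/k -/i !mnmDE !mnm1E eqxx (noV _ sV).
    have /negbTE -> : i != gi s by rewrite -val_eqE /= neq_ltn lt_i orbT.
    by rewrite add0n [(true + _)%N]addnC addnA addn1; lia.
  have leT M p' : {in msupp p', forall u, (u <= M)%O} -> (mlead p' <= M)%O.
    have [->|p0] := eqVneq p' 0; first by rewrite mlead0 le0x.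
    by apply; apply: mlead_supp.
  have pT : p@_T = (w 0 rho)@_m.
    rewrite /p rows_mul raddf_sum (bigD1 rho) //= big1 ?addr0 => [|s ns].
      have [_ _ f1 fl] := fP rho; rewrite mleadcMW.
      - by rewrite f1 mulr1.
      - apply: leT => u; rewrite mcoeff_msupp => /wl[[->]//|].
        by move=> /orP[/ltW|/andP[/= + _]] /=; rewrite ?lemc_add2l // eqm_add2r => /eqP ->.
      - apply: leT => u; rewrite mcoeff_msupp => /fl.2[[->]//|].
        by move=> /orP[/ltW|/andP[/= + _]] /=; rewrite ?lemc_add2l // eqm_add2r => /eqP ->.
    apply/eqP; apply: contraT; rewrite -mcoeff_msupp => /msuppM_le/allpairsP[[m1 m2] /=].
    rewrite !mcoeff_msupp => -[w1 f2 eT]; case: (main _ _ _ w1 f2) => [|[es _ _]].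
      by rewrite -eT ltxx.
    by rewrite es eqxx in ns.
  have Tp : T \in msupp p by rewrite mcoeff_msupp pT.
  have p0 : p != 0 by apply: contraTneq Tp => ->; rewrite msupp0.
  have lp : mlead p = T.
    apply/le_anti; rewrite msupp_le_mlead // andbT; apply: leT => u.
    rewrite /p rows_mul => /msupp_sum_le/flattenP[l /mapP[s _ ->]].
    move=> /msuppM_le/allpairsP[[m1 m2] /=]; rewrite !mcoeff_msupp => -[w1 f2 ->].
    by case: (main _ _ _ w1 f2) => [/ltW//|[_ -> ->]].
  have [a [b [bab le]]] := lead (Nw k) p0; rewrite -/p lp in le.
  exists a, b; split=> //; move/mnm_lepP: le => le.
  have key1 c d : bad c d || bad d c -> (forall u, ((U_(c) + U_(d))%MM u <= T u)%N) ->
      c = i -> False.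
    move=> bcd lecd ci; have dV : d \in V' rho.
      by rewrite inE -/i -ci orbA bcd.
    have := lecd d; rewrite /T !mnmDE !mnm1E eqxx (noV _ dV) ci add0n.
    by rewrite addnC ltnn.
  apply/mnm_lepP => u; have := le u; rewrite /T !mnmDE !mnm1E.
  have [ei|ni] := eqVneq i u; last by rewrite addn0.
  have [ea|na] := eqVneq a u.
    have bab' : bad a b || bad b a by rewrite bab.
    by case: (key1 a b bab' le (etrans ea (esym ei))).
  have [eb|nb] := eqVneq b u => //.
  have bba : bad b a || bad a b by rewrite bab orbT.
  have le' v : ((U_(b) + U_(a))%MM v <= T v)%N by rewrite addmC.
  by case: (key1 b a bba le' (etrans eb (esym ei))).
Qed.

End Step.
End LinearResolution.

(** * Koszulness *)

Section KoszulResolution.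
Local Open Scope ring_scope.
Variables (n : nat) (I : {mpoly int[n]} -> Prop) (bad : rel 'I_n).
Hypotheses (I0 : I 0) (ID : forall p q, I p -> I q -> I (p + q))
  (IM : forall a p, I p -> I (a * p)).
Hypothesis quad : forall i j, bad i j -> exists r : {mpoly int[n]},
  [/\ r \is 2.-homog, {in msupp r, forall m, (m < (U_(i) + U_(j))%MM)%O}
    & I ('X_i * 'X_j - r)].
Hypothesis lead : forall p, I p -> p != 0 ->
  exists i j, bad i j /\ (U_(i) + U_(j) <= mlead p)%MM.
Hypothesis I_const : forall p, I p -> p@_0%MM = 0.
Local Notation R := {mpoly int[n]}.
Implicit Types (p q : R).

Let class r (N : 'rV[R]_r -> Prop) := exists t tau V, linear_class I bad N t tau V.

Definition syzygies r s (D : 'M[R]_(s, r)) : 'rV[R]_s -> Prop :=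
  fun w => forall k, I ((w *m D) 0 k).

Definition presents r s (N : 'rV[R]_r -> Prop) (D : 'M[R]_(s, r)) : Prop :=
  (forall i k, D i k \is 1.-homog) /\
  forall v, N v <-> exists w, forall k, I ((v - w *m D) 0 k).

Lemma class_step r (N : 'rV[R]_r -> Prop) : class N ->
  exists s (D : 'M[R]_(s, r)), presents N D /\ class (syzygies D).
Proof.
move=> [t [tau [V lc]]]; have [f fP] := gen_rows lc.
exists #|gen_index V|, (rows f); split; last first.
  by exists (t' t (V:=V)), (tau' tau (V:=V)), (V' bad (V:=V)); apply: (syzygy_class I0 ID IM quad lead lc fP).
split=> [i k|v]; first by rewrite mxE; case: (fP i).
split=> [Nv|[w hw]].
  have [K bK] : exists K, below t tau v K.
    have [->|v0] := eqVneq v 0.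
      by exists (0%MM, 0%N) => k m; rewrite mxE mcoeff0 eqxx.
    have [k [m [_ vl]]] := leading_exists t (lc_inj lc) v0.
    exists ((m + t k)%MM, (tau k).+1) => k' m' /vl lt.
    apply: (key_le_trans (K2 := tkey t tau k m)); last by rewrite /key_lt /= eqxx ltnSn orbT.
    by case: lt => [[-> ->]|]; [left|right].
  by have [w [_ hw _]] := division I0 ID IM quad lc fP Nv bK; exists w.
rewrite -[v](subrK (w *m rows f)); apply: (lc_add lc); first exact: (lc_ideal lc).
have -> : w *m rows f = \sum_i w 0 i *: f i.
  by apply/rowP => k; rewrite rows_mul summxE; apply: eq_bigr => i _; rewrite mxE.
elim/big_ind: _ => [|*|i _]; last by apply: (lc_scale lc); case: (fP i).
  by apply: (lc_ideal lc) => k; rewrite mxE.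
exact: (lc_add lc).
Qed.

(** A stage of the resolution; the module of relations is kept together with its
    class so that the construction can be iterated. *)
Record stage := Stage {
  stage_rank : nat;
  stage_mod : 'rV[R]_stage_rank -> Prop;
  stage_class : class stage_mod }.

(** The resolution starts from the polynomials without constant term. *)
Lemma augmentation_class : class (fun v : 'rV[R]_1 => (v 0 0)@_0%MM = 0).
Proof.
exists (fun=> 0%MM), (fun=> 0%N), (fun=> setT); split.
- by move=> v w hv hw; rewrite mxE mcoeffD hv hw addr0.
- by move=> a v hv; rewrite mxE rmorphM /= hv mulr0.
- by move=> v vI; apply: I_const.
- by move=> i j _; rewrite !ord1.
- move=> k i _; exists (\row__ 'X_i).
  split=> [|k'||]; rewrite ?mxE ?mcoeffX ?mnm1_eq0 ?eqxx //; first by rewrite dhomogX /= mdeg1.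
  split; first by rewrite mxE mcoeffX eqxx.
  move=> k' m'; rewrite mxE mcoeffX; have [<-|_] := eqVneq U_(i)%MM m'; last by rewrite eqxx.
  by rewrite !ord1; left.
- move=> v k m; rewrite ord1 => v0 [vm _]; left.
  have /existsP[i mi] : [exists i, m i != 0%N].
    apply: contraR vm => /existsPn h; rewrite (_ : m = 0%MM) ?v0 //.
    by apply/mnmP => i; rewrite mnm0E; apply/eqP/negPn/h.
  by exists i; rewrite ?inE.
Qed.

Lemma next_stage (S : stage) : exists T : {T : stage & 'M[R]_(stage_rank T, stage_rank S)},
  presents (stage_mod (s := S)) (projT2 T) /\
  forall w, stage_mod w <-> syzygies (projT2 T) w.
Proof.
have [s [D [DP Dc]]] := class_step (stage_class S).
by exists (existT _ (Stage Dc) D).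
Qed.

Let next S := projT1 (sval (cid (next_stage S))).
Let mat S : 'M[R]_(stage_rank (next S), stage_rank S) := projT2 (sval (cid (next_stage S))).

Fixpoint stages i : stage :=
  if i is i'.+1 then next (stages i') else Stage augmentation_class.

Variables (A : comPzRingType) (W : nat -> A -> Prop) (phi : {rmorphism R -> A}).
Variable eps : {rmorphism A -> int}.
Hypotheses (phi_surj : forall a, exists p, a = phi p)
  (phi_ker : forall p, phi p = 0 <-> I p)
  (W_phi : forall w p, p \is w.-homog -> W w (phi p))
  (eps_phi : forall p, eps (phi p) = p@_0%MM).

(** The basis elements in homological degree [i] all have weight [i], which makes
    the vanishing of [Tor] outside weight [i] immediate. *)
Definition linear_complex : free_complex A := {|
  crank := fun i => stage_rank (stages i);
  cdeg := fun i _ => i;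
  cdiff := fun i => map_mx phi (mat (stages i));
  caug := const_mx 1 |}.

Lemma lift_row r (v : 'rV[A]_r) : exists v', v = map_mx phi v'.
Proof.
have /choice[g hg] : forall k, exists p, v 0 k = phi p by move=> k; apply: phi_surj.
by exists (\row_k g k); apply/rowP => k; rewrite !mxE.
Qed.

Lemma lift_eq r (v w : 'rV[R]_r) : map_mx phi v = map_mx phi w <-> forall k, I ((v - w) 0 k).
Proof.
split=> [/rowP e k|h]; first by apply/phi_ker; have := e k; rewrite !mxE rmorphB => ->; rewrite subrr.
by apply/rowP => k; have /phi_ker := h k; rewrite !mxE rmorphB => /eqP; rewrite subr_eq0 => /eqP.
Qed.

Lemma image_mat S (v : 'rV[R]_(stage_rank S)) :
  stage_mod v <-> exists w, map_mx phi v = w *m map_mx phi (mat S).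
Proof.
have [[_ h] _] := svalP (cid (next_stage S)); rewrite h; split=> [[w /lift_eq hw]|[w]].
  by exists (map_mx phi w); rewrite -map_mxM.
have [w' ->] := lift_row w; rewrite -map_mxM => /lift_eq; by exists w'.
Qed.

Lemma koszul_of_linear_resolution : (forall w a, (0 < w)%N -> W w a -> eps a = 0) -> koszul W.
Proof.
move=> eps_W; exists eps => //; exists linear_complex; split.
- split=> [k|i j k] //=; rewrite leqnSn subSnn mxE; apply: W_phi.
  by have [[h _] _] := svalP (cid (next_stage (stages i))); apply: h.
- split=> /=.
  + by exists (const_mx 1); apply/matrixP => i j; rewrite !ord1 !mxE big_ord1 !mxE rmorph1 mulr1.
  + move=> v; have [v' ->] := lift_row v; rewrite -(image_mat (S := stages 0)) /=.
    have e : (map_mx eps (map_mx phi v') *m const_mx 1 : 'cV_1) 0 0 = (v' 0 0)@_0%MM.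
      by rewrite mxE big_ord1 !mxE mulr1 eps_phi.
    split=> [h|h]; first by rewrite -e h mxE.
    by apply/matrixP => i j; rewrite !ord1 e h mxE.
  + move=> i v; have [v' ->] := lift_row v; rewrite -map_mxM -(image_mat (S := stages i.+1)).
    have [_ ->] := svalP (cid (next_stage (stages i))).
    split=> [/rowP e k|h]; first by apply/phi_ker; have := e k; rewrite mxE [RHS]mxE.
    by apply/rowP => k; rewrite mxE [RHS]mxE; apply/phi_ker/h.
- move=> i w wi v vw _; exists 0 => [k _|]; first by rewrite mxE.
  by rewrite mul0mx; apply/rowP => k; rewrite mxE; apply: vw => /= e; apply: wi.
Qed.

End KoszulResolution.

(** * Antichains with irreducible join *)

Section Antichains.
Local Open Scope order_scope.
Variables (d : Order.disp_t) (L : finTBLatticeType d) (X : nat -> L).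
Hypotheses (Lgeo : geometric L) (Xflag : modular_flag X).
Implicit Types (x y g : L) (k : nat) (A : {set L}).
Local Notation G := (Gmin L).

(** Induction on the level.  Two elements that are new at the same level have an
    irreducible join, so [A] has at most one new element [a], and the meet of the
    join of [A] with the flag is the join of [a_-] and of the other elements.  If
    [a_-] is not [\bot] it may replace [a], by [Gmin_joinl]. *)
Lemma pairwise_join_notin A : A \subset G -> (1 < #|A|)%N ->
    {in A &, forall x y, x != y -> x `|` y \notin G} ->
  \join_(x in A) x \notin G.
Proof.
have [N XN] := flag_top Xflag.
have: {in A, forall x, x <= X N} by move=> x _; rewrite XN lex1.
elim: N A {XN} => [|k IH] A Ak /subsetP AG A1 pw.
  have /card_gt0P[x xA] := ltnW A1; have := Ak x xA; rewrite flag_bot // lex0.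
  by move=> /eqP x0; have := AG x xA; rewrite x0 (negbTE (bot_notin_Gmin L)).
have [Alow|] := boolP [forall x in A, x <= X k].
  by apply: IH => //; [apply/forall_inP|apply/subsetP].
case/forall_inPn=> a aA aN; set B := A :\ a.
have BP b : b \in B -> [/\ b \in A, b != a, a `|` b \notin G & b <= X k].
  rewrite in_setD1 => /andP[ba bA].
  have abG : a `|` b \notin G by apply: pw; rewrite // eq_sym.
  split=> //; apply: contraR abG => bN.
  exact: (Gmin_join_new Lgeo Xflag (AG a aA) (AG b bA) (Ak a aA) (Ak b bA) aN bN).
set g := \join_(x in A) x; apply/negP => gG.
have gE : g = a `|` \join_(x in B) x by rewrite /g (big_setD1 a).
have gk : g `&` X k = (a `&` X k) `|` \join_(x in B) x.
  rewrite gE joinC flag_meet // 1?joinC //.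
  by apply/joinsP => b /BP[].
have [b bB] : exists b, b \in B.
  by apply/card_gt0P; move: A1; rewrite (cardsD1 a) aA.
have [bA ba abG bk] := BP b bB.
have jB : b <= \join_(x in B) x by apply: joins_sup.
have {}gk0 : g `&` X k != \bot.
  rewrite gk -lex0; apply/negP => /(le_trans (leUr _ _))/(le_trans jB).
  by rewrite lex0 => /eqP b0; have := AG b bA; rewrite b0 (negbTE (bot_notin_Gmin L)).
have {gk0} loG : g `&` X k \in G.
  by have [//|h0] := Gmin_meet_flag Lgeo Xflag k gG; rewrite h0 eqxx in gk0.
have [a0|a0] := eqVneq (a `&` X k) \bot.
  rewrite gk a0 join0x in loG; have [B1|B1] := ltnP 1 #|B|.
    suff: \join_(x in B) x \notin G by rewrite loG.
    apply: IH => //; first by move=> x /BP[].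
      by apply/subsetP => x /BP[/AG].
    by move=> x y /BP[xA _ _ _] /BP[yA _ _ _]; apply: pw.
  have eB : B = [set b].
    by apply/esym/eqP; rewrite eqEcard sub1set bB cards1.
  by move: gG; rewrite gE eB big_set1 (negbTE abG).
have aG : a `&` X k \in G.
  by have [//|h0] := Gmin_meet_flag Lgeo Xflag k (AG a aA); rewrite h0 eqxx in a0.
have aBG y : y \in B -> (a `&` X k) `|` y \notin G.
  move=> /BP[yA _ ayG _]; apply: contra ayG.
  exact: (Gmin_joinl Lgeo (AG a aA) (AG y yA) aG (leIl _ _)).
have aB : a `&` X k \notin B by apply/negP => /[dup] /aBG; rewrite joinxx aG.
pose A' := (a `&` X k) |: B.
suff: \join_(x in A') x \notin G by rewrite /A' big_setU1 //= -gk loG.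
apply: IH.
- by move=> x /setU1P[->|/BP[]//]; apply: leIr.
- by apply/subsetP => x /setU1P[->//|/BP[/AG]].
- rewrite cardsU1 aB add1n ltnS; apply/card_gt0P; by exists b.
- move=> x y /setU1P[->|xB] /setU1P[->|yB]; rewrite ?eqxx // => xy.
  + exact: aBG.
  + by rewrite joinC aBG.
  + by have [xA _ _ _] := BP x xB; have [yA _ _ _] := BP y yB; apply: pw.
Qed.

Variables (n : nat) (e : 'I_n -> L) (k : nat) (N : {set L}).
Local Notation h := (hvar e).
Local Notation I := (stratum_ideal X e k N).

(** If [a] and [b] in [A] have irreducible join [c], the product
    [(h g - h a) * (h g - h b)] is a multiple of [h g - h c] modulo the join relation
    of [a] and [b], so that the pair may be replaced by [c]. *)
Lemma antichain_relation A g : A \subset G -> g \in G -> g <= X k ->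
  \join_(x in A) x = g -> I (\prod_(x in A) (h g - h x))%R.
Proof.
have [c] := ubnP #|A|; elim: c => // c IH in A * => cA AG gG gk Ag.
have [A1|A1] := leqP #|A| 1%N.
  have [|] := eqVneq A set0.
    by move=> A0; case/negP: (bot_notin_Gmin L); rewrite -Ag A0 big_set0 in gG.
  rewrite -card_gt0 => A0; have /cards1P[x eA] : #|A| == 1%N by rewrite eqn_leq A1.
  rewrite -Ag eA !big_set1 GRing.subrr; exact: ideal0.
have [a [b [aA bA ab abG]]] : exists a b, [/\ a \in A, b \in A, a != b & a `|` b \in G].
  apply: contraPP gG => nab; apply/negP; rewrite -Ag; apply: pairwise_join_notin => //.
  move=> a b aA bA ab; apply/negP => abG; apply: nab; by exists a, b.
have gle x : x \in A -> x <= g by move=> xA; rewrite -Ag; apply: joins_sup.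
set C := A :\ a :\ b; have bA' : b \in A :\ a by rewrite !inE eq_sym ab.
rewrite (big_setD1 a) //= (big_setD1 b) //= -/C.
have eg : (a `|` b) `|` \join_(x in C) x = g.
  by rewrite -Ag (big_setD1 a aA) /= (big_setD1 b bA') /= joinA.
have AGs := subsetP AG.
have cC : (#|(a `|` b) |: C| < c)%N.
  rewrite cardsU1 -ltnS; apply: leq_trans cA; rewrite ltnS.
  have -> : #|A| = #|C|.+2 by rewrite (cardsD1 a) aA (cardsD1 b) bA'.
  by case: (_ \notin _); rewrite ?add1n ?add0n ?ltnS // ltnW.
have IC : I ((h g - h (a `|` b)) * \prod_(x in C) (h g - h x))%R.
  have jC : \join_(x in (a `|` b) |: C) x = g.
    have [cin|cin] := boolP (a `|` b \in C); last by rewrite big_setU1.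
    by rewrite -eg (join_idPr (joins_sup _ cin)) // (setUidPr _) // sub1set.
  have CG : (a `|` b) |: C \subset G.
    by apply/subsetP => x /setU1P[->//|]; rewrite !in_setD1 => /and3P[_ _ /AGs].
  have IC' := IH _ cC CG gG gk jC.
  have [cin|cin] := boolP (a `|` b \in C); last by rewrite -big_setU1.
  by apply: idealM; move: IC'; rewrite (setUidPr _) // sub1set.
have rel : I ((h (a `|` b) - h a) * (h (a `|` b) - h b))%R.
  apply/ideal_incl/StratumJoin; rewrite ?(AGs a) ?(AGs b) //.
  by apply: le_trans gk; rewrite leUx !gle.
apply: ideal_eq (idealD (idealM ((h g - h a) + (h (a `|` b) - h b))%R IC)
  (idealM (\prod_(x in C) (h g - h x))%R rel)) _.
by move: (\prod_(x in C) _)%R => p; ring.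
Qed.

End Antichains.

(** * The order on the variables *)

Section Enumeration.
Local Open Scope order_scope.
Variables (d : Order.disp_t) (L : finTBLatticeType d) (X : nat -> L).
Hypothesis Xflag : modular_flag X.
Implicit Types (x y : L) (k : nat).

Lemma level_exists x : exists k, x <= X k.
Proof. by have [N XN] := flag_top Xflag; exists N; rewrite XN lex1. Qed.

Definition level x := ex_minn (level_exists x).

Lemma level_le x k : (level x <= k)%N = (x <= X k).
Proof.
rewrite /level; case: ex_minnP => m xm min; apply/idP/idP => [mk|/min//].
exact: le_trans xm (flag_le_trans Xflag mk).
Qed.

Definition down_card x := #|[set y | y <= x]|.

(** Level first; inside a level, elements with more elements below them have a
    smaller key, so that the key decreases along the order of the lattice. *)
Definition variable_key x :=
  (level x * #|L|.+1 + (#|L| - down_card x))%N.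

Lemma variable_key_lt x y :
  (variable_key x < variable_key y)%N = (level x < level y)%N ||
    (level x == level y) && (#|L| - down_card x < #|L| - down_card y)%N.
Proof. by apply: ltn_digit; rewrite ltnS leq_subr. Qed.

Lemma variable_key_level k x y : x <= X k -> ~~ (y <= X k) ->
  (variable_key x < variable_key y)%N.
Proof.
rewrite variable_key_lt -!level_le -ltnNge => xk yk.
by rewrite (leq_ltn_trans xk yk).
Qed.

Lemma variable_key_anti k x y : ~~ (x <= X k) -> y <= X k.+1 -> x < y ->
  (variable_key y < variable_key x)%N.
Proof.
move=> xk yk xy; rewrite variable_key_lt.
have lxy : (level x <= level y)%N.
  by rewrite level_le (le_trans (ltW xy)) // -level_le.
have -> : level y = level x.
  apply/eqP; rewrite eqn_leq lxy andbT; apply: leq_trans (_ : k.+1 <= _)%N.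
    by rewrite level_le.
  by rewrite ltnNge level_le.
rewrite ltnn eqxx /=.
have sub : [set z | z <= x] \proper [set z | z <= y].
  apply/properP; split.
    by apply/subsetP => z; rewrite !inE => /le_trans; apply; apply: ltW.
  by exists y; rewrite !inE ?lexx // lt_geF.
by apply: ltn_sub2l (proper_card sub); apply: leq_trans (proper_card sub) (max_card _).
Qed.

(** The variables are listed by decreasing key, since in the degree-lexicographic
    order a smaller index is a larger variable. *)
Lemma variable_enumeration : exists n (e : 'I_n -> L),
  [/\ injective e,
      forall i, (e i \in Gmin L) && ~~ is_atom (e i),
      forall x, x \in Gmin L -> ~~ is_atom x -> exists i, e i = x,
      forall k i j, e i <= X k -> ~~ (e j <= X k) -> (j < i)%N
    & forall k i j, ~~ (e i <= X k) -> e j <= X k.+1 -> e i < e j -> (i < j)%N].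
Proof.
pose r : rel L := fun x y => (variable_key y <= variable_key x)%N.
pose s := sort r (enum [set x in Gmin L | ~~ is_atom x]).
have s_mem x : (x \in s) = (x \in Gmin L) && ~~ is_atom x.
  by rewrite mem_sort mem_enum inE.
have s_uniq : uniq s by rewrite sort_uniq enum_uniq.
pose e (i : 'I_(size s)) := tnth (in_tuple s) i.
have e_s i : e i \in s by apply: mem_tnth.
have r_trans : transitive r by move=> x y z xy yz; apply: leq_trans yz xy.
have s_sorted : sorted r s by apply: sort_sorted => x y; rewrite /r leq_total.
have e_key i j : (variable_key (e i) < variable_key (e j))%N -> (j < i)%N.
  apply: contraLR; rewrite -!leqNgt => ij.
  rewrite /e !(tnth_nth \bot) /=.
  by apply: (sorted_leq_nth r_trans) => //; [move=> x; apply: leqnn | | ]; rewrite inE.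
exists (size s), e; split.
- move=> i j; rewrite /e !(tnth_nth \bot) /= => /eqP.
  by rewrite nth_uniq // => /eqP/val_inj.
- by move=> i; rewrite -s_mem.
- move=> x xG xa; have xs : x \in s by rewrite s_mem xG.
  have xi : (index x s < size s)%N by rewrite index_mem.
  by exists (Ordinal xi); rewrite /e (tnth_nth \bot) /= nth_index.
- by move=> k i j ik jk; apply: e_key; apply: variable_key_level ik jk.
- by move=> k i j ik jk ij; apply: e_key; apply: variable_key_anti ik jk ij.
Qed.

End Enumeration.

(** * Presentations by polynomial rings *)

Section PolynomialMorphisms.
Local Open Scope ring_scope.

Lemma rmorph_mpoly_ext n (A : comPzRingType) (f g : {rmorphism {mpoly int[n]} -> A}) :
  (forall i, f 'X_i = g 'X_i) -> f =1 g.
Proof.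
move=> fg p; rewrite [p]mpolyE !raddf_sum; apply: eq_bigr => m _.
have -> : p@_m *: 'X_[m] = 'X_[m] *~ p@_m :> {mpoly int[n]}.
  by rewrite -scaler_int intz.
rewrite !raddfMz mpolyXE_id /= !rmorph_prod; congr (_ *~ _).
by apply: eq_bigr => i _; rewrite !rmorphXn fg.
Qed.

Lemma comp_mpoly_homog n k (lq : n.-tuple {mpoly int[k]}) d p :
    (forall i, tnth lq i \is 1.-homog) -> p \is d.-homog -> p \mPo lq \is d.-homog.
Proof.
move=> lqh /dhomogP ph; rewrite comp_mpolyEX big_seq rpred_sum // => m /ph /= <-.
rewrite rpredZ // comp_mpolyX mdegE.
elim: index_enum => [|i s IHs]; first by rewrite !big_nil dhomog1.
rewrite !big_cons dhomogM //; have := dhomogMn (m i) (lqh i); by rewrite mul1n.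
Qed.

Lemma ideal_kernel (R : comNzRingType) (A : pzRingType) (S : R -> Prop)
  (f : {rmorphism R -> A}) p : (forall q, S q -> f q = 0) -> ideal S p -> f p = 0.
Proof.
move=> h; elim=> {p} [|p /h//|p q _ hp _ hq|a p _ hp]; first exact: rmorph0.
  by rewrite rmorphD hp hq addr0.
by rewrite rmorphM hp mulr0.
Qed.

Lemma gen_idealP (R : comNzRingType) (S : R -> Prop) p : p \in gen_ideal S <-> ideal S p.
Proof.
split=> [/asboolP[s sS ->]|].
  elim: s sS => [|u s IH] sS; first by rewrite big_nil; apply: ideal0.
  rewrite big_cons; apply: idealD; last by apply: IH => v vs; apply: sS; rewrite inE vs orbT.
  by apply/idealM/ideal_incl/sS; rewrite mem_head.
elim=> {p} [|p Sp|p q _ hp _ hq|a p _ hp]; [exact: rpred0| |exact: rpredD|exact: gen_idealMr].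
by apply/asboolP; exists [:: (1, p)] => [u|]; rewrite ?inE ?big_seq1 ?mul1r // => /eqP ->.
Qed.

Lemma quot_pi0P (R : comNzRingType) (S : R -> Prop) p : quot_pi S p = 0 <-> ideal S p.
Proof.
by rewrite -gen_idealP; have := quot_piP S p 0; rewrite subr0 rmorph0.
Qed.

Lemma quot_pi_surj (R : comNzRingType) (S : R -> Prop) (a : quot_ring S) :
  exists p, a = quot_pi S p.
Proof. by exists (repr a); rewrite /quot_pi reprK. Qed.

(** The universal property of the quotient, through which the augmentation is
    constructed. *)
Lemma quot_lift (R : comNzRingType) (S : R -> Prop) (A : pzRingType)
    (f : {rmorphism R -> A}) : (forall p, S p -> f p = 0) ->
  exists g : {rmorphism quot_ring S -> A}, forall p, g (quot_pi S p) = f p.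
Proof.
move=> fS; pose g (a : quot_ring S) := f (repr a).
have gE p : g (quot_pi S p) = f p.
  apply/eqP; rewrite -subr_eq0 -rmorphB; apply/eqP/(ideal_kernel fS)/quot_pi0P.
  by rewrite rmorphB /= {1}/quot_pi reprK subrr.
have gB : zmod_morphism g.
  move=> a b; have [p ->] := quot_pi_surj a; have [q ->] := quot_pi_surj b.
  by rewrite -rmorphB !gE rmorphB.
have gM : monoid_morphism g.
  split=> [|a b]; first by rewrite -(rmorph1 (quot_pi S)) gE rmorph1.
  have [p ->] := quot_pi_surj a; have [q ->] := quot_pi_surj b.
  by rewrite -rmorphM !gE rmorphM.
pose gZ := GRing.isZmodMorphism.Build _ _ g gB.
pose gR := GRing.isMonoidMorphism.Build _ _ g gM.
pose gg : {rmorphism quot_ring S -> A} := HB.pack g gZ gR.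
by exists gg.
Qed.

Lemma ideal_homogeneous n d (S : {mpoly int[n]} -> Prop) p w :
  (forall q, S q -> q \is d.-homog) -> ideal S p -> ideal S (pihomog mdeg w p).
Proof.
move=> Sh Ip; elim: Ip w => {p} [w|p Sp w|p q _ hp _ hq w|a p _ hp w].
- by rewrite pihomog0; apply: ideal0.
- have [<-|ne] := eqVneq d w; first by rewrite pihomog_dE ?Sh //; apply: ideal_incl.
  by rewrite (pihomog_ne0 ne (Sh p Sp)); apply: ideal0.
- by rewrite pihomogD; apply: idealD.
rewrite [a]mpolyE mulr_suml raddf_sum; elim/big_ind: _ => [|*|m _].
- exact: ideal0.
- exact: idealD.
rewrite [p](pihomog_partitionE (leqnn (mmeasure mdeg p))) mulr_sumr raddf_sum.
elim/big_ind: _ => [|*|d' _] /=; [exact: ideal0|exact: idealD|].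
have h : (a@_m *: 'X_[m]) * pihomog mdeg d' p \is (mdeg m + d').-homog.
  by rewrite dhomogM ?pihomogP // rpredZ // dhomogX.
have [<-|ne] := eqVneq (mdeg m + d')%N w; first by rewrite pihomog_dE //; apply: idealM.
by rewrite (pihomog_ne0 ne h); apply: ideal0.
Qed.

End PolynomialMorphisms.

(** * Groebner bases from leading monomials *)

Section GroebnerBasis.
Local Open Scope ring_scope.
Variables (n : nat) (I : {mpoly int[n]} -> Prop) (bad : rel 'I_n).
Hypothesis quad : forall i j, bad i j -> exists r : {mpoly int[n]},
  [/\ r \is 2.-homog, {in msupp r, forall m, (m < (U_(i) + U_(j))%MM)%O}
    & I ('X_i * 'X_j - r)].
Hypothesis lead : forall p, I p -> p != 0 ->
  exists i j, bad i j /\ (U_(i) + U_(j) <= mlead p)%MM.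

Definition degree_lex : rel 'X_{1..n} := fun m1 m2 => (m1 <= m2)%O.

Lemma degree_lex_order : monomial_order degree_lex.
Proof.
split.
- exact: le_total.
- exact: le_anti.
- exact: le_trans.
- exact: le0m.
- by move=> m1 m2 m; rewrite /degree_lex lemc_add2l.
Qed.

Lemma lead_mon_mlead p m : lead_mon degree_lex p m -> p != 0 /\ m = mlead p.
Proof.
move=> [pm pmax]; have p0 : p != 0 by apply: contraTneq pm => ->; rewrite msupp0.
by split=> //; apply/le_anti; rewrite msupp_le_mlead //=; apply: pmax; rewrite mlead_supp.
Qed.

Lemma quadratic_groebner_basis : exists gb : seq {mpoly int[n]},
  {in gb, forall g, g \is 2.-homog} /\ groebner_basis degree_lex I gb.
Proof.
have /choice[r rP] : forall ij : 'I_n * 'I_n, exists r : {mpoly int[n]},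
    bad ij.1 ij.2 -> [/\ r \is 2.-homog,
      {in msupp r, forall m, (m < (U_(ij.1) + U_(ij.2))%MM)%O}
      & I ('X_ij.1 * 'X_ij.2 - r)].
  move=> ij; have [/quad[r h]|] := boolP (bad ij.1 ij.2); first by exists r.
  by exists 0.
pose q ij := 'X_ij.1 * 'X_ij.2 - r ij.
have q_lead ij : bad ij.1 ij.2 ->
    lead_mon degree_lex (q ij) (U_(ij.1) + U_(ij.2))%MM /\ (q ij)@_(U_(ij.1) + U_(ij.2)) = 1.
  move=> b; have [_ lt _] := rP ij b.
  have q1 : (q ij)@_(U_(ij.1) + U_(ij.2)) = 1.
    rewrite mcoeffB -mpolyXD mcoeffX eqxx memN_msupp_eq0 ?subr0 //.
    by apply/negP => /lt; rewrite ltxx.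
  split=> //; split=> [|m]; first by rewrite mcoeff_msupp q1.
  move=> /msuppB_le; rewrite mem_cat -mpolyXD msuppX inE => /orP[/eqP ->|mr].
    exact: lexx.
  exact/ltW/lt.
exists [seq q ij | ij <- enum [pred ij | bad ij.1 ij.2]]; split.
  move=> g /mapP[ij]; rewrite mem_enum => b ->; have [rh _ _] := rP ij b.
  by rewrite rpredB // -mpolyXD dhomogX /= mdegD !mdeg1.
split=> [g /mapP[ij]|g /mapP[ij]|p m Ip /lead_mon_mlead[p0 ->]].
- by rewrite mem_enum => b ->; have [_ _] := rP ij b.
- rewrite mem_enum => b ->; have [ql q1] := q_lead ij b.
  by exists (U_(ij.1) + U_(ij.2))%MM => //; left.
- have [i [j [b le]]] := lead Ip p0.
  exists (q (i, j)), (U_(i) + U_(j))%MM; split=> //.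
    by apply: map_f; rewrite mem_enum.
  by have [] := q_lead (i, j) b.
Qed.

End GroebnerBasis.

(** * The Feichtner-Yuzvinsky ring of the irreducible elements *)

Section Presentation.
Local Open Scope ring_scope.
Variables (d : Order.disp_t) (L : finTBLatticeType d) (X : nat -> L).
Hypotheses (Lgeo : geometric L) (Xflag : modular_flag X).
Variables (n : nat) (e : 'I_n -> L).
Hypotheses (e_inj : injective e)
  (e_Gmin : forall i, (e i \in Gmin L) && ~~ is_atom (e i))
  (e_surj : forall x, x \in Gmin L -> ~~ is_atom x -> exists i, e i = x).
Variable M : nat.
Hypothesis XM : X M = \top%O.
Local Notation G := (Gmin L).
Local Notation h := (hvar e).
Local Notation I := (stratum_ideal X e M set0).

Lemma e_in_G i : e i \in G. Proof. by case/andP: (e_Gmin i). Qed.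

Definition G_index i : 'I_#|G| := enum_rank_in (e_in_G i) (e i).

Lemma G_indexK i : enum_val (G_index i) = e i.
Proof. exact: enum_rankK_in (e_in_G i). Qed.

(** The two substitutions pass between the variables [X_j] for all irreducible
    elements and those for the elements that are not atoms. *)
Definition nonatom_vars : n.-tuple {mpoly int[#|G|]} := [tuple 'X_(G_index i) | i < n].
Definition value_vars : #|G|.-tuple {mpoly int[n]} := [tuple h (enum_val j) | j < #|G|].

Definition FY_map : {rmorphism {mpoly int[n]} -> FY G} :=
  (quot_pi (@wond_rel d L G) \o comp_mpoly nonatom_vars).

Lemma FY_mapX i : FY_map 'X_i = quot_pi _ 'X_(G_index i).
Proof. by rewrite /FY_map /= comp_mpolyXU -tnth_nth tnth_mktuple. Qed.

Lemma value_varsX j : 'X_j \mPo value_vars = h (enum_val j).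
Proof. by rewrite comp_mpolyXU -tnth_nth tnth_mktuple. Qed.

Lemma FY_map_hvar j : FY_map (h (enum_val j)) = quot_pi _ 'X_j.
Proof.
have [ja|jN] := boolP (is_atom (enum_val j : L)).
  rewrite (hvar_atom e_Gmin ja) rmorph0; apply/esym/quot_pi0P/ideal_incl.
  exact: WondAtom.
have [i ei] := e_surj (enum_valP j) jN.
rewrite -ei (hvar_e e_inj) FY_mapX; congr (quot_pi _ 'X__).
by apply: enum_val_inj; rewrite G_indexK.
Qed.

Lemma nonatom_varsK p : (p \mPo nonatom_vars) \mPo value_vars = p.
Proof.
apply: (rmorph_mpoly_ext (f := (comp_mpoly value_vars \o comp_mpoly nonatom_vars))
  (g := idfun)) => i /=.
by rewrite comp_mpolyXU -tnth_nth tnth_mktuple value_varsX G_indexK hvar_e.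
Qed.

Lemma value_varsK p : FY_map (p \mPo value_vars) = quot_pi _ p.
Proof.
apply: (rmorph_mpoly_ext (f := (FY_map \o comp_mpoly value_vars))
  (g := quot_pi (@wond_rel d L G))) => j /=.
by rewrite value_varsX -FY_map_hvar.
Qed.

Lemma FY_map_surj a : exists p, a = FY_map p.
Proof.
by have [p ->] := quot_pi_surj a; exists (p \mPo value_vars); rewrite value_varsK.
Qed.

Lemma hvar_homog x : h x \is 1.-homog.
Proof. by apply: rpred_sum => i _; rewrite dhomogX /= mdeg1. Qed.

Lemma FY_map_weight w a :
  FY_weight G w a <-> exists2 p, p \is w.-homog & a = FY_map p.
Proof.
split=> [[p ph ->]|[p ph ->]].
  exists (p \mPo value_vars); last by rewrite value_varsK.
  by apply: comp_mpoly_homog => // j; rewrite tnth_mktuple hvar_homog.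
exists (p \mPo nonatom_vars) => //.
by apply: comp_mpoly_homog => // j; rewrite tnth_mktuple dhomogX /= mdeg1.
Qed.

Lemma stratum_rel_FY p : stratum_rel X e M set0 p -> FY_map p = 0.
Proof.
case=> [a b aG bG abG _|f a]; last by rewrite inE.
have index x : x \in G -> exists j : 'I_#|G|, enum_val j = x.
  by move=> xG; exists (enum_rank_in xG x); rewrite enum_rankK_in.
have [i ei] := index _ aG; have [j ej] := index _ bG; have [c ec] := index _ abG.
have [ab|ab] := boolP (a <= b)%O.
  by rewrite (join_idPr ab) subrr mulr0 rmorph0.
have [ba|ba] := boolP (b <= a)%O.
  by rewrite (join_idPl ba) subrr mul0r rmorph0.
rewrite rmorphM !rmorphB -ec -ei -ej !FY_map_hvar -!rmorphB -rmorphM.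
apply/quot_pi0P/ideal_incl; have ij : i != j.
  by apply: contraNneq ab => eij; rewrite -ei -ej eij lexx.
have big2 (T : Type) (idx : T) (op : Monoid.com_law idx) (F : 'I_#|G| -> T) :
    \big[op/idx]_(k in [set i; j]) F k = op (F i) (F j).
  by rewrite big_setU1 ?inE //= big_set1.
have -> : ('X_c - 'X_i) * ('X_c - 'X_j) =
    \prod_(k in [set i; j]) ('X_c - 'X_k) :> {mpoly int[#|G|]} by rewrite big2.
apply: WondAntichain; last by rewrite big2 ei ej ec.
apply/forall_inP => k /set2P[]->; apply/forall_inP => l /set2P[]->; rewrite ?eqxx ?ij //=.
  by rewrite ei ej /Order.comparable (negbTE ab).
by rewrite eq_sym ij ei ej /Order.comparable (negbTE ab) (negbTE ba).
Qed.

(** One inclusion holds because a pair of incomparable irreducible elements is an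
    antichain, the other one by [antichain_relation]. *)
Lemma FY_map_kernel p : FY_map p = 0 <-> I p.
Proof.
split=> [/quot_pi0P pI|]; last exact: ideal_kernel stratum_rel_FY.
rewrite -[p]nonatom_varsK; elim: pI => {p} [|p||].
- by rewrite comp_mpoly0; apply: ideal0.
- case=> [i ia|i A _ jA].
    by rewrite value_varsX (hvar_atom e_Gmin ia); apply: ideal0.
  rewrite rmorph_prod; have -> : \prod_(j in A) (('X_i - 'X_j) \mPo value_vars) =
      \prod_(x in [set enum_val j | j in A]) (h (enum_val i) - h x).
    rewrite big_imset /=; last by move=> j k _ _; apply: enum_val_inj.
    by apply: eq_bigr => j _; rewrite raddfB /= !value_varsX.
  apply: (antichain_relation Lgeo Xflag).
  + by apply/subsetP => x /imsetP[j _ ->]; apply: enum_valP.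
  + exact: enum_valP.
  + by rewrite XM lex1.
  + by rewrite big_imset //=; move=> j k _ _; apply: enum_val_inj.
- by move=> p q _ hp _ hq; rewrite comp_mpolyD; apply: idealD.
- by move=> a p _ hp; rewrite rmorphM; apply: idealM.
Qed.

(** The constant term vanishes on the defining relations: an antichain with
    irreducible join is not empty, so its product has a factor without constant
    term. *)
Lemma augmentation_exists : exists eps : {rmorphism FY G -> int},
  forall p, eps (quot_pi _ p) = p@_0%MM.
Proof.
have X0 k : ('X_k : {mpoly int[#|G|]})@_0%MM = 0 by rewrite mcoeffX mnm1_eq0.
apply: (quot_lift (f := mcoeff 0%MM)) => p [i _|i A _ jA]; first exact: X0.
have /set0Pn[j jA'] : A != set0.
  apply: contraTneq (enum_valP i) => A0; move: jA; rewrite A0 big_set0 => <-.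
  exact: bot_notin_Gmin.
by rewrite (bigD1 j) //= rmorphM /= mcoeffB !X0 subrr mul0r.
Qed.

Hypotheses
  (e_level : forall k i j, (e i <= X k)%O -> ~~ (e j <= X k)%O -> (j < i)%N)
  (e_anti : forall k i j, ~~ (e i <= X k)%O -> (e j <= X k.+1)%O -> (e i < e j)%O ->
    (i < j)%N).
Local Notation bad := (bad_pair X e M).

Lemma bad_pair_small i j : bad i j -> exists r : {mpoly int[n]},
  [/\ r \is 2.-homog, {in msupp r, forall m, (m < (U_(i) + U_(j))%MM)%O}
    & I ('X_i * 'X_j - r)].
Proof.
move/(bad_pair_quadric Lgeo Xflag e_inj e_Gmin e_level e_anti XM).
by case=> r [rh lt] rI; exists r.
Qed.

Lemma bad_pair_lead p : I p -> p != 0 ->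
  exists i j, bad i j /\ (U_(i) + U_(j) <= mlead p)%MM.
Proof.
apply: (lead_bad (@ideal0 _ _) (@idealD _ _) (@idealM _ _)).
  by move=> i j /bad_pair_small[r [_ lt] rI]; exists r.
exact: (no_bad_pair_independent Lgeo Xflag e_inj e_Gmin e_surj e_level e_anti XM).
Qed.

Lemma stratum_ideal_homogeneous p w : I p -> I (pihomog mdeg w p).
Proof.
apply: (ideal_homogeneous (d := 2)) => q [a b _ _ _ _|f a]; last by rewrite inE.
by rewrite -[2%N]/(1 + 1)%N dhomogM ?rpredB ?hvar_homog.
Qed.

Lemma FY_quadratic_groebner : admits_quadratic_groebner_basis (FY_weight G).
Proof.
exists n, FY_map; split.
- exact: FY_map_surj.
- exact: FY_map_weight.
- by move=> p w /FY_map_kernel/stratum_ideal_homogeneous => /(_ w)/FY_map_kernel.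
have quad i j : bad i j -> exists r : {mpoly int[n]},
    [/\ r \is 2.-homog, {in msupp r, forall m, (m < (U_(i) + U_(j))%MM)%O}
      & FY_map ('X_i * 'X_j - r) = 0].
  by move=> /bad_pair_small[r [? ? /FY_map_kernel ?]]; exists r.
have lead p : FY_map p = 0 -> p != 0 ->
  exists i j, bad i j /\ (U_(i) + U_(j) <= mlead p)%MM.
  by move/FY_map_kernel/bad_pair_lead.
have [gb [gbh gbG]] := quadratic_groebner_basis quad lead.
by exists (@degree_lex n), gb; split=> //; apply: degree_lex_order.
Qed.

Lemma FY_koszul : koszul (FY_weight G).
Proof.
have [eps epsE] := augmentation_exists.
have eps_map p : eps (FY_map p) = p@_0%MM.
  rewrite /FY_map /= epsE.
  apply: (rmorph_mpoly_ext (f := (mcoeff 0%MM \o comp_mpoly nonatom_vars))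
    (g := mcoeff 0%MM)) => i /=.
  by rewrite comp_mpolyXU -tnth_nth tnth_mktuple !mcoeffX !mnm1_eq0.
have I_const p : I p -> p@_0%MM = 0 by move=> /FY_map_kernel p0; rewrite -eps_map p0 rmorph0.
apply: (koszul_of_linear_resolution (@ideal0 _ _) (@idealD _ _) (@idealM _ _)
  bad_pair_small bad_pair_lead I_const (phi := FY_map) (eps := eps)) => //.
- exact: FY_map_surj.
- exact: FY_map_kernel.
- by move=> w p ph; apply/FY_map_weight; exists p.
- move=> w a w0 [p ph ->]; rewrite epsE.
  by apply: (dhomog_nemf_coeff ph); rewrite /= mdeg0 neq_ltn w0.
Qed.

End Presentation.

Theorem theorem1p4 (d : Order.disp_t) (L : finTBLatticeType d)
    (Lgeo : geometric L) (Lss : supersolvable L) :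
  admits_quadratic_groebner_basis (FY_weight (Gmin L)) /\
  koszul (FY_weight (Gmin L)).
Proof.
have [D Dmax Ddistr] := Lss.
have Xflag := max_chain_flag Lgeo Dmax (max_chain_left_modular Ddistr).
have [n [e [e_inj e_Gmin e_surj e_level e_anti]]] := variable_enumeration Xflag.
have [M XM] := flag_top Xflag.
split; first exact: (FY_quadratic_groebner Lgeo Xflag e_inj e_Gmin e_surj XM e_level e_anti).
exact: (FY_koszul Lgeo Xflag e_inj e_Gmin e_surj XM e_level e_anti).
Qed.
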